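(* Let $d \ge 1$ be an integer, let $\alpha > 0$ and $0 < \delta < \infty$. There exists a constant $C > 0$, depending on $\alpha$, $d$ and $\delta$, such that for every $u \in W^{\alpha,1}(\mathbb{R}^d)$, $$\int_{\mathbb{R}^d} \mathcal{M}_\delta u \, \mathrm{d}\operatorname{cap}_{W^{\alpha,1}} \leq C\|u\|_{W^{\alpha,1}(\mathbb{R}^d)}.$$
   Context: Functions are real-valued. For $k \in \mathbb{N} = \{0,1,2,\ldots\}$, $W^{k,1}(\mathbb{R}^d)$ is the space of $u \in L^1(\mathbb{R}^d)$ with weak derivatives $D^i u \in L^1(\mathbb{R}^d, \mathbb{R}^{d^i})$ for $i \in \{1,\ldots,k\}$, with norm $\|u\|_{W^{k,1}(\mathbb{R}^d)} := \sum_{i=0}^{k} \|D^i u\|_{L^1(\mathbb{R}^d)}$, $D^0u := u$. For non-integer $\alpha > 0$, write $\alpha = k + \theta$ with $k \in \mathbb{N}$ and $0 < \theta < 1$; then $u \in W^{\alpha,1}(\mathbb{R}^d)$ if $u \in W^{k,1}(\mathbb{R}^d)$ and $$\|u\|_{W^{\alpha,1}(\mathbb{R}^d)} := \|u\|_{W^{k,1}(\mathbb{R}^d)} + \int_{\mathbb{R}^d}\int_{\mathbb{R}^d} \frac{|D^k u(x) - D^k u(y)|}{|x-y|^{\theta+d}} \,\mathrm{d}x\,\mathrm{d}y$$ is finite. The Sobolev capacity of a compact set $K \subset \mathbb{R}^d$ is $$\operatorname{cap}_{W^{\alpha,1}}(K) := \inf\{ \|\varphi\|_{W^{\alpha,1}(\mathbb{R}^d)}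 : \varphi \in C_c^\infty(\mathbb{R}^d),\ \varphi \ge 0 \text{ in } \mathbb{R}^d,\ \varphi > 1 \text{ on } K\},$$ and for an open set $\omega \subset \mathbb{R}^d$, $\operatorname{cap}_{W^{\alpha,1}}(\omega) := \sup\{\operatorname{cap}_{W^{\alpha,1}}(K) : K \subset \omega \text{ compact}\}$. The local maximal function $\mathcal{M}_\delta u : \mathbb{R}^d \to [0,+\infty]$ is $$\mathcal{M}_\delta u(x) := \sup\left\{ \frac{1}{|B_r(x)|}\int_{B_r(x)} |u| : 0 < r \leq \delta \right\},$$ where $B_r(x)$ is the ball of radius $r$ centered at $x$ and $|B_r(x)|$ its Lebesgue measure. The Choquet integral is $\int_{\mathbb{R}^d} \mathcal{M}_\delta u \, \mathrm{d}\operatorname{cap}_{W^{\alpha,1}} := \int_0^\infty \operatorname{cap}_{W^{\alpha,1}}(\{\mathcal{M}_\delta u > t\}) \, \mathrm{d}t$ (the sets $\{\mathcal{M}_\delta u > t\}$ are open). *)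

(* Defs.v *)
From HB Require Import structures.
From mathcomp Require Import all_boot all_order all_algebra.
From mathcomp Require Import all_classical all_reals all_analysis.

Set Implicit Arguments.
Unset Strict Implicit.
Unset Printing Implicit Defensive.

Import Order.TTheory GRing.Theory Num.Theory.
Import numFieldNormedType.Exports.

Local Open Scope classical_set_scope.
Local Open Scope ring_scope.

(* R^d is 'rV[R]_d: its topology and normed-module structure are the library
   ones (the norm is the sup norm, so the Euclidean norm is defined apart), and
   it receives the product sigma-algebra of the Borel sets of R, which is the
   Borel sigma-algebra of R^d. Elements of L^1 are thus Borel representatives;
   nothing below depends on the choice of representative. *)

Definition rV_display : measure_display.
Proof. exact: default_measure_display. Qed.

Section measurable_rV.
Variables (R : realType) (d : nat).

Let coord (i : 'I_d) (x : 'rV[R]_d) : R := x ord0 i.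

Let rV_set0 : g_sigma_preimage coord set0.
Proof. exact: sigma_algebra0. Qed.

Let rV_setC A : g_sigma_preimage coord A -> g_sigma_preimage coord (~` A).
Proof. exact: sigma_algebraC. Qed.

Let rV_bigcup (F : (set 'rV[R]_d)^nat) :
  (forall i, g_sigma_preimage coord (F i)) ->
  g_sigma_preimage coord (\bigcup_i (F i)).
Proof. exact: sigma_algebra_bigcup. Qed.

HB.instance Definition _ := @isMeasurable.Build rV_display
  'rV[R]_d (g_sigma_preimage coord) rV_set0 rV_setC rV_bigcup.

Lemma measurable_coord (i : 'I_d) :
  measurable_fun [set: 'rV[R]_d] (fun x : 'rV[R]_d => x ord0 i).
Proof.
move=> _ Y mY; rewrite setTI; apply: sub_sigma_algebra => /=.
rewrite -bigcup_seq/=; exists i => /=; first by rewrite mem_index_enum.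
by exists Y => //; rewrite setTI.
Qed.

Lemma measurable_fun_rV d1 (T : measurableType d1) (f : T -> 'rV[R]_d) :
  (forall i, measurable_fun [set: T] (fun x => f x ord0 i)) ->
  measurable_fun [set: T] f.
Proof.
move=> mf; apply: measurability => //.
move=> _ [A + <-]; rewrite -bigcup_seq/= => -[i _ [B mB <-]].
rewrite setTI; have := mf i measurableT B mB.
by rewrite !setTI.
Qed.

End measurable_rV.

Section lebesgue_measure_rV.
Variable R : realType.

Definition rV_cons d (p : measurableTypeR R * 'rV[R]_d) : 'rV[R]_d.+1 :=
  \row_i (if unlift ord0 i is Some j then p.2 ord0 j else p.1).

Lemma rV_consE d (p : measurableTypeR R * 'rV[R]_d) :
  (rV_cons p ord0 ord0 = p.1) *
  (forall i, rV_cons p ord0 (lift ord0 i) = p.2 ord0 i).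
Proof.
by split=> [|i]; rewrite mxE ?unlift_none ?liftK.
Qed.

Lemma measurable_rV_cons d : measurable_fun setT (@rV_cons d).
Proof.
apply: measurable_fun_rV => i; have [j ->|->] := unliftP ord0 i.
  apply: (eq_measurable_fun (fun p : _ * 'rV[R]_d => p.2 ord0 j)).
    by move=> p _; rewrite rV_consE.
  exact: (measurableT_comp (measurable_coord j)).
apply: (eq_measurable_fun (fun p : measurableTypeR R * 'rV[R]_d => p.1 : R)).
  by move=> p _; rewrite rV_consE.
exact: measurable_fst.
Qed.

Section step.
Variable d : nat.
Variable m : {sigma_finite_measure set 'rV[R]_d -> \bar R}.

(* The image of the product of the Lebesgue measure of R and m under the
   identification R * R^d = R^(d + 1). *)
Definition rV_extend : set 'rV[R]_d.+1 -> \bar R :=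
  pushforward (@lebesgue_measure R \x m)%E (@rV_cons d).

Let mpre A : measurable A -> measurable (@rV_cons d @^-1` A).
Proof. by move=> mA; rewrite -[X in measurable X]setTI; exact: measurable_rV_cons. Qed.

Let ext0 : rV_extend set0 = 0%E.
Proof. by rewrite /rV_extend /pushforward preimage_set0 measure0. Qed.

Let ext_ge0 A : (0 <= rV_extend A)%E.
Proof. by rewrite /rV_extend /pushforward; exact: measure_ge0. Qed.

Let ext_sigma_additive : semi_sigma_additive rV_extend.
Proof.
move=> F mF tF mUF; rewrite /rV_extend /pushforward preimage_bigcup.
apply: measure_semi_sigma_additive.
- by move=> n; exact: mpre.
- apply/trivIsetP => /= i j _ _ ij; rewrite -preimage_setI.
  by move/trivIsetP : tF => /(_ _ _ _ _ ij) ->//; rewrite preimage_set0.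
- by rewrite -preimage_bigcup; exact: mpre.
Qed.

HB.instance Definition _ := isMeasure.Build _ _ _ rV_extend
  ext0 ext_ge0 ext_sigma_additive.

Let uncons (x : 'rV[R]_d.+1) : measurableTypeR R * 'rV[R]_d :=
  (x ord0 ord0, \row_i x ord0 (lift ord0 i)).

Let uncons_cons : cancel (@rV_cons d) uncons.
Proof.
move=> [a v]; rewrite /uncons rV_consE; congr pair.
by apply/rowP => i; rewrite mxE rV_consE.
Qed.

Let measurable_uncons : measurable_fun setT uncons.
Proof.
apply/measurable_fun_pairP; split; first exact: measurable_coord.
apply: measurable_fun_rV => i.
apply: (eq_measurable_fun (fun x : 'rV[R]_d.+1 => x ord0 (lift ord0 i))).
  by move=> x _; rewrite mxE.
exact: measurable_coord.
Qed.

Let ext_sigma_finite : sigma_finite setT rV_extend.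
Proof.
have /sigma_finiteP[F [TF ndF Foo]] := sigma_finiteT (@lebesgue_measure R).
have /sigma_finiteP[G [TG ndG Goo]] := sigma_finiteT m.
exists (fun n => uncons @^-1` (F n `*` G n)).
  rewrite predeqE => x; split => // _.
  have [[k _ Fk] [l _ Gl]] :
      (\bigcup_n F n) (uncons x).1 /\ (\bigcup_n G n) (uncons x).2.
    by rewrite -TF -TG.
  exists (maxn k l) => //; split.
  - by move: Fk; exact/subsetPset/ndF/leq_maxl.
  - by move: Gl; exact/subsetPset/ndG/leq_maxr.
move=> n; have [mF Fn] := Foo n; have [mG Gn] := Goo n; split.
  rewrite -[X in measurable X]setTI.
  by apply: measurable_uncons => //; exact: measurableX.
rewrite /rV_extend /pushforward -comp_preimage.
rewrite (_ : uncons \o _ = id); last by apply/funext => p; exact: uncons_cons.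
by rewrite preimage_id product_measure1E// lte_mul_pinfty// ge0_fin_numE.
Qed.

HB.instance Definition _ := Measure_isSigmaFinite.Build _ _ _ rV_extend
  ext_sigma_finite.

End step.

Fixpoint lebesgue_rV d : {sigma_finite_measure set 'rV[R]_d -> \bar R} :=
  if d is d'.+1 then rV_extend (lebesgue_rV d') else \d_(0 : 'rV[R]_0).

Lemma lebesgue_rV_box d (A : 'I_d -> set (measurableTypeR R)) :
  (forall i, measurable (A i)) ->
  lebesgue_rV d [set x | forall i, A i (x ord0 i)] =
  (\prod_(i < d) lebesgue_measure (A i))%E.
Proof.
elim: d A => [|d IHd] A mA /=.
  by rewrite big_ord0 diracE mem_set//= => -[].
have mB : measurable [set x : 'rV[R]_d | forall i, A (lift ord0 i) (x ord0 i)].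
  rewrite (_ : [set x | _] =
      \bigcap_(i in [set: 'I_d]) (fun x : 'rV[R]_d => x ord0 i) @^-1` A (lift ord0 i)).
    apply: fin_bigcap_measurable => [|i _]; first exact: finite_finset.
    by rewrite -[X in measurable X]setTI; exact: (measurable_coord i measurableT (mA _)).
  by apply/seteqP; split=> x /= Ax i => [_|]; exact: Ax.
rewrite big_ord_recl -(IHd (fun i => A (lift ord0 i)))//.
rewrite -product_measure1E// /rV_extend /pushforward.
congr (product_measure1 _ _ _); apply/seteqP; split=> p /= => [Ap|[Ap0 Ap] i].
  by split=> [|i]; [have := Ap ord0|have := Ap (lift ord0 i)]; rewrite rV_consE.
by have [j ->|->] := unliftP ord0 i; rewrite rV_consE.
Qed.

End lebesgue_measure_rV.

Section sobolev.
Context {R : realType} {d : nat}.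
Implicit Types (u phi : 'rV[R]_d -> R) (x y : 'rV[R]_d) (K w : set 'rV[R]_d).
Implicit Types (k : nat) (alpha theta delta : R).

Local Notation mu := (lebesgue_rV R d).

Definition enorm x : R := Num.sqrt (\sum_(i < d) x ord0 i ^+ 2).

Definition eball x (r : R) : set 'rV[R]_d := [set y | enorm (y - x) < r].

(* For s = [:: i1; ...; ik], the partial derivative d/dx_i1 ... d/dx_ik phi. *)
Definition partial phi (s : seq 'I_d) : 'rV[R]_d -> R :=
  foldr (fun i f => 'D_(delta_mx ord0 i) f) phi s.

Definition smooth phi :=
  forall s : seq 'I_d, continuous (partial phi s) /\
    forall (i : 'I_d) x, derivable (partial phi s) x (delta_mx ord0 i).

Definition test_function phi :=
  smooth phi /\ compact (closure [set x | phi x != 0]).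

(* A field of k-tensors is given by its d ^ k components, indexed by k-tuples
   of coordinates; tnorm is the Euclidean norm of R^(d^k). *)
Definition tensor k := k.-tuple 'I_d -> R.

Definition tnorm k (a : tensor k) : R :=
  Num.sqrt (\sum_(s : k.-tuple 'I_d) a s ^+ 2).

Definition integrable_weak_derivative k u (g : 'rV[R]_d -> tensor k) :=
  forall s : k.-tuple 'I_d,
    mu.-integrable setT (fun x => (g x s)%:E) /\
    forall phi, test_function phi ->
      \int[mu]_x (u x * partial phi s x) = (-1) ^+ k * \int[mu]_x (g x s * phi x).

(* D^k u, for u having integrable weak derivatives of order k: these are
   unique almost everywhere, and D^0 u is u itself. *)
Definition weak_derivative k u : 'rV[R]_d -> tensor k :=
  if k is 0 then fun x _ => u x
  else xget (fun _ _ => 0) [set g | integrable_weak_derivative u g].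
Arguments weak_derivative k u : clear implicits.

Definition int_sobolev k u :=
  mu.-integrable setT (EFin \o u) /\
  forall i, (1 <= i <= k)%N ->
    exists g : 'rV[R]_d -> tensor i, integrable_weak_derivative u g.

Definition int_sobolev_norm k u : \bar R :=
  (\sum_(i < k.+1) \int[mu]_x (tnorm (weak_derivative i u x))%:E)%E.

Definition gagliardo k theta u : \bar R :=
  (\int[mu]_y \int[mu]_x
    (tnorm (weak_derivative k u x \- weak_derivative k u y) /
     enorm (x - y) `^ (theta + d%:R))%:E)%E.

Definition sobolev_norm alpha u : \bar R :=
  let k := Num.truncn alpha in
  let theta := alpha - k%:R in
  (int_sobolev_norm k u + if theta == 0%R then 0 else gagliardo k theta u)%E.

Definition sobolev alpha u :=
  int_sobolev (Num.truncn alpha) u /\ (sobolev_norm alpha u < +oo)%E.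

Definition compact_cap alpha K : \bar R :=
  ereal_inf [set sobolev_norm alpha phi | phi in
    [set phi | [/\ test_function phi, forall x, 0 <= phi x &
                   forall x, K x -> 1 < phi x]]].

Definition cap alpha w : \bar R :=
  ereal_sup [set compact_cap alpha K | K in [set K | compact K /\ K `<=` w]].

Definition local_maximal delta u x : \bar R :=
  ereal_sup [set ((mu (eball x r))^-1 * \int[mu]_(y in eball x r) `|u y|%:E)%E
            | r in `]0, delta]].

Definition choquet (c : set 'rV[R]_d -> \bar R) (f : 'rV[R]_d -> \bar R) : \bar R :=
  (\int[lebesgue_measure]_(t in `]0%R, +oo[) c [set x | t%:E < f x])%E.

End sobolev.

Arguments weak_derivative {R d} k u.

(* Main.v *)
Require Import Defs.
From HB Require Import structures.
From mathcomp Require Import all_boot all_order all_algebra.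
From mathcomp Require Import ring lra zify.
Set Implicit Arguments.
Unset Strict Implicit.
Unset Printing Implicit Defensive.
Import Order.TTheory GRing.Theory Num.Theory.
Local Open Scope ring_scope.

(* All functions are discretised on finite dyadic grids. For each derivative of
   u, the increments of its averages from one dyadic level to the next are
   controlled by the next derivative (through traces on faces of cubes), and at
   the top order by the Gagliardo seminorm, or by a stopping-time and coarea
   argument when alpha is an integer. Hence the cell averages of |u| are bounded
   by a sum of lambda_Q 1_Q over dyadic cubes with
   sum_Q lambda_Q side(Q)^(d - alpha) <= C |u|. This class of bounds is stable
   under the dyadic maximal function, because spreading lambda_Q over the
   ancestors of Q and their neighbours only costs a geometric series. Where such a
   sum exceeds a level t, the first dyadic level at which its partial sums exceed
   t gives disjoint stopping cubes; smooth bumps adapted to them show that the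
   capacity is at most C sum side(Q)^(d - alpha) over stopping cubes, and
   integrating in t recovers sum_Q lambda_Q side(Q)^(d - alpha). Compact subsets
   of {M u > t} are captured by all fine enough grids, so Fatou's lemma passes to
   the limit of the mesh. *)

(** A weak derivative is only known through its integrals against test functions, whereas the
    estimates concern |u| and the absolute values of the derivatives. No chain rule is used: the
    sign of an integrable v is approximated by signs constant on small dyadic cubes
    ([dyadic_approximation]), and the comparison of adjacent cubes passes from v to |v|. At an
    integer order, adding up the increments of all levels by the trace inequality alone gives a
    bound that grows with the number of levels; this is why the last derivative is spent on stopping
    times and coarea. Capacity is never handled as a subadditive set function: one finite
    combination of bumps is tested on each compact set and its norm is bounded term by term. That
    norm is defined through chosen weak derivatives, so the proof includes their uniqueness almost
    everywhere ([vanishing]). Two conditions make the limit of the grids possible: no constant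
    depends on the grid, and the box grows while the mesh shrinks. Positivity of alpha enters
    through 2^alpha > 1, which makes the geometric series over the levels converge. *)

Section geometric_sums.
Variable R : realFieldType.

Lemma geom_sum_le (q : R) n : 1 < q ->
  \sum_(i < n.+1) q ^+ i <= q / (q - 1) * q ^+ n.
Proof.
move=> q1; have q10 : 0 < q - 1 by lra.
rewrite mulrAC ler_pdivlMr// mulrC -subrX1 -exprS lerBlDr lerDl//.
Qed.

Lemma geom_half_sum_le m n : \sum_(m <= i < n) (2^-1 : R) ^+ i <= 2 * 2^-1 ^+ m.
Proof.
have [nm|mn] := leqP n m.
  by rewrite big_geq// mulr_ge0// exprn_ge0// invr_ge0.
suff : \sum_(m <= i < n) (2^-1 : R) ^+ i = 2 * 2^-1 ^+ m - 2 * 2^-1 ^+ n.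
  by move=> ->; rewrite lerBlDr lerDl mulr_ge0// exprn_ge0// invr_ge0.
elim: n mn => // n IHn; rewrite ltnS leq_eqVlt => /predU1P[->|mn].
  by rewrite big_nat1 exprS; field.
by rewrite big_nat_recr/= 1?ltnW// IHn// exprS; field.
Qed.

End geometric_sums.

(** * Averages over nested partitions, and domination by weighted sums over cells *)

Section dyadic_averages.
Variables (R : realFieldType) (G : finType) (n B : nat) (r : nat -> rel G).
Hypothesis r_refl : forall j, reflexive (r j).
Hypothesis r_sym : forall j, symmetric (r j).
Hypothesis r_trans : forall j, transitive (r j).
Hypothesis r_le : forall i j x y, (i <= j <= n)%N -> r j x y -> r i x y.
Hypothesis r_card : forall j x, (j <= n)%N -> #|[pred y | r j x y]| = (B ^ (n - j))%N.
Hypothesis B_gt0 : (0 < B)%N.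

Implicit Types (f g : G -> R) (c C q : R).

(** A cell of level j < n has [B] children, and the cells of level n are single points; sizes are
    counted in points. *)
Definition csize j : R := (B ^ (n - j))%:R.

Definition avg j (f : G -> R) x : R := (csize j)^-1 * \sum_(y | r j x y) f y.

Lemma avgE j f x : avg j f x = (csize j)^-1 * \sum_(y | r j x y) f y.
Proof. by []. Qed.

Lemma csize_gt0 j : 0 < csize j.
Proof. by rewrite ltr0n expn_gt0 B_gt0. Qed.

Lemma csizeV_ge0 j : 0 <= (csize j)^-1.
Proof. by rewrite invr_ge0 ltW// csize_gt0. Qed.

Let csize_neq0 j : csize j != 0.
Proof. by rewrite gt_eqF// csize_gt0. Qed.

Lemma csizeS j : (j < n)%N -> csize j = B%:R * csize j.+1.
Proof. by move=> jn; rewrite /csize -natrM -expnS -subSn. Qed.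

Lemma rl j x y : r j x y -> r j x =1 r j y.
Proof.
move=> xy z; apply/idP/idP => [|yz]; last exact: r_trans yz.
by apply: r_trans; rewrite r_sym.
Qed.

Lemma avg_ge0 j f x : (forall y, 0 <= f y) -> 0 <= avg j f x.
Proof.
by move=> f0; rewrite mulr_ge0 ?csizeV_ge0// sumr_ge0.
Qed.

Lemma ler_avg j f g x : (forall y, r j x y -> f y <= g y) -> avg j f x <= avg j g x.
Proof.
move=> fg; rewrite ler_wpM2l ?csizeV_ge0//.
exact: ler_sum.
Qed.

Lemma eq_avg j f g x : (forall y, r j x y -> f y = g y) -> avg j f x = avg j g x.
Proof. by move=> fg; congr (_ * _); exact: eq_bigr. Qed.

Lemma avg_inv j f x y : r j x y -> avg j f x = avg j f y.
Proof. by move=> xy; congr (_ * _); apply: eq_bigl; exact: rl. Qed.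

Lemma avg_cst j c x : (j <= n)%N -> avg j (fun=> c) x = c.
Proof.
move=> jn; rewrite /avg sumr_const r_card// -mulr_natl mulrA mulVf ?mul1r//.
Qed.

Lemma avgD j f g x : avg j (fun y => f y + g y) x = avg j f x + avg j g x.
Proof. by rewrite /avg big_split mulrDr. Qed.

Lemma avgN j f x : avg j (fun y => - f y) x = - avg j f x.
Proof. by rewrite /avg sumrN mulrN. Qed.

Lemma avgB j f g x : avg j (fun y => f y - g y) x = avg j f x - avg j g x.
Proof. by rewrite avgD avgN. Qed.

Lemma avgZ j c f x : avg j (fun y => c * f y) x = c * avg j f x.
Proof. by rewrite /avg -mulr_sumr mulrCA. Qed.

Lemma avg_sum j (I : Type) (s : seq I) (Q : pred I) (f : I -> G -> R) x :
  avg j (fun y => \sum_(i <- s | Q i) f i y) x = \sum_(i <- s | Q i) avg j (f i) x.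
Proof. by rewrite /avg exchange_big mulr_sumr. Qed.

Lemma ler_norm_avg j f x : `|avg j f x| <= avg j (fun y => `|f y|) x.
Proof.
rewrite normrM gtr0_norm ?invr_gt0 ?csize_gt0//.
by rewrite ler_wpM2l ?csizeV_ge0// ler_norm_sum.
Qed.

Lemma avg_id j f x : (j <= n)%N -> (forall y, r j x y -> f y = f x) -> avg j f x = f x.
Proof. by move=> jn fx; rewrite (eq_avg fx) avg_cst. Qed.

Lemma avg_last f x : avg n f x = f x.
Proof.
apply: avg_id => // y xy.
have := r_card x (leqnn n); rewrite subnn expn0 => /eqP/card1P[z zP].
have := zP y; have := zP x; rewrite !inE xy r_refl => /esym/eqP<- /esym/eqP-> //.
Qed.

Lemma sum_avg j f : (j <= n)%N -> \sum_x avg j f x = \sum_x f x.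
Proof.
move=> jn; rewrite /avg -mulr_sumr (exchange_big_dep xpredT)//= mulr_sumr; apply: eq_bigr => y _.
rewrite sumr_const -mulr_natl (_ : #|_| = (B ^ (n - j))%N).
  by rewrite mulrA mulVf ?mul1r//.
by rewrite -(r_card y)//; apply: eq_card => x; rewrite !inE r_sym.
Qed.

Lemma avg_avg i j f x : (i <= j <= n)%N -> avg i (avg j f) x = avg i f x.
Proof.
move=> /[dup] ijn /andP[ij jn]; congr (_ * _).
rewrite /avg -mulr_sumr (exchange_big_dep (r i x))/=; last first.
  by move=> y z ixy jyz; apply: r_trans ixy _; exact: r_le jyz.
rewrite mulr_sumr; apply: eq_bigr => z ixz.
rewrite sumr_const -mulr_natl (_ : #|_| = (B ^ (n - j))%N).
  by rewrite mulrA mulVf ?mul1r//.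
rewrite -(r_card z)//; apply: eq_card => y; rewrite !inE [r j z y]r_sym.
apply/andP/idP => [[]//|jyz]; split => //.
by apply: r_trans ixz _; rewrite r_sym; apply: r_le jyz.
Qed.

Lemma avg_avg_ge i j f x : (i <= j <= n)%N -> avg j (avg i f) x = avg i f x.
Proof.
move=> /andP[ij jn]; apply: avg_id => // y xy; apply: avg_inv.
by rewrite r_sym; apply: r_le xy; rewrite ij.
Qed.

Lemma avgS_le j f x : (j < n)%N -> (forall y, 0 <= f y) ->
  avg j.+1 f x <= B%:R * avg j f x.
Proof.
move=> jn f0; rewrite /avg mulrA (csizeS jn) invfM mulVKf ?pnatr_eq0 -?lt0n//.
rewrite ler_wpM2l ?csizeV_ge0//.
rewrite [leRHS](bigID (r j.+1 x))/=.
rewrite [X in _ <= X + _](eq_bigl (r j.+1 x)); last first.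
  move=> y; apply/andP/idP => [[]//|xy]; split => //.
  by apply: r_le xy; rewrite leqnSn.
by rewrite lerDl sumr_ge0.
Qed.

(* [domin q f c]: f is dominated by a sum of functions [Lam j] that are constant
   on the cells of level j, with total mass at most c when the cells of level j
   carry the weight q ^ j. *)
Definition domin (q : R) (f : G -> R) (c : R) :=
  exists Lam : nat -> G -> R,
    [/\ forall j x, 0 <= Lam j x,
        forall j x y, r j x y -> Lam j x = Lam j y,
        forall x, f x <= \sum_(j < n.+1) Lam j x &
        \sum_(j < n.+1) q ^+ j * \sum_x Lam j x <= c].

Lemma domin_le q f f' c c' : domin q f c ->
  (forall x, f' x <= f x) -> c <= c' -> domin q f' c'.
Proof.
move=> [Lam [L0 Linv fL Lc]] ff' cc'; exists Lam; split => //.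
- by move=> x; exact: le_trans (ff' x) (fL x).
- exact: le_trans Lc cc'.
Qed.

Lemma domin0 q : domin q (fun=> 0) 0.
Proof.
exists (fun=> fun=> 0); split => //.
- by move=> x; rewrite big1.
- by rewrite big1// => i _; rewrite big1 ?mulr0.
Qed.

Lemma dominD q f g c d : domin q f c -> domin q g d ->
  domin q (fun x => f x + g x) (c + d).
Proof.
move=> [L [L0 Linv fL Lc]] [M [M0 Minv fM Md]].
exists (fun j x => L j x + M j x); split.
- by move=> j x; rewrite addr_ge0.
- by move=> j x y xy; rewrite (Linv _ _ y)// (Minv _ _ y).
- by move=> x; rewrite big_split lerD.
- rewrite [leLHS](_ : _ = \sum_(j < n.+1) q ^+ j * \sum_x L j x +
    \sum_(j < n.+1) q ^+ j * \sum_x M j x) ?lerD//.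
  by rewrite -big_split; apply: eq_bigr => j _; rewrite big_split mulrDr.
Qed.

Lemma dominZ q f c a : 0 <= a -> domin q f c -> domin q (fun x => a * f x) (a * c).
Proof.
move=> a0 [L [L0 Linv fL Lc]].
exists (fun j x => a * L j x); split.
- by move=> j x; rewrite mulr_ge0.
- by move=> j x y xy; rewrite (Linv _ _ y).
- by move=> x; rewrite -mulr_sumr ler_wpM2l.
- rewrite [leLHS](_ : _ = a * \sum_(j < n.+1) q ^+ j * \sum_x L j x) ?ler_wpM2l//.
  by rewrite mulr_sumr; apply: eq_bigr => j _; rewrite -mulr_sumr mulrCA.
Qed.

Lemma telescope_avg f x m : (m <= n)%N ->
  f x = avg m f x + \sum_(m <= j < n) (avg j.+1 f x - avg j f x).
Proof. by move=> mn; rewrite telescope_sumr// avg_last addrC subrK. Qed.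

(** The increment from level j to level j + 1 is constant on cells of level j + 1, so its absolute
    value can serve as [Lam] there. The bound is useful when the increments are summable against the
    weights, as a Gagliardo seminorm guarantees. *)
Lemma domin_haar q f : (forall x, 0 <= f x) ->
  domin q f (\sum_x f x +
    \sum_(j < n) q ^+ j.+1 * \sum_x `|avg j.+1 f x - avg j f x|).
Proof.
move=> f0.
exists (fun j => if j is i.+1 then
          if (i < n)%N then fun x => `|avg i.+1 f x - avg i f x| else fun=> 0
        else avg 0 f); split.
- move=> [x|j x]; first exact: avg_ge0.
  by case: ifP.
- move=> [|j] x y xy; first exact: avg_inv.
  case: ifP => // jn; rewrite (avg_inv f xy) (_ : avg j f x = avg j f y)//.
  by apply: avg_inv; apply: r_le xy; rewrite leqnSn.
- move=> x; rewrite [leLHS](telescope_avg _ _ (leq0n n)) big_ord_recl lerD2l.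
  rewrite big_mkord ler_sum// => j _ /=; rewrite ltn_ord.
  exact: ler_norm.
- rewrite big_ord_recl/= expr0 mul1r sum_avg// lerD2l ler_sum// => j _.
  by rewrite ltn_ord.
Qed.

(* If the increments of the averages of f are controlled by those of g, then f
   gains one order over g: the part of g coarser than level j telescopes, and
   the finer part is averaged. *)
Lemma domin_lift q f g c C : 1 < q -> 0 <= C -> (forall x, 0 <= f x) ->
  (forall j x, (j < n)%N ->
     avg j.+1 f x <= avg j f x + C * 2^-1 ^+ j * avg j g x) ->
  domin q g c -> domin (2 * q) f (\sum_x f x + C * (2 + q / (q - 1)) * c).
Proof.
move=> q1 C0 f0 fg [L [L0 Linv gL Lc]].
have q0 : 0 < q by lra.
(* A part [L i] with i <= j is constant on cells of level j, and the coefficients 2^-j with j >= i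
   sum to at most 2 times 2^-i: hence the factor 2 in front of [L j]. The parts finer than j enter
   through their averages. *)
pose M j x := (if j == 0%N then avg 0 f x else 0) +
  C * 2^-1 ^+ j * (2 * L j x + \sum_(i < n.+1 | (j < i)%N) avg j (L i) x).
have f_le x : f x <= avg 0 f x + \sum_(0 <= j < n) C * 2^-1 ^+ j * avg j g x.
  rewrite [leLHS](telescope_avg _ _ (leq0n n)) lerD2l.
  apply: ler_sum_nat => j /andP[_ jn]; rewrite lerBlDl; exact: fg.
have gavg j x : (j <= n)%N -> avg j g x <=
    \sum_(i < n.+1 | (i <= j)%N) L i x + \sum_(i < n.+1 | (j < i)%N) avg j (L i) x.
  move=> jn; apply: (le_trans (ler_avg (fun y _ => gL y))).
  rewrite avg_sum (bigID (fun i : 'I__ => (i <= j)%N))/=.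
  under [X in _ + X]eq_bigl do rewrite -ltnNge.
  rewrite lerD2r ler_sum// => i ij; rewrite avg_id// => y xy.
  by apply/esym/Linv; apply: r_le xy; rewrite ij.
have S0 j x : 0 <= \sum_(i < n.+1 | (j < i)%N) avg j (L i) x.
  by rewrite sumr_ge0// => i _; apply: avg_ge0.
have S1 j x : 0 <= \sum_(i < n.+1 | (i <= j)%N) L i x by rewrite sumr_ge0.
have h0 j : 0 <= (2^-1 : R) ^+ j by rewrite exprn_ge0// invr_ge0.
have swap (F : 'I_n.+1 -> 'I_n.+1 -> R) (Q : rel nat) :
    \sum_(j < n.+1) \sum_(i < n.+1 | Q i j) F i j =
    \sum_(i < n.+1) \sum_(j < n.+1 | Q i j) F i j.
  by rewrite (exchange_big_dep xpredT).
exists M; split.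
- move=> j x; rewrite addr_ge0//; first by case: ifP => // _; exact: avg_ge0.
  by rewrite mulr_ge0 ?mulr_ge0 ?addr_ge0 ?mulr_ge0.
- move=> j x y xy; rewrite /M (Linv _ _ _ xy); congr (_ + _ * (_ + _)).
    by case: ifP => // /eqP j0; apply: avg_inv; rewrite -j0.
  by apply: eq_bigr => i _; exact: avg_inv.
- move=> x; apply: (le_trans (f_le x)).
  rewrite [X in _ <= X]big_split/=; apply: lerD; first by rewrite big_ord_recl/= lerDl sumr_ge0.
  apply: (@le_trans _ _ (\sum_(j < n.+1) C * 2^-1 ^+ j *
    (\sum_(i < n.+1 | (i <= j)%N) L i x + \sum_(i < n.+1 | (j < i)%N) avg j (L i) x))).
    rewrite big_mkord [leRHS]big_ord_recr/= -[leLHS]addr0 lerD//; last first.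
      by rewrite !mulr_ge0 ?addr_ge0.
    by apply: ler_sum => j _; rewrite ler_wpM2l ?mulr_ge0// gavg// ltnW.
  rewrite (eq_bigr (fun j : 'I__ => \sum_(i < n.+1 | (i <= j)%N) C * 2^-1 ^+ j * L i x +
     C * 2^-1 ^+ j * \sum_(i < n.+1 | (j < i)%N) avg j (L i) x)); last first.
    by move=> j _; rewrite mulrDr mulr_sumr.
  rewrite big_split/= (swap (fun i j : 'I__ => C * 2^-1 ^+ j * L i x) (fun i j => (i <= j)%N)).
  rewrite -big_split/= ler_sum// => i _; rewrite mulrDr lerD2r.
  rewrite -mulr_suml mulrA ler_wpM2r// -mulr_sumr -mulrA ler_wpM2l//.
  rewrite mulrC (le_trans _ (geom_half_sum_le R i n.+1))// big_geq_mkord//.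
(* The weight (2 q)^j meets the factor 2^-j of [M] and leaves q^j: this is the order gained. *)
- rewrite (eq_bigr (fun j : 'I__ => (if val j == 0%N then \sum_x f x else 0) +
     C * (2 * (q ^+ j * \sum_x L j x) +
      \sum_(i < n.+1 | (j < i)%N) q ^+ j * \sum_x L i x))); last first.
    move=> j _; rewrite big_split/= mulrDr; congr (_ + _).
      have [->|] := eqVneq (val j) 0%N; first by rewrite expr0 mul1r /= sum_avg.
      by rewrite big1 ?mulr0.
    rewrite -mulr_sumr big_split/= -mulr_sumr exprMn.
    rewrite exchange_big/=.
    rewrite (eq_bigr (fun i : 'I__ => \sum_x L i x)); last first.
      by move=> i ji; rewrite sum_avg// -ltnS.
    rewrite -mulr_sumr.
    have e : (2 : R) ^+ j * 2^-1 ^+ j = 1 by rewrite -exprMn mulfV ?expr1n// pnatr_eq0.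
    rewrite -[RHS]mul1r -[X in _ = X * _]e; ring.
  rewrite big_split/= lerD//; first by rewrite big_ord_recl/= -[leRHS]addr0 lerD2l big1.
  rewrite -mulr_sumr -mulrA ler_wpM2l// big_split/= mulrDl lerD//.
    by rewrite -mulr_sumr ler_wpM2l.
  (* [L i] is averaged at every level j < i; the weights q^j of these levels add up to at most q /
     (q - 1) times q^i. *)
  rewrite (swap (fun i j : 'I__ => q ^+ j * \sum_x L i x) (fun i j => (j < i)%N)).
  apply: (@le_trans _ _ (\sum_(i < n.+1) q / (q - 1) * (q ^+ i * \sum_x L i x))); last first.
    by rewrite -mulr_sumr ler_wpM2l// divr_ge0 ?subr_ge0// ltW.
  apply: ler_sum => i _; rewrite -mulr_suml mulrA ler_wpM2r ?sumr_ge0//.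
  apply: le_trans (geom_sum_le _ q1).
  rewrite (big_ord_widen n.+1 (fun j => q ^+ j))// [leRHS](bigID (fun j : 'I__ => (j < i)%N))/=.
  rewrite [X in _ <= X + _](eq_bigl (fun j : 'I__ => (j < i)%N)); last first.
    by move=> j; rewrite ltnS; case: ltngtP.
  by rewrite lerDl sumr_ge0// => j _; rewrite exprn_ge0// ltW.
Qed.

(** * Total variation on the grid: stopping cells and coarea *)

Section total_variation.
Variables (e : rel G) (C : R).

(** Difference quotients along oriented edges, in units where a cell of level 0 has side 1 and the
    finest mesh is 2^-n. *)
Definition grad (f : G -> R) x : R := 2 ^+ n * \sum_(y | e x y) `|f x - f y|.

Hypothesis C_ge0 : 0 <= C.
Hypothesis poincare : forall f j x, (j < n)%N ->
  `|avg j.+1 f x - avg j f x| <= C * 2^-1 ^+ j * avg j (grad f) x.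

Lemma grad_ge0 f x : 0 <= grad f x.
Proof. by rewrite mulr_ge0 ?exprn_ge0// sumr_ge0. Qed.

(** Telescoping f from level j to level n bounds the oscillation by the increments of the levels i
    >= j, whose factors 2^-i form a geometric series. *)
Lemma avg_osc f j x : (j <= n)%N ->
  avg j (fun y => `|f y - avg j f y|) x <= 2 * C * 2^-1 ^+ j * avg j (grad f) x.
Proof.
move=> jn.
apply: (@le_trans _ _ (avg j (fun y => \sum_(j <= i < n)
   C * 2^-1 ^+ i * avg i (grad f) y) x)).
  apply: ler_avg => y _; rewrite {1}(telescope_avg f y jn) addrAC subrr add0r.
  apply: (le_trans (ler_norm_sum _ _ _)); apply: ler_sum_nat => i /andP[_ ni].
  exact: poincare.
rewrite avg_sum; apply: (@le_trans _ _ (\sum_(j <= i < n)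
    2^-1 ^+ i * (C * avg j (grad f) x))).
  apply: ler_sum_nat => i /andP[ji ni].
  by rewrite avgZ avg_avg ?ji 1?ltnW// [leRHS]mulrCA mulrA.
rewrite -mulr_suml (_ : 2 * C * _ * _ = 2 * 2^-1 ^+ j * (C * avg j (grad f) x)); last by ring.
rewrite ler_wpM2r ?geom_half_sum_le// mulr_ge0// avg_ge0// => y.
exact: grad_ge0.
Qed.

(* The stopping cells of A are the maximal cells in which A has density > 1/(2B):
   then the density is at most 1/2, unless the cell has level 0, and the
   oscillation of the indicator of A bounds the size of the cell from below. *)
Lemma domin_indicator (A : {set G}) (f := fun x => (x \in A)%:R : R) :
  domin 2 f (2 * B%:R * \sum_x f x + 8 * B%:R * C * \sum_x grad f x).
Proof.
have B0 : 0 < B%:R :> R by rewrite ltr0n.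
have B1 : 1 <= B%:R :> R by rewrite ler1n.
(* The threshold is such that the children of a cell with density at most eta have density at most B
   * eta = 1/2. *)
pose eta : R := (2 * B%:R)^-1.
have eta0 : 0 < eta by rewrite invr_gt0 mulr_gt0.
have Beta : B%:R * eta = 2^-1 by rewrite /eta invfM mulrCA mulfV ?mulr1 ?gt_eqF.
have eta12 : eta <= 2^-1 by rewrite -Beta ler_peMl// ltW.
have f0 x : 0 <= f x by rewrite /f ler0n.
pose D j x := (eta < avg j f x) && [forall i : 'I_j, avg i f x <= eta].
have Dinv j x y : (j <= n)%N -> r j x y -> D j x = D j y.
  move=> jn xy; rewrite /D (avg_inv f xy); congr (_ && _); apply: eq_forallb => i.
  by rewrite (@avg_inv i f x y)//; apply: r_le xy; rewrite jn ltnW.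
exists (fun j => if (j <= n)%N then fun x => (D j x)%:R else fun=> 0); split.
- by move=> j x; case: ifP => _ //; rewrite ler0n.
- by move=> j x y xy; case: ifP => // jn; rewrite (Dinv _ _ y).
- move=> x; rewrite /f; case: (boolP (x \in A)) => xA; last first.
    by rewrite sumr_ge0// => i _; rewrite -ltnS ltn_ord ler0n.
  (* At level n the average at a point of A is 1, so some level exceeds eta; the least such level
     stops. *)
  have ex : exists j, (j <= n)%N && (eta < avg j f x).
    exists n; rewrite leqnn avg_last /f xA (le_lt_trans eta12)//.
    by rewrite invf_lt1// ltr1n.
  case: (ex_minnP ex) => j /andP[jn ej] jmin.
  rewrite (bigD1 (Ordinal (jn : (j < n.+1)%N)))//= jn (_ : D j x).
    by rewrite lerDl sumr_ge0// => i _; rewrite -ltnS ltn_ord ler0n.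
  rewrite /D ej; apply/forallP => i; rewrite leNgt; apply/negP => ei.
  have := jmin i; rewrite ei andbT => /(_ (ltnW (leq_trans (ltn_ord i) jn))).
  by rewrite leqNgt ltn_ord.
- have S0 j : 0 <= \sum_x (D j x)%:R * grad f x.
    by rewrite sumr_ge0// => x _; rewrite mulr_ge0// ?ler0n ?grad_ge0.
  have D0 : \sum_x (D 0 x)%:R <= 2 * B%:R * \sum_x f x.
    rewrite -(@sum_avg 0)// mulr_sumr; apply: ler_sum => x _.
    case: (boolP (D 0 x)) => [/andP[h _]|_]; last first.
      by apply: mulr_ge0; [exact: mulr_ge0|exact: avg_ge0].
    by rewrite -ler_pdivrMl ?mulr_gt0// mulr1 ltW.
  have DS (j : 'I_n) : 2 ^+ j.+1 * \sum_x (D j.+1 x)%:R <=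
      8 * B%:R * C * \sum_x (D j.+1 x)%:R * grad f x.
    have jn : (j.+1 <= n)%N by [].
    have -> : \sum_x (D j.+1 x)%:R * grad f x =
              \sum_x (D j.+1 x)%:R * avg j.+1 (grad f) x.
      rewrite -(sum_avg _ jn); apply: eq_bigr => x _; rewrite -avgZ.
      by apply: eq_avg => y xy; rewrite (Dinv _ _ y).
    rewrite !mulr_sumr; apply: ler_sum => x _.
    case: (boolP (D j.+1 x)) => [/andP[h /forallP hj]|_]; last by rewrite !mul0r !mulr0.
    rewrite mulr1 mul1r.
    (* The parent of a stopping cell of positive level lies below the threshold. Hence each point of
       A in the cell differs from the mean by at least 1/2, and the oscillation is at least half the
       density. *)
    have p12 : avg j.+1 f x <= 2^-1.
      rewrite -Beta; apply: (le_trans (avgS_le x _ f0)) => //.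
      by rewrite ler_wpM2l// (hj ord_max).
    have := avg_osc f x jn.
    have : 2^-1 * avg j.+1 f x <= avg j.+1 (fun y => `|f y - avg j.+1 f y|) x.
      rewrite -avgZ; apply: ler_avg => y xy.
      rewrite -(avg_inv f xy); move: p12; set p := avg _ f x => p12.
      rewrite /f; case: (y \in A) => /=; last by rewrite mulr0.
      by rewrite ger0_norm; lra.
    move: h; set a := avg j.+1 f x; set b := avg j.+1 _ x; set c := avg j.+1 (grad f) x.
    move=> h ab bc.
    have : eta * 2^-1 <= 2 * C * 2^-1 ^+ j.+1 * c by lra.
    have P0 : 0 < 4 * B%:R * 2 ^+ j.+1 :> R by rewrite !mulr_gt0 ?exprn_gt0.
    rewrite -(ler_pM2l P0 (eta * 2^-1)).
    have -> : 4 * B%:R * 2 ^+ j.+1 * (eta * 2^-1) = 2 ^+ j.+1.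
      rewrite (_ : _ * _ = (B%:R * eta) * (2 * 2 ^+ j.+1)); last by field.
      by rewrite Beta mulrA mulVf ?mul1r ?pnatr_eq0.
    have -> : 4 * B%:R * 2 ^+ j.+1 * (2 * C * 2^-1 ^+ j.+1 * c) =
       (2 ^+ j.+1 * 2^-1 ^+ j.+1) * (8 * B%:R * C * c) by ring.
    by rewrite -exprMn mulfV ?pnatr_eq0// expr1n mul1r.
  rewrite big_ord_recl/= expr0 mul1r lerD//.
  apply: (@le_trans _ _ (\sum_(j < n) 8 * B%:R * C * \sum_x (D j.+1 x)%:R * grad f x)).
    apply: ler_sum => j _; rewrite /bump/= add1n ltn_ord.
    exact: DS.
  rewrite -mulr_sumr ler_wpM2l ?mulr_ge0// exchange_big/=; apply: ler_sum => x _.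
  rewrite -mulr_suml ler_piMl ?grad_ge0//.
  (* At most one level stops at a given point, so the gradient terms of all levels add up to at most
     one full gradient. *)
  case: (pickP (fun j : 'I_n => D j.+1 x)) => [j Dj|none]; last first.
    by rewrite big1// => i _; rewrite none.
  rewrite (bigD1 j)//= Dj big1 ?addr0// => i ij.
  case: (boolP (D i.+1 x)) => // Di; exfalso.
  move: Dj Di => /andP[ej /forallP hj] /andP[ei /forallP hi].
  move: ij; rewrite -val_eqE/= => ij; case: (ltngtP i j) ij => // ij _.
    by have := hj (Ordinal (ij : (i.+1 < j.+1)%N)); rewrite leNgt ei.
  by have := hi (Ordinal (ij : (j.+1 < i.+1)%N)); rewrite leNgt ej.
Qed.

(* A discrete coarea formula: peeling off the smallest positive value m of f as
   m times the indicator of {f > 0} is additive on both sides. *)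
Lemma domin_variation f : (forall x, 0 <= f x) ->
  domin 2 f (2 * B%:R * \sum_x f x + 8 * B%:R * C * \sum_x grad f x).
Proof.
have [m] := ubnP #|[set x | 0 < f x]|; elim: m f => // m IHm f fm f0.
case: (pickP (fun x => 0 < f x)) => [x0 fx0|none]; last first.
  apply: (domin_le (domin0 2)) => [x|].
    by rewrite leNgt none.
  by rewrite addr_ge0 ?mulr_ge0 ?sumr_ge0 ?ler0n// => x _; exact: grad_ge0.
case: (@arg_minP _ _ _ x0 (fun x => 0 < f x) f fx0) => a fa amin.
pose A := [set x | 0 < f x].
pose w x := f x - f a * (x \in A)%:R.
have w0 x : 0 <= w x.
  rewrite /w inE; case: (boolP (0 < f x)) => fx; last by rewrite mulr0 subr0.
  by rewrite mulr1 subr_ge0 amin.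
(* The minimiser a leaves the set of positive values, which makes its cardinality the induction
   measure. *)
have wm : (#|[set x | (0 < w x)%R]| < m)%N.
  rewrite -ltnS; apply: leq_trans fm; rewrite ltnS; apply: proper_card.
  apply/properP; split; last first.
    exists a; rewrite inE ?fa//.
    by rewrite /w inE fa mulr1 subrr ltxx.
  apply/subsetP => x; rewrite !inE /w inE; case: (boolP (0 < f x)) => // fx.
  by rewrite mulr0 subr0 (negbTE fx).
have := dominD (dominZ (f0 a) (domin_indicator A)) (IHm w wm w0).
move=> /domin_le; apply=> [x|]; first by rewrite /w addrC subrK.
have -> : \sum_x f x = f a * (\sum_x (x \in A)%:R) + \sum_x w x.
  by rewrite mulr_sumr -big_split; apply: eq_bigr => x _; rewrite /= /w addrC subrK.
(* Since f a is at most every positive value of f, the jumps of the indicator and of w across an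
   edge never have opposite signs, so absolute values add up. *)
suff -> : \sum_x grad f x = f a * \sum_x grad (fun x => (x \in A)%:R) x + \sum_x grad w x.
  by rewrite le_eqVlt; apply/orP; left; apply/eqP; ring.
rewrite mulr_sumr -big_split; apply: eq_bigr => x _; rewrite /grad/= mulrCA -mulrDr.
congr (_ * _); rewrite mulr_sumr -big_split; apply: eq_bigr => y _/=.
have wA z : w z = f z - f a * (0 < f z)%R%:R by rewrite /w inE.
rewrite !wA !inE; have := w0 x; have := w0 y; rewrite !wA.
have b1 : (nat_of_bool true)%:R = 1 :> R by [].
have b0 : (nat_of_bool false)%:R = 0 :> R by [].
case: (boolP (0 < f x)) => fx; case: (boolP (0 < f y)) => fy;
  rewrite ?b1 ?b0 ?mulr1 ?mulr0 ?subr0.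
- move=> _ _; have -> : f x - f a - (f y - f a) = f x - f y by ring.
  by rewrite (subrr (1 : R)) normr0 mulr0 add0r.
- have -> : f y = 0 by apply/le_anti; rewrite f0 leNgt fy.
  by rewrite !subr0 normr1 mulr1 => _ wx; rewrite !ger0_norm ?f0//; ring.
- have -> : f x = 0 by apply/le_anti; rewrite f0 leNgt fx.
  by rewrite !sub0r !normrN normr1 mulr1 => wy _; rewrite !ger0_norm ?f0//; ring.
- by rewrite normr0 mulr0 add0r.
Qed.

End total_variation.

(** * The maximal function over neighbouring cells *)

Section maximal.
Variables (near : nat -> rel G) (K : nat).
Hypothesis K_gt0 : (0 < K)%N.
Hypothesis near_sym : forall j, symmetric (near j).
Hypothesis near_le : forall i j x y, (i <= j <= n)%N -> near j x y -> near i x y.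
Hypothesis near_r : forall j x y z, near j x y -> r j y z -> near j x z.
Hypothesis near_card : forall j x, (j <= n)%N ->
  (#|[pred y | near j x y]| <= K * B ^ (n - j))%N.

(** The sum over a whole neighbourhood is divided by the size of a single cell; the number K of
    cells in the neighbourhood reappears in the constants. *)
Definition mean j (f : G -> R) x : R := (csize j)^-1 * \sum_(y | near j x y) f y.

Lemma mean_ge0 j f x : (forall y, 0 <= f y) -> 0 <= mean j f x.
Proof. by move=> f0; rewrite mulr_ge0 ?csizeV_ge0// sumr_ge0. Qed.

Lemma mean_inv j f x y : r j x y -> mean j f x = mean j f y.
Proof.
move=> xy; congr (_ * _); apply: eq_bigl => z.
by apply/idP/idP; rewrite !(near_sym j _ z) => /near_r; apply; rewrite // r_sym.
Qed.

Lemma sum_mean j f : (j <= n)%N -> (forall y, 0 <= f y) ->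
  \sum_x mean j f x <= K%:R * \sum_x f x.
Proof.
move=> jn f0; rewrite /mean -mulr_sumr (exchange_big_dep xpredT)//= mulr_sumr mulr_sumr.
apply: ler_sum => y _; rewrite sumr_const -[X in _ * X]mulr_natl mulrA ler_wpM2r//.
rewrite ler_pdivrMl ?csize_gt0// mulrC -natrM ler_nat; apply: leq_trans (near_card y jn).
by rewrite (_ : #|_| = #|[pred x | near j y x]|)//; apply: eq_card => x; rewrite !inE near_sym.
Qed.

(** Every y near x at level j is near x at the coarser level i, together with its whole cell of
    level i, on which f is constant; so f y is at most the mean at level i. There are at most K
    times [csize] such y. *)
Lemma mean_coarser i j f x : (i <= j <= n)%N -> (forall y, 0 <= f y) ->
  (forall y z, r i y z -> f y = f z) -> mean j f x <= K%:R * mean i f x.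
Proof.
move=> ijn f0 fi; have /andP[ij jn] := ijn.
apply: (@le_trans _ _ ((csize j)^-1 * \sum_(y | near j x y) mean i f x)).
  rewrite ler_wpM2l ?csizeV_ge0//; apply: ler_sum => y xy.
  rewrite -(@avg_id i f y) ?(leq_trans ij)//; last by move=> z yz; rewrite -(fi _ _ yz).
  rewrite ler_wpM2l ?csizeV_ge0// [leRHS](bigID (r i y))/=.
  rewrite [X in _ <= X + _](eq_bigl (r i y)) ?lerDl ?sumr_ge0// => z.
  apply/andP/idP => [[]//|yz]; split => //.
  by apply: near_r yz; exact: near_le xy.
rewrite sumr_const -[X in _ * X]mulr_natl mulrA ler_wpM2r ?mean_ge0//.
by rewrite ler_pdivrMl ?csize_gt0// mulrC -natrM ler_nat near_card.
Qed.

(** The mean at level j of a part [L i] coarser than j is absorbed by its mean at its own level i,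
    so it is enough to record the means of [L i] at the levels j <= i. One h serves for all levels j
    at once, which is what a maximal function requires. *)
Lemma domin_maximal q f c : 1 < q -> domin q f c ->
  exists2 h, forall j x, (j <= n)%N -> mean j f x <= h x &
    domin q h (K%:R ^+ 2 * (q / (q - 1)) * c).
Proof.
move=> q1 [L [L0 Linv fL Lc]].
have K1 : 1 <= K%:R :> R by rewrite ler1n.
pose M j x := if (j <= n)%N then K%:R * \sum_(i < n.+1 | (j <= i)%N) mean j (L i) x else 0.
have M0 j x : 0 <= M j x.
  rewrite /M; case: ifP => // _; rewrite mulr_ge0 ?sumr_ge0// => i _.
  exact: mean_ge0.
exists (fun x => \sum_(j < n.+1) M j x).
  move=> j x jn.
  apply: (@le_trans _ _ (\sum_(i < n.+1) mean j (L i) x)).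
    rewrite /mean -mulr_sumr (exchange_big_dep (near j x))//= ler_wpM2l ?csizeV_ge0//.
    by apply: ler_sum => y xy; rewrite xy fL.
  rewrite (bigID (fun i : 'I__ => (i < j)%N))/= [leRHS](bigID (fun i : 'I__ => (i < j)%N))/=.
  apply: lerD.
    apply: ler_sum => i ij; apply: (@le_trans _ _ (K%:R * mean i (L i) x)).
      by apply: mean_coarser; rewrite ?jn 1?ltnW//; exact: Linv.
    rewrite /M -ltnS ltn_ord ler_wpM2l// (bigD1 i)//= lerDl sumr_ge0// => l _.
    exact: mean_ge0.
  rewrite [leRHS](bigD1 (Ordinal (jn : (j < n.+1)%N))) ?ltnn//= -[leLHS]addr0 lerD//; last first.
    by rewrite sumr_ge0.
  rewrite /M jn (eq_bigl (fun i : 'I__ => (j <= i)%N)); last by move=> i; rewrite -leqNgt.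
  by rewrite ler_peMl// sumr_ge0// => i _; exact: mean_ge0.
exists M; split => //.
  move=> j x y xy; rewrite /M; case: ifP => // _; congr (_ * _); apply: eq_bigr => i _.
  exact: mean_inv.
apply: (@le_trans _ _ (\sum_(j < n.+1) \sum_(i < n.+1 | (j <= i)%N)
    q ^+ j * (K%:R ^+ 2 * \sum_x L i x))).
  apply: ler_sum => j _; rewrite -mulr_sumr ler_wpM2l ?exprn_ge0//; first lra.
  rewrite /M -ltnS ltn_ord -[leLHS]mulr_sumr [X in _ * X]exchange_big/= mulr_sumr.
  apply: ler_sum => i ji; rewrite expr2 -mulrA ler_wpM2l//.
  by apply: sum_mean => //; rewrite -ltnS.
rewrite (exchange_big_dep xpredT)//=.
apply: (@le_trans _ _ (\sum_(i < n.+1) K%:R ^+ 2 * (q / (q - 1)) * (q ^+ i * \sum_x L i x))).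
  apply: ler_sum => i _; rewrite -mulr_suml.
  have := geom_sum_le i q1; rewrite (big_ord_widen n.+1 (fun j => q ^+ j))//.
  rewrite (eq_bigl (fun j : 'I_n.+1 => (j <= i)%N))//; set S := \sum_(_ < _ | _) _ => hS.
  rewrite [leRHS](_ : _ = q / (q - 1) * q ^+ i * (K%:R ^+ 2 * \sum_x L i x)); last by ring.
  by rewrite ler_wpM2r// mulr_ge0 ?sumr_ge0// exprn_ge0.
by rewrite -mulr_sumr ler_wpM2l// mulr_ge0 ?exprn_ge0// divr_ge0//; lra.
Qed.

End maximal.

End dyadic_averages.

(** * Dyadic cells of a finite box of integer points *)

Section dyadic_grid.
Variables (d T n : nat).

(* The cells of level n of a cubical box with T cells of level 0 per side. *)
Definition grid := {ffun 'I_d -> 'I_(T * 2 ^ n)}.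

Implicit Types x y z : grid.

(** Counted in finest cells, so that [x a %/ side j] is the index, in direction a, of the cell of
    level j containing x. *)
Definition side j := (2 ^ (n - j))%N.

Lemma sideE j : side j = (2 ^ (n - j))%N.
Proof. by []. Qed.

Definition same_cell j : rel grid :=
  fun x y => [forall a, (x a %/ side j == y a %/ side j)%N].

Definition near_cell j : rel grid := fun x y =>
  [forall a, (x a %/ side j <= (y a %/ side j).+1)%N &&
             (y a %/ side j <= (x a %/ side j).+1)%N].

Lemma side_gt0 j : (0 < side j)%N. Proof. by rewrite expn_gt0. Qed.

Lemma sideS j : (j < n)%N -> side j = (side j.+1 * 2)%N.
Proof. by move=> jn; rewrite /side mulnC -expnS -subSn. Qed.

Lemma same_cellP j x y :
  reflect (forall a, (x a %/ side j = y a %/ side j)%N) (same_cell j x y).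
Proof.
by apply: (iffP forallP) => h a; [apply/eqP; exact: h|rewrite (h a)].
Qed.

Lemma same_cell_refl j : reflexive (same_cell j).
Proof. by move=> x; apply/same_cellP. Qed.

Lemma same_cell_sym j : symmetric (same_cell j).
Proof.
by move=> x y; apply/same_cellP/same_cellP => h a; rewrite h.
Qed.

Lemma same_cell_trans j : transitive (same_cell j).
Proof.
by move=> y x z /same_cellP xy /same_cellP yz; apply/same_cellP => a; rewrite xy.
Qed.

Lemma div_side i j k : (i <= j <= n)%N -> (k %/ side i = k %/ side j %/ 2 ^ (j - i))%N.
Proof.
move=> /andP[ij jn]; rewrite -divnMA /side -expnD; congr (_ %/ 2 ^ _)%N; lia.
Qed.

Lemma same_cell_le i j x y : (i <= j <= n)%N -> same_cell j x y -> same_cell i x y.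
Proof.
move=> ijn /same_cellP xy; apply/same_cellP => a.
by rewrite !(div_side _ ijn) xy.
Qed.

(** Two forms: the exact count serves for cells, which lie inside the box, the upper bound for
    neighbourhoods, which the boundary of the box may cut. *)
Lemma card_interval M a b : (#|[pred c : 'I_M | (a <= c < b)%N]| <= b - a)%N /\
  ((b <= M)%N -> #|[pred c : 'I_M | (a <= c < b)%N]| = (b - a)%N).
Proof.
have E N : (b <= N)%N -> \sum_(0 <= c < N | (a <= c < b)%N) 1%N = (b - a)%N.
  move=> bN; rewrite (_ : \sum_(0 <= c < N | _) 1%N = \sum_(a <= c < b) 1%N).
    by rewrite sum_nat_const_nat muln1.
  rewrite (big_nat_widen _ _ _ _ _ bN) (big_nat_widenl _ _ _ _ _ (leq0n a)).
  by apply: eq_bigl => c; rewrite andTb andbC.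
have F : #|[pred c : 'I_M | (a <= c < b)%N]| = \sum_(0 <= c < M | (a <= c < b)%N) 1%N.
  by rewrite big_mkord sum1_card.
split; last by move=> bM; rewrite F E.
have [bM|Mb] := leqP b M; first by rewrite F E.
rewrite F -(E b)// (big_nat_widen _ _ _ _ _ (ltnW Mb)).
rewrite [leqRHS](bigID (fun c => c < M)%N)/= leq_addr//.
Qed.

Lemma card_grid (Q : 'I_d -> pred 'I_(T * 2 ^ n)) :
  #|[pred y : grid | [forall a, Q a (y a)]]| = (\prod_a #|Q a|)%N.
Proof.
transitivity #|family Q|; first by apply: eq_card => y; rewrite inE.
by rewrite card_family foldrE big_map/= big_enum.
Qed.

Lemma card_same_cell j x : (j <= n)%N ->
  #|[pred y | same_cell j x y]| = ((2 ^ d) ^ (n - j))%N.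
Proof.
move=> jn.
rewrite [LHS](card_grid (fun a c => (x a %/ side j == c %/ side j)%N)) (eq_bigr (fun=> side j)).
  by rewrite big_const iter_muln_1 card_ord /side -!expnM mulnC.
move=> a _; have [_ h] := card_interval (T * 2 ^ n)
  (x a %/ side j * side j) ((x a %/ side j).+1 * side j).
rewrite (eq_card (B := [pred c : 'I__ | (x a %/ side j * side j <= c
    < (x a %/ side j).+1 * side j)%N])).
  rewrite h; first by rewrite -mulnBl subSnn mul1n.
  have E : (T * 2 ^ n = T * 2 ^ j * side j)%N by rewrite -mulnA -expnD subnKC.
  rewrite [leqRHS]E leq_mul2r ltn_divLR ?side_gt0//; apply/orP; right.
  by rewrite -E.
move=> c; rewrite -[LHS]/(x a %/ side j == c %/ side j)%N inE eqn_leq -[X in _ && X]ltnS.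
by rewrite leq_divRL ?side_gt0// ltn_divLR ?side_gt0.
Qed.

Lemma near_cell_sym j : symmetric (near_cell j).
Proof. by move=> x y; apply: eq_forallb => a; rewrite andbC. Qed.

Lemma near_cell_le i j x y : (i <= j <= n)%N -> near_cell j x y -> near_cell i x y.
Proof.
move=> ijn /forallP xy; apply/forallP => a; have /andP[h1 h2] := xy a.
have k0 : (0 < 2 ^ (j - i))%N by rewrite expn_gt0.
have key u v : (u <= v.+1 -> u %/ 2 ^ (j - i) <= (v %/ 2 ^ (j - i)).+1)%N.
  move=> uv; apply: (leq_trans (leq_div2r _ uv)).
  apply: (@leq_trans ((v + 2 ^ (j - i)) %/ 2 ^ (j - i))%N).
    by apply: leq_div2r; rewrite -addn1 leq_add2l.
  by rewrite divnDr// divnn k0 addn1.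
by rewrite !(div_side _ ijn) !key.
Qed.

Lemma near_same_cell j x y z : near_cell j x y -> same_cell j y z -> near_cell j x z.
Proof.
move=> /forallP xy /same_cellP yz; apply/forallP => a.
by rewrite -yz.
Qed.

Lemma card_near_cell j x : (j <= n)%N ->
  (#|[pred y | near_cell j x y]| <= 3 ^ d * (2 ^ d) ^ (n - j))%N.
Proof.
move=> jn; rewrite [leqLHS](card_grid (fun a c => (x a %/ side j <= (c %/ side j).+1)%N &&
  (c %/ side j <= (x a %/ side j).+1)%N)).
apply: (@leq_trans (\prod_(a < d) (3 * side j))%N); last first.
  by rewrite big_const iter_muln_1 card_ord expnMn /side -!expnM [(d * _)%N]mulnC.
apply: leq_prod => a _; have [h _] := card_interval (T * 2 ^ n)
  ((x a %/ side j).-1 * side j) ((x a %/ side j).+2 * side j).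
apply: (@leq_trans #|[pred c : 'I_(T * 2 ^ n) |
   ((x a %/ side j).-1 * side j <= c < (x a %/ side j).+2 * side j)%N]|); last first.
  apply: (leq_trans h); rewrite -mulnBl leq_mul2r; apply/orP; right.
  by case: (_ %/ _)%N => //= k; lia.
apply: subset_leq_card; apply/subsetP => c; rewrite !inE => /andP[h1 h2].
by rewrite -leq_divRL ?side_gt0// -ltn_divLR ?side_gt0//; move: h1 h2;
set u := (c %/ _)%N; set v := (x a %/ _)%N; move: u v => u v; lia.
Qed.

(** * Increments between sibling cells and a discrete Poincare inequality *)

Section siblings.
Variable R : realFieldType.
Implicit Types (f g : grid -> R) (C : R).

Local Notation avg := (avg n (2 ^ d) same_cell).

Let B_gt0 : (0 < 2 ^ d)%N. Proof. by rewrite expn_gt0. Qed.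

(* Two points of a cell are joined by changing their coordinates one by one. *)
Lemma sibling_increment f g C j x : (j < n)%N ->
  (forall a (x y : grid), (forall b, b != a -> x b = y b) -> same_cell j x y ->
    avg j.+1 f x - avg j.+1 f y <= C * avg j g x) ->
  `|avg j.+1 f x - avg j f x| <= d%:R * C * avg j g x.
Proof.
move=> jn adj; have jn' := ltnW jn.
(* The hypothesis bounds one sign of the difference; exchanging the two points gives the other. *)
have adj' a (u v : grid) : (forall b, b != a -> u b = v b) -> same_cell j u v ->
    `|avg j.+1 f u - avg j.+1 f v| <= C * avg j g u.
  move=> uv r; rewrite ler_norml lerNl opprB (adj a u v uv r) andbT.
  rewrite (avg_inv n (2 ^ d) same_cell_sym same_cell_trans g r).
  apply: (adj a).
    by move=> b ba; rewrite uv.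
  by rewrite same_cell_sym.
have path y : same_cell j x y ->
    `|avg j.+1 f x - avg j.+1 f y| <= d%:R * C * avg j g x.
  (* [z k] takes its coordinates below k from y and the others from x: a path from x to y inside the
     cell, changing one coordinate at a time. *)
  move=> xy; pose z k : grid := [ffun a : 'I_d => if (a < k)%N then y a else x a].
  have zx k : same_cell j x (z k).
    apply/same_cellP => a; rewrite ffunE; case: ifP => // _.
    by move/same_cellP : xy.
  have z0 : z 0%N = x by apply/ffunP => a; rewrite ffunE.
  have zd : z d = y by apply/ffunP => a; rewrite ffunE ltn_ord.
  rewrite -opprB normrN -{1}z0 -{1}zd -(telescope_sumr (fun k => avg j.+1 f (z k)))//.
  apply: (le_trans (ler_norm_sum _ _ _)).
  rewrite -mulrA mulr_natl -[X in _ *+ X]subn0 -sumr_const_nat.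
  apply: ler_sum_nat => k /andP[_ kd]; rewrite distrC.
  rewrite (avg_inv n (2 ^ d) same_cell_sym same_cell_trans g (zx k)).
  apply: (adj' (Ordinal kd)).
    move=> b; rewrite -val_eqE/= !ffunE => bk.
    by rewrite (_ : (b < k.+1)%N = (b < k)%N)//; lia.
  by apply: same_cell_trans (zx k.+1); rewrite same_cell_sym.
have cst c : avg j (fun=> c : R) x = c by exact: (avg_cst card_same_cell B_gt0).
(* The average at level j is the average over y of the averages at level j + 1, so the path bound
   for each y suffices. *)
rewrite -(avg_avg same_cell_sym same_cell_trans same_cell_le card_same_cell B_gt0 f x
   (_ : (j <= j.+1 <= n)%N)) ?leqnSn//.
rewrite -[X in `|X - _|]cst -avgB.
apply: (le_trans (ler_norm_avg _ _ _ _ _ _)) => //.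
rewrite -[leRHS]cst.
by apply: ler_avg => // y xy; exact: path.
Qed.

Definition edge : rel grid := fun x y =>
  [exists a, (y a == (x a).+1 :> nat) && [forall b, (b != a) ==> (x b == y b)]].

(** Translation by k steps in direction a. A point that would leave the box keeps its coordinate, so
    each use must show that the translate stays inside. *)
Let shift (a : 'I_d) (k : nat) (x : grid) : grid :=
  [ffun b => if b == a then insubd (x a) (x a + k)%N else x b].

Let shift_a a k x : (x a + k < T * 2 ^ n)%N -> shift a k x a = (x a + k)%N :> nat.
Proof. by move=> h; rewrite ffunE eqxx insubdK. Qed.

Let shift_b a k x b : b != a -> shift a k x b = x b.
Proof. by move=> h; rewrite ffunE (negbTE h). Qed.

(** The subcell of y is the subcell of x translated by its own side s, so the difference of the
    averages telescopes along s unit edges that stay in the common parent. Each of the s translates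
    is injective, which bounds the sum by s times the edge sum over the parent; s 2^-n <= 2^-j gives
    the scale, and the ratio of cell sizes the factor 2^d. *)
Lemma edge_increment_dir f j a x y : (j < n)%N -> (forall b, b != a -> x b = y b) ->
  same_cell j x y -> (x a %/ side j.+1 < y a %/ side j.+1)%N ->
  `|avg j.+1 f x - avg j.+1 f y| <= (2 ^ d)%:R * 2^-1 ^+ j * avg j (grad n edge f) x.
Proof.
move=> jn xyb /same_cellP xy xya.
set s := side j.+1 in xya *; have s0 : (0 < s)%N by exact: side_gt0.
have ya : (y a %/ s = (x a %/ s).+1)%N.
  have := xy a; rewrite (sideS jn) !divnMA -/s => h.
  by move: h xya; move: (_ %/ s)%N (_ %/ s)%N => u v; lia.
have xa2 : ((x a %/ s) %/ 2 = (x a %/ s).+1 %/ 2)%N.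
  by rewrite -ya; have := xy a; rewrite (sideS jn) !divnMA.
(* The subcell of y lies in the box, so moving a point of the subcell of x by at most s does not
   leave it. *)
have zM z k : same_cell j.+1 x z -> (k <= s)%N -> (z a + k < T * 2 ^ n)%N.
  move=> /same_cellP/(_ a) xz ks.
  have yM : ((x a %/ s).+2 * s <= T * 2 ^ n)%N.
    have E : (T * 2 ^ n = T * 2 ^ j.+1 * s)%N by rewrite -mulnA -expnD subnKC.
    rewrite [leqRHS]E leq_mul2r; apply/orP; right; rewrite -ya ltn_divLR// -E.
    exact: ltn_ord.
  apply: leq_trans yM; have := ltn_ceil (z a) s0; rewrite -xz -/s => h.
  by rewrite [X in (_ < X)%N]mulSn addnC -addnS leq_add.
have sh_same z k : same_cell j.+1 x z -> (k <= s)%N -> same_cell j x (shift a k z).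
  move=> xz ks; apply/same_cellP => b; have [->|ba] := eqVneq b a; last first.
    rewrite shift_b//; have := xz => /(same_cell_le (_ : j <= j.+1 <= n)%N).
    by rewrite leqnSn jn => /(_ isT)/same_cellP.
  rewrite shift_a ?zM// (sideS jn) !divnMA -/s.
  have /same_cellP/(_ a) := xz; rewrite -/s => xza.
  have : (z a + k < (x a %/ s).+2 * s)%N.
    rewrite mulSn addnC -addnS leq_add//.
    by have := ltn_ceil (z a) s0; rewrite -xza.
  rewrite -ltn_divLR// ltnS => le1.
  have le2 : (x a %/ s <= (z a + k) %/ s)%N by rewrite xza leq_div2r// leq_addr.
  have [->//|ne] := eqVneq ((z a + k) %/ s)%N (x a %/ s)%N.
  rewrite xa2 (_ : ((z a + k) %/ s = (x a %/ s).+1)%N)//.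
  by apply/eqP; rewrite eqn_leq le1 ltn_neqAle eq_sym ne.
have sh_inj k : (k <= s)%N -> {in [pred z | same_cell j.+1 x z] &, injective (shift a k)}.
  move=> ks z w; rewrite !inE => xz xw zw; apply/ffunP => b.
  have [->|ba] := eqVneq b a; last by have := congr1 (fun h : grid => h b) zw; rewrite !shift_b.
  apply: val_inj; have := congr1 (fun h : grid => val (h a)) zw.
  by rewrite /= !shift_a ?zM// => /addIn.
have sh_s z : same_cell j.+1 x z -> same_cell j.+1 y (shift a s z).
  move=> xz; apply/same_cellP => b; have [->|ba] := eqVneq b a; last first.
    by rewrite shift_b// -xyb//; move/same_cellP : xz.
  rewrite shift_a ?zM// -/s ya divnDr ?dvdnn// divnn s0 addn1.
  by have /same_cellP/(_ a) := xz; rewrite -/s => ->.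
have sum_y : \sum_(z | same_cell j.+1 y z) f z =
             \sum_(z | same_cell j.+1 x z) f (shift a s z).
  rewrite -(big_imset f (sh_inj s (leqnn s))); apply: eq_bigl => z.
  suff -> : shift a s @: [pred z | same_cell j.+1 x z] = [set z | same_cell j.+1 y z].
    by rewrite inE.
  apply/eqP; rewrite eqEcard; apply/andP; split.
    by apply/subsetP => _ /imsetP[w + ->]; rewrite !inE; exact: sh_s.
  rewrite card_in_imset; last exact: sh_inj.
  by rewrite card_same_cell// cardsE card_same_cell.
pose h w := \sum_(v | edge w v) `|f w - f v|.
have h0 w : 0 <= h w by rewrite sumr_ge0.
have shift0 z : shift a 0 z = z.
  apply/ffunP => b; have [->|ba] := eqVneq b a; last by rewrite shift_b.
  by apply: val_inj; rewrite /= shift_a ?addn0.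
have step z k : same_cell j.+1 x z -> (k < s)%N ->
    `|f (shift a k.+1 z) - f (shift a k z)| <= h (shift a k z).
  move=> xz ks; rewrite /h (bigD1 (shift a k.+1 z))/=; last first.
    apply/existsP; exists a; rewrite !shift_a ?zM// 1?ltnW// addnS eqxx/=.
    by apply/forallP => b; apply/implyP => ba; rewrite !shift_b.
  by rewrite distrC lerDl sumr_ge0.
have main : \sum_(z | same_cell j.+1 x z) `|f z - f (shift a s z)| <=
            s%:R * \sum_(w | same_cell j x w) h w.
  apply: (@le_trans _ _ (\sum_(z | same_cell j.+1 x z) \sum_(0 <= k < s) h (shift a k z))).
    apply: ler_sum => z xz; rewrite distrC -{2}[z]shift0.
    rewrite -(telescope_sumr (fun k => f (shift a k z)))//.
    apply: (le_trans (ler_norm_sum _ _ _)); apply: ler_sum_nat => k /andP[_ ks].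
    exact: step.
  rewrite exchange_big/= mulr_natl -[X in _ *+ X]subn0 -sumr_const_nat.
  apply: ler_sum_nat => k /andP[_ ks].
  rewrite -(big_imset h (sh_inj k (ltnW ks))) [leRHS](bigID
    (mem (shift a k @: [pred z | same_cell j.+1 x z])))/=.
  rewrite [X in _ <= X + _](eq_bigl (mem (shift a k @: [pred z | same_cell j.+1 x z]))).
    by rewrite lerDl sumr_ge0.
  move=> w; apply/andP/idP => [[]//|wi]; split => //.
  move: wi => /imsetP[z + ->]; rewrite inE => xz.
  by apply: sh_same => //; exact: ltnW.
have c0 : 0 < csize R n (2 ^ d) j.+1 by exact: csize_gt0.
rewrite !avgE -mulrBr sum_y -sumrB normrM gtr0_norm ?invr_gt0//.
rewrite (csizeS R (2 ^ d) jn) invfM.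
have -> : \sum_(w | same_cell j x w) grad n edge f w =
    2 ^+ n * \sum_(w | same_cell j x w) h w by rewrite mulr_sumr.
rewrite [leRHS](_ : _ = (csize R n (2 ^ d) j.+1)^-1 *
  (2^-1 ^+ j * 2 ^+ n * \sum_(w | same_cell j x w) h w)); last first.
  have b0 : (2 ^ d)%:R != 0 :> R by rewrite pnatr_eq0 -lt0n.
  move: b0 (lt0r_neq0 c0); move: (2 ^ d)%:R (csize _ _ _ _) => b k b0 k0.
  by field; rewrite b0 k0.
rewrite ler_wpM2l ?invr_ge0 ?(ltW c0)//.
apply: (le_trans (ler_norm_sum _ _ _)); apply: (le_trans main).
rewrite ler_wpM2r ?sumr_ge0// exprVn ler_pdivlMl ?exprn_gt0//.
by rewrite /s /side -natrX -natrM -natrX ler_nat -expnD leq_exp2l//; lia.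
Qed.

(* The discrete gradient along the edges of the finest grid controls the
   increments of the averages at every level. *)
Lemma grid_poincare f j x : (j < n)%N ->
  `|avg j.+1 f x - avg j f x| <= (d * 2 ^ d)%:R * 2^-1 ^+ j * avg j (grad n edge f) x.
Proof.
move=> jn; rewrite natrM -[_ * _ * 2^-1 ^+ j]mulrA.
apply: sibling_increment => // a {}x y xy r.
apply: (le_trans (ler_norm _)).
have yx b : b != a -> y b = x b by move=> ba; rewrite xy.
have ryx : same_cell j y x by rewrite same_cell_sym.
have [lt|lt|eq] := ltngtP (x a %/ side j.+1)%N (y a %/ side j.+1)%N.
- exact: edge_increment_dir lt.
- rewrite distrC (avg_inv n (2 ^ d) same_cell_sym same_cell_trans _ r).
  exact: edge_increment_dir lt.
- rewrite (_ : avg j.+1 f x = avg j.+1 f y); last first.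
    apply: (avg_inv n (2 ^ d) same_cell_sym same_cell_trans); apply/same_cellP => b.
    by have [->|/xy->] := eqVneq b a.
  rewrite subrr normr0; apply: mulr_ge0; first by rewrite mulr_ge0 ?exprn_ge0 ?ler0n ?invr_ge0.
  by apply: avg_ge0 => // z; exact: grad_ge0.
Qed.

End siblings.

End dyadic_grid.

From mathcomp Require Import all_classical all_reals all_analysis.
From mathcomp Require Import measurable_realfun.
Import numFieldNormedType.Exports.
Local Open Scope classical_set_scope.
Local Open Scope ring_scope.

(** * Smooth functions of one real variable *)

Section smooth_functions_on_R.
Variable R : realType.
Implicit Types (f g : R -> R) (x y : R).

Lemma nbhs_ltr x a : x < a -> \forall y \near x, y < a.
Proof. by move=> xa; apply: open_nbhs_nbhs; split => //; exact: open_lt. Qed.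

Lemma nbhs_gtr x a : a < x -> \forall y \near x, a < y.
Proof. by move=> xa; apply: open_nbhs_nbhs; split => //; exact: open_gt. Qed.

(** Differentiability up to a finite order suits inductions over sums, products and inverses;
    [Ck_deriv_seq] turns all finite orders into one sequence of derivatives. *)
Fixpoint Ck n f : Prop := if n is m.+1 then
  exists2 g : R -> R, (forall x : R, is_derive x 1 f (g x)) & Ck m g else True.

(** A function kept together with all its derivatives: differentiating a product of such functions
    of separate coordinates only raises indices. *)
Definition deriv_seq (H : nat -> R -> R) := forall n x, is_derive x 1 (H n) (H n.+1 x).

Lemma Ck_deriv_seq f : (forall n, Ck n f) -> exists2 H, H 0%N = f & deriv_seq H.
Proof.
move=> sf; pose D h : R -> R := fun x => 'D_1 h x.
exists (fun n => iter n D f) => //.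
have DS h : (forall n, Ck n h) -> (forall x, is_derive x 1 h (D h x)) /\ forall n, Ck n (D h).
  move=> sh; have [g hg _] := sh 1%N; split.
    by move=> x; apply: derivableP; exact: (@ex_derive _ _ _ _ _ _ _ (hg x)).
  move=> n; have [g' hg' gn] := sh n.+1; rewrite (_ : D h = g')//.
  by apply/funext => x; rewrite /D (@derive_val _ _ _ _ _ _ _ (hg' x)).
suff S n : forall m, Ck m (iter n D f) by move=> n x; exact: (DS _ (S n)).1.
by elim: n => // n IHn m /=; exact: (DS _ IHn).2.
Qed.

Lemma CkS n f : Ck n.+1 f -> Ck n f.
Proof.
elim: n f => // n IHn f [g fg gn]; exists g => //; exact: IHn.
Qed.

Lemma CkD n f g : Ck n f -> Ck n g -> Ck n (fun x => f x + g x).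
Proof.
elim: n f g => // n IHn f g [f' ff' f'n] [g' gg' g'n].
by exists (fun x => f' x + g' x); [move=> x; exact: is_deriveD|exact: IHn].
Qed.

Lemma CkM n f g : Ck n f -> Ck n g -> Ck n (fun x => f x * g x).
Proof.
elim: n f g => // n IHn f g [f' ff' f'n] [g' gg' g'n].
exists (fun x => f x * g' x + g x * f' x).
  by move=> x; have := is_deriveM (ff' x) (gg' x).
have fn : Ck n f by apply: CkS; exists f'.
have gn : Ck n g by apply: CkS; exists g'.
by apply: CkD; exact: IHn.
Qed.

Lemma Ck_cst n (c : R) : Ck n (fun=> c).
Proof.
by elim: n c => // n IHn c; exists (fun=> 0); [move=> x; exact: is_derive_cst|exact: IHn].
Qed.

Lemma Ck_id n : Ck n (fun x => x).
Proof.
case: n => // n; exists (fun=> 1); last exact: Ck_cst.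
by move=> x; exact: is_derive_id.
Qed.

Lemma Ck_affine n f a b : Ck n f -> Ck n (fun x => f (a * x + b)).
Proof.
elim: n f => // n IHn f [f' ff' f'n]; exists (fun x => a * f' (a * x + b)).
  move=> x; have aff : is_derive x 1 (fun z : R => a * z + b) a.
    have := is_deriveD (is_deriveZ a (is_derive_id x (1 : R))) (is_derive_cst b x (1 : R)).
    by move=> /is_derive_eq; apply; rewrite addr0 /GRing.scale/= mulr1.
  by have := @is_derive1_comp R f (fun z => a * z + b) x _ _ (ff' (a * x + b)) aff; rewrite mulrC.
by apply: CkM; [exact: Ck_cst|exact: IHn].
Qed.

Lemma CkV n f : (forall x, f x != 0) -> Ck n f -> Ck n (fun x => (f x)^-1).
Proof.
move=> f0; elim: n => // n IHn [f' ff' f'n].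
have fn : Ck n f by apply: CkS; exists f'.
exists (fun x => - 1 * ((f x)^-1 * (f x)^-1 * f' x)).
  move=> x; have := is_deriveV (f0 x) (ff' x) => /is_derive_eq; apply.
  by rewrite /GRing.scale/= expr2 invfM mulN1r mulNr.
apply: CkM; first exact: Ck_cst.
by apply: CkM => //; apply: CkM; exact: IHn.
Qed.

(* x^-k exp(-1/x) for x > 0 *)
Definition flat k x : R := if x <= 0 then 0 else x ^- k * expR (- x^-1).

(** With y = 1/x, exp y is the power k + 2 of exp (y / (k + 2)), which is at least y / (k + 2). The
    quadratic decay so obtained makes the derivative vanish at 0. *)
Lemma flat_le k x : `|flat k x| <= (k.+2)%:R ^+ k.+2 * x ^+ 2.
Proof.
rewrite /flat; case: (leP x 0) => [x0|x0] /=.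
    by rewrite normr0 mulr_ge0 ?sqr_ge0// exprn_ge0.
rewrite ger0_norm ?mulr_ge0 ?expR_ge0 ?invr_ge0 ?exprn_ge0 ?(ltW x0)//.
have h : x^-1 ^+ k.+2 <= (k.+2)%:R ^+ k.+2 * expR (x^-1).
  have K0 : 0 < k.+2%:R :> R by [].
  have -> : expR x^-1 = expR (x^-1 / k.+2%:R) ^+ k.+2 by rewrite -expRM_natr divfK ?gt_eqF.
  rewrite -exprMn lerXn2r ?nnegrE ?invr_ge0 ?(ltW x0) ?mulr_ge0 ?expR_ge0//.
  rewrite -ler_pdivrMl// mulrC; apply: le_trans (expR_ge1Dx _).
  by rewrite lerDr.
rewrite expRN ler_pdivrMr ?expR_gt0// mulrAC -ler_pdivrMr ?exprn_gt0//.
by apply: le_trans h; rewrite -exprVn -exprVn -exprD addn2.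
Qed.

Lemma is_derive_flat0 f c : (forall x, `|f x| <= c * x ^+ 2) -> is_derive (0 : R) 1 f 0.
Proof.
move=> fc.
have f0 : f 0 = 0 by apply/normr0_eq0/le_anti; rewrite normr_ge0 (le_trans (fc 0))// expr0n mulr0.
have lim0 : (fun h => h^-1 *: ((f \o shift 0) (h *: (1 : R)) - f 0)) @ 0^' --> (0 : R).
  apply/cvgr0Pnorm_le => e e0; near=> h.
  have h0 : h != 0 by near: h; exact: nbhs_dnbhs_neq.
  rewrite /= f0 subr0 addr0 normrZ normfV [_ *: 1]mulr1 ler_pdivrMl ?normr_gt0//.
  apply: (le_trans (fc h)).
  have -> : h ^+ 2 = `|h| * `|h| by rewrite -expr2 real_normK ?num_real.
  rewrite mulrCA ler_wpM2l//.
  apply: (@le_trans _ _ ((`|c| + 1) * `|h|)).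
    by rewrite ler_wpM2r// (le_trans (ler_norm c))// lerDl.
  rewrite -ler_pdivlMl ?ltr_wpDl// ltW//.
  near: h; apply: dnbhs0_lt; rewrite mulr_gt0// invr_gt0 ltr_wpDl//.
by split; [apply/cvg_ex; exists 0|exact/cvg_lim].
Unshelve. all: by end_near. Qed.

(** The family [flat] is closed under differentiation, so smoothness of every order follows by
    induction for all k simultaneously. *)
Lemma is_derive_flat k x :
  is_derive x 1 (flat k) (- k%:R * flat k.+1 x + flat k.+2 x).
Proof.
have [x0|x0|->] := ltgtP x 0.
- rewrite /flat !(ltW x0) mulr0 addr0.
  apply: (near_eq_is_derive _ (is_derive_cst (0 : R) x (1 : R))).
  by near=> z; rewrite ifT//; apply: ltW; near: z; exact: nbhs_ltr.
- have xn0 : x != 0 by rewrite gt_eqF.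
  have dV : is_derive x 1 (fun z : R => z^-1) (- x ^- 2).
    by have := is_deriveV xn0 (is_derive_id x (1 : R)) => /is_derive_eq; apply; exact: mulr1.
  have dE : is_derive x 1 (fun z : R => expR (- z^-1)) (expR (- x^-1) * x ^- 2).
    have := @is_derive1_comp R expR (fun z => - z^-1) x _ _ (is_derive_expR (- x^-1)) (is_deriveN dV).
    by rewrite opprK.
  have dP : is_derive x 1 (fun z : R => z ^- k) (- k%:R * x ^- k.+1).
    have := is_deriveX k dV => /is_derive_eq h.
    rewrite (_ : (fun z => z ^- k) = (fun z : R => z^-1) ^+ k); last first.
      by apply/funext => z; rewrite exprfctE exprVn.
    apply: h; rewrite /GRing.scale/= -!exprVn; case: (k) => [|m]; first by rewrite /=; ring.
    by rewrite /= !exprSr; ring.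
  have h := is_deriveM dP dE.
  apply: (near_eq_is_derive _ (is_derive_eq h _)).
    near=> z; rewrite /flat ifF//; apply/negbTE; rewrite -ltNge; near: z; exact: nbhs_gtr.
  rewrite /flat leNgt x0/= /GRing.scale/= -!exprVn !exprS; ring.
- apply: is_derive_eq; first exact: (is_derive_flat0 (@flat_le k)).
  by rewrite /flat lexx mulr0 addr0.
Unshelve. all: by end_near. Qed.

Lemma Ck_flat n k : Ck n (flat k).
Proof.
elim: n k => // n IHn k.
exists (fun x => - k%:R * flat k.+1 x + flat k.+2 x); first exact: is_derive_flat.
by apply: CkD; [apply: CkM => //; exact: Ck_cst|exact: IHn].
Qed.

Definition step x : R := flat 0 x / (flat 0 x + flat 0 (1 - x)).

Lemma flat_ge0 k x : 0 <= flat k x.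
Proof.
rewrite /flat; case: (leP x 0) => //= x0.
by rewrite mulr_ge0 ?expR_ge0// invr_ge0 exprn_ge0// ltW.
Qed.

Lemma flat_gt0 k x : 0 < x -> 0 < flat k x.
Proof. by move=> x0; rewrite /flat leNgt x0/= mulr_gt0 ?expR_gt0// invr_gt0 exprn_gt0. Qed.

Lemma step_den_gt0 x : 0 < flat 0 x + flat 0 (1 - x).
Proof.
have [x0|x0] := ltP 0 x; first by rewrite ltr_wpDr ?flat_ge0 ?flat_gt0.
by rewrite ltr_wpDl ?flat_ge0 ?flat_gt0// subr_gt0 (le_lt_trans x0).
Qed.

Lemma Ck_step n : Ck n step.
Proof.
apply: CkM; first exact: Ck_flat.
apply: CkV; first by move=> x; rewrite gt_eqF ?step_den_gt0.
apply: CkD; first exact: Ck_flat.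
rewrite (_ : (fun x => flat 0 (1 - x)) = (fun x => flat 0 (-1 * x + 1))); last first.
  by apply/funext => x; rewrite mulN1r addrC.
by apply: Ck_affine; exact: Ck_flat.
Qed.

Lemma step0 x : x <= 0 -> step x = 0.
Proof. by move=> x0; rewrite /step /flat x0 mul0r. Qed.

Lemma step1 x : 1 <= x -> step x = 1.
Proof.
move=> x1; rewrite /step [flat 0 (1 - x)]/flat subr_le0 x1 addr0 divff// gt_eqF//.
by rewrite flat_gt0// (lt_le_trans _ x1).
Qed.

Lemma step_ge0 x : 0 <= step x.
Proof. by rewrite divr_ge0 ?flat_ge0// ltW ?step_den_gt0. Qed.

Lemma step_le1 x : step x <= 1.
Proof. by rewrite ler_pdivrMr ?step_den_gt0// mul1r lerDl flat_ge0. Qed.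

Lemma deriv_seq_continuous H n : deriv_seq H -> continuous (H n).
Proof.
move=> dH x; apply/differentiable_continuous/derivable1_diffP.
exact: (@ex_derive _ _ _ _ _ _ _ (dH n x)).
Qed.

Lemma deriv_seq_near H n x (c : R) : deriv_seq H ->
  (\forall y \near x, H n y = c) -> H n.+1 x = 0.
Proof.
move=> dH Hc; rewrite -(@derive_val _ _ _ _ _ _ _ (dH n x)).
by rewrite (near_eq_derive _ Hc) derive_cst.
Qed.

Lemma deriv_seq_cst_left H a (c : R) : deriv_seq H -> (forall x, x < a -> H 0%N x = c) ->
  forall n x, x < a -> H n.+1 x = 0.
Proof.
move=> dH Hc; elim=> [|n IHn] x xa.
  by apply: (deriv_seq_near dH (c := c)); near=> y; apply: Hc; near: y; exact: nbhs_ltr.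
by apply: (deriv_seq_near dH (c := 0)); near=> y; apply: IHn; near: y; exact: nbhs_ltr.
Unshelve. all: by end_near. Qed.

Lemma deriv_seq_cst_right H a (c : R) : deriv_seq H -> (forall x, a < x -> H 0%N x = c) ->
  forall n x, a < x -> H n.+1 x = 0.
Proof.
move=> dH Hc; elim=> [|n IHn] x xa.
  by apply: (deriv_seq_near dH (c := c)); near=> y; apply: Hc; near: y; exact: nbhs_gtr.
by apply: (deriv_seq_near dH (c := 0)); near=> y; apply: IHn; near: y; exact: nbhs_gtr.
Unshelve. all: by end_near. Qed.

Lemma bounded_cst_outside f a b c1 c2 : a <= b -> continuous f ->
  (forall x, x < a -> f x = c1) -> (forall x, b < x -> f x = c2) ->
  exists2 M, 0 < M & forall x, `|f x| <= M.
Proof.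
move=> ab cf f1 f2.
have cn : {within `[a, b], continuous (fun x => `|f x|)}.
  apply: continuous_subspaceT => x; apply: continuous_comp; first exact: cf.
  exact: norm_continuous.
have [c _ cmax] := EVT_max ab cn.
exists (`|f c| + `|c1| + `|c2| + 1); first by rewrite ltr_wpDl.
move=> x; have [xa|ax] := ltP x a.
  by rewrite f1//; have := normr_ge0 (f c); have := normr_ge0 c2; lra.
have [bx|xb] := ltP b x.
  by rewrite f2//; have := normr_ge0 (f c); have := normr_ge0 c1; lra.
have := cmax x; rewrite in_itv/= ax xb => /(_ isT).
by have := normr_ge0 c1; have := normr_ge0 c2; lra.
Qed.

End smooth_functions_on_R.

(** * Pairing integrable functions with bounded measurable weights *)

Section weighted_integrals.
Context {dsp : measure_display} {T : measurableType dsp} {R : realType}.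
Variable mu : {measure set T -> \bar R}.
Implicit Types (v w f g : T -> R).

Definition bm w := measurable_fun setT w /\ exists M, forall x, `|w x| <= M.

Definition integ v := mu.-integrable setT (EFin \o v).

Lemma bm_cst c : bm (fun=> c).
Proof. by split; [exact: measurable_cst|exists `|c|]. Qed.

Lemma bmD v w : bm v -> bm w -> bm (fun x => v x + w x).
Proof.
move=> [mv [M vM]] [mw [N wN]]; split; first exact: measurable_funD.
by exists (M + N) => x; rewrite (le_trans (ler_normD _ _))// lerD.
Qed.

Lemma bmM v w : bm v -> bm w -> bm (fun x => v x * w x).
Proof.
move=> [mv [M vM]] [mw [N wN]]; split; first exact: measurable_funM.
by exists (M * N) => x; rewrite normrM ler_pM.
Qed.

Lemma bmZ c v : bm v -> bm (fun x => c * v x).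
Proof. by move=> bv; apply: bmM => //; exact: bm_cst. Qed.

Lemma bmN v : bm v -> bm (fun x => - v x).
Proof.
move=> /(bmZ (- 1)); rewrite (_ : (fun x => _ * _) = (fun x => - v x))//.
by apply/funext => x; rewrite mulN1r.
Qed.

Lemma bmB v w : bm v -> bm w -> bm (fun x => v x - w x).
Proof. by move=> bv bw; apply: bmD => //; exact: bmN. Qed.

Lemma bm_norm v : bm v -> bm (fun x => `|v x|).
Proof.
move=> [mv [M vM]]; split; first exact: measurableT_comp.
by exists M => x; rewrite normr_id.
Qed.

Lemma bm_sum (I : Type) (s : seq I) (P : pred I) (w : I -> T -> R) :
  (forall i, P i -> bm (w i)) -> bm (fun x => \sum_(i <- s | P i) w i x).
Proof.
move=> bw; elim: s => [|i s IHs].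
  by rewrite (_ : (fun x => _) = (fun=> 0)); [exact: bm_cst|apply/funext => x; rewrite big_nil].
rewrite (_ : (fun x => _) = (fun x => (if P i then w i x else 0) + \sum_(j <- s | P j) w j x)).
  by apply: bmD => //; case: (boolP (P i)) => Pi; [exact: bw|exact: bm_cst].
by apply/funext => x; rewrite big_cons; case: ifP => // _; rewrite add0r.
Qed.

Lemma bm_prod (I : Type) (s : seq I) (P : pred I) (w : I -> T -> R) :
  (forall i, P i -> bm (w i)) -> bm (fun x => \prod_(i <- s | P i) w i x).
Proof.
move=> bw; elim: s => [|i s IHs].
  by rewrite (_ : (fun x => _) = (fun=> 1)); [exact: bm_cst|apply/funext => x; rewrite big_nil].
rewrite (_ : (fun x => _) = (fun x => (if P i then w i x else 1) * \prod_(j <- s | P j) w j x)).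
  by apply: bmM => //; case: (boolP (P i)) => Pi; [exact: bw|exact: bm_cst].
by apply/funext => x; rewrite big_cons; case: ifP => // _; rewrite mul1r.
Qed.

Lemma bm_indic (A : set T) : measurable A -> bm (\1_A : T -> R).
Proof.
move=> mA; split; first exact: measurable_indic.
by exists 1 => x; rewrite indicE ger0_norm ?ler0n// lern1 leq_b1.
Qed.

Lemma integ_bm v w : integ v -> bm w -> integ (fun x => v x * w x).
Proof.
move=> iv [mw [M wM]].
have := @integrableMr _ _ _ mu setT measurableT w (EFin \o v) mw.
move=> /(_ _ iv); rewrite (_ : ((EFin \o w) \* (EFin \o v))%E = EFin \o (fun x => v x * w x)).
  apply; exists M; split; first by rewrite num_real.
  by move=> N MN x _; apply: (le_trans (wM x)); exact: ltW.
by apply/funext => x /=; rewrite mulrC.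
Qed.

Lemma integ_norm v : integ v -> integ (fun x => `|v x|).
Proof. by move=> iv; exact: (integrable_norm iv). Qed.

Lemma integD v w : integ v -> integ w -> integ (fun x => v x + w x).
Proof. by move=> iv iw; have := integrableD measurableT iv iw. Qed.

Lemma integ_sum (I : Type) (s : seq I) (v : I -> T -> R) :
  (forall i, integ (v i)) -> integ (fun x => \sum_(i <- s) v i x).
Proof.
move=> iv; elim: s => [|i s IHs].
  rewrite (_ : (fun x => _) = (fun=> 0)); last by apply/funext => x; rewrite big_nil.
  exact: integrable0.
rewrite (_ : (fun x => _) = (fun x => v i x + \sum_(j <- s) v j x)); first exact: integD.
by apply/funext => x; rewrite big_cons.
Qed.

Definition II v w : R := \int[mu]_x (v x * w x).

Lemma II_D v w1 w2 : integ v -> bm w1 -> bm w2 ->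
  II v (fun x => w1 x + w2 x) = II v w1 + II v w2.
Proof.
move=> iv b1 b2; rewrite /II -RintegralD//; [|exact: integ_bm..].
by apply: eq_Rintegral => x _; rewrite mulrDr.
Qed.

Lemma II_Z v w c : integ v -> bm w -> II v (fun x => c * w x) = c * II v w.
Proof.
move=> iv b; rewrite /II -RintegralZl//; last exact: integ_bm.
by apply: eq_Rintegral => x _; rewrite mulrCA.
Qed.

Lemma II_B v w1 w2 : integ v -> bm w1 -> bm w2 ->
  II v (fun x => w1 x - w2 x) = II v w1 - II v w2.
Proof.
move=> iv b1 b2; rewrite /II -RintegralB//; [|exact: integ_bm..].
by apply: eq_Rintegral => x _; rewrite mulrBr.
Qed.

Lemma II_0 v : II v (fun=> 0) = 0.
Proof.
rewrite /II (_ : (fun x => _) = cst 0); first by rewrite /Rintegral integral0.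
by apply/funext => x; rewrite mulr0.
Qed.

Lemma II_sum (I : Type) (s : seq I) v (w : I -> T -> R) :
  integ v -> (forall i, bm (w i)) ->
  II v (fun x => \sum_(i <- s) w i x) = \sum_(i <- s) II v (w i).
Proof.
move=> iv bw; elim: s => [|i s IHs].
  rewrite big_nil (_ : (fun x => _) = (fun=> 0)) ?II_0//.
  by apply/funext => x; rewrite big_nil.
rewrite big_cons -IHs -II_D//; last exact: bm_sum.
by congr II; apply/funext => x; rewrite big_cons.
Qed.

Lemma II_suml (I : Type) (s : seq I) (v : I -> T -> R) w :
  (forall i, integ (v i)) -> bm w ->
  II (fun x => \sum_(i <- s) v i x) w = \sum_(i <- s) II (v i) w.
Proof.
move=> iv bw; elim: s => [|i s IHs].
  rewrite big_nil /II (_ : (fun x => _) = cst 0); first by rewrite /Rintegral integral0.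
  by apply/funext => x; rewrite big_nil mul0r.
rewrite big_cons -IHs /II -RintegralD//; last 2 first.
- exact: integ_bm.
- by apply: integ_bm => //; exact: integ_sum.
by apply: eq_Rintegral => x _; rewrite big_cons mulrDl.
Qed.

Lemma II_le v w1 w2 : integ v -> bm w1 -> bm w2 -> (forall x, 0 <= v x) ->
  (forall x, w1 x <= w2 x) -> II v w1 <= II v w2.
Proof.
move=> iv b1 b2 v0 w12; apply: le_Rintegral => //; [exact: integ_bm..|].
by move=> x _; rewrite ler_wpM2l.
Qed.

Lemma II_ge0 v w : (forall x, 0 <= v x) -> (forall x, 0 <= w x) -> 0 <= II v w.
Proof. by move=> v0 w0; apply: Rintegral_ge0 => x _; rewrite mulr_ge0. Qed.

Lemma ler_norm_II v w : integ v -> bm w -> `|II v w| <= II (fun x => `|v x|) (fun x => `|w x|).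
Proof.
move=> iv bw; apply: (le_trans (le_normr_Rintegral _ _)) => //; first exact: integ_bm.
by rewrite le_eqVlt; apply/orP; left; apply/eqP/eq_Rintegral => x _; rewrite normrM.
Qed.

Lemma II_cvg v (w : nat -> T -> R) w' M : integ v -> (forall n, measurable_fun setT (w n)) ->
  measurable_fun setT w' -> (forall n x, `|w n x| <= M) ->
  (forall x, w n x @[n --> \oo] --> w' x) -> II v (w n) @[n --> \oo] --> II v w'.
Proof.
move=> iv mw mw' wM ww'.
have mv : measurable_fun setT v by move/integrableP : iv => [/measurable_EFinP].
have [] := @dominated_convergence _ _ _ mu setT measurableT
  (fun n x => (v x * w n x)%:E) (fun x => (v x * w' x)%:E) (fun x => (M * `|v x|)%:E).
- by move=> n; apply/measurable_EFinP; exact: measurable_funM.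
- by apply/measurable_EFinP; exact: measurable_funM.
- apply: aeW => x _; apply: cvg_EFin; first exact: nearW.
  by apply: cvgM; [exact: cvg_cst|exact: ww'].
- exact: (integrableZl measurableT M (integ_norm iv)).
- by apply: aeW => x n _; rewrite lee_fin normrM mulrC ler_wpM2r.
move=> iw _ cv; apply: fine_cvg; rewrite fineK//.
exact: integrable_fin_num.
Qed.

End weighted_integrals.

(** * Products of functions of one coordinate *)

Section product_functions.
Context {R : realType} {d : nat}.
Implicit Types (x : 'rV[R]_d) (s : seq 'I_d).

Definition prodf (h : 'I_d -> R -> R) x : R := \prod_i h i (x ord0 i).

Lemma is_derive_line (f : 'rV[R]_d -> R) x v df :
  is_derive (0 : R) 1 (fun t : R => f (t *: v + x)) df -> is_derive x v f df.
Proof.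
move=> dg.
have E : (fun h : R => h^-1 *: ((f \o shift x) (h *: v) - f x)) =
  (fun h : R => h^-1 *: (((fun t : R => f (t *: v + x)) \o shift 0) (h *: (1 : R)) -
     (fun t : R => f (t *: v + x)) 0)).
  by apply/funext => h /=; rewrite addr0 scale0r add0r [h *: 1]mulr1.
split.
  by rewrite /derivable E; exact: (@ex_derive _ _ _ _ _ _ _ dg).
by rewrite /derive E; exact: (@derive_val _ _ _ _ _ _ _ dg).
Qed.

Lemma is_derive_prodf h x a df : is_derive (x ord0 a) 1 (h a) df ->
  is_derive x (delta_mx ord0 a) (prodf h) (df * \prod_(i | i != a) h i (x ord0 i)).
Proof.
move=> dh; apply: is_derive_line.
pose c := \prod_(i | i != a) h i (x ord0 i).
have -> : (fun t : R => prodf h (t *: delta_mx ord0 a + x)) =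
          (fun t : R => h a (t + x ord0 a) * c).
  apply/funext => t; rewrite /prodf (bigD1 a)//=; congr (h a _ * _).
    by rewrite !mxE !eqxx mulr1.
  by apply: eq_bigr => i ia; rewrite !mxE (negbTE ia) andbF mulr0 add0r.
have d1 : is_derive (0 : R) 1 (fun t : R => t + x ord0 a) 1.
  have := is_deriveD (is_derive_id (0 : R) (1 : R)) (is_derive_cst (x ord0 a) (0 : R) (1 : R)).
  by rewrite addr0.
have dh0 : is_derive ((fun t : R => t + x ord0 a) 0) 1 (h a) df by rewrite add0r.
have d2 := @is_derive1_comp R (h a) (fun t : R => t + x ord0 a) 0 _ _ dh0 d1.
have := is_deriveM d2 (is_derive_cst c (0 : R) (1 : R)).
by move=> /is_derive_eq; apply; rewrite scaler0 add0r mulr1 mulrC.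
Qed.

Lemma is_derive_prodf_seq (H : 'I_d -> nat -> R -> R) (k : 'I_d -> nat) x a :
  (forall i, deriv_seq (H i)) ->
  is_derive x (delta_mx ord0 a) (prodf (fun i => H i (k i)))
    (prodf (fun i => H i ((i == a) + k i)%N) x).
Proof.
move=> dH; have := @is_derive_prodf (fun i => H i (k i)) x a _ (dH a (k a) (x ord0 a)).
move=> /is_derive_eq; apply; rewrite /prodf [RHS](bigD1 a)//= eqxx; congr (_ * _).
by apply: eq_bigr => i /negbTE ->.
Qed.

(** Only the number of occurrences of each direction in s matters, hence [count_mem]. *)
Lemma partial_prodf (H : 'I_d -> nat -> R -> R) s : (forall i, deriv_seq (H i)) ->
  partial (prodf (fun i => H i 0%N)) s = prodf (fun i => H i (count_mem i s)).
Proof.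
move=> dH; elim: s => //= a s IHs; apply/funext => x; rewrite IHs.
rewrite (@derive_val _ _ _ _ _ _ _
  (is_derive_prodf_seq (fun i => count_mem i s) x a dH)).
by apply: eq_bigr => i _; rewrite eq_sym.
Qed.

Lemma continuous_prodf (h : 'I_d -> R -> R) : (forall i, continuous (h i)) ->
  continuous (prodf h).
Proof.
move=> ch; rewrite /prodf; elim: (index_enum _) => [|i s IHs].
  rewrite (_ : (fun x => _) = cst 1); first exact: cst_continuous.
  by apply/funext => x; rewrite big_nil.
rewrite (_ : (fun x => _) = (fun x : 'rV[R]_d => h i (x ord0 i)) \*
   (fun x : 'rV[R]_d => \prod_(j <- s) h j (x ord0 j))).
  move=> x; apply: continuousM; last exact: IHs.
  apply: (@continuous_comp _ _ _ (fun x : 'rV[R]_d => x ord0 i) (h i)).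
    exact: coord_continuous.
  exact: ch.
by apply/funext => x; rewrite big_cons.
Qed.

Lemma smooth_prodf (H : 'I_d -> nat -> R -> R) : (forall i, deriv_seq (H i)) ->
  smooth (prodf (fun i => H i 0%N)).
Proof.
move=> dH s; rewrite partial_prodf//; split.
  by apply: continuous_prodf => i; exact: deriv_seq_continuous.
by move=> a x; exact: (@ex_derive _ _ _ _ _ _ _ (is_derive_prodf_seq (fun i => count_mem i s) x a dH)).
Qed.

Lemma compact_support_box (phi : 'rV[R]_d -> R) (lo hi : 'I_d -> R) :
  (forall x, phi x != 0 -> forall i, lo i <= x ord0 i <= hi i) ->
  compact (closure [set x | phi x != 0]).
Proof.
move=> phi0; pose K := [set x : 'rV[R]_d | forall i, `[lo i, hi i]%classic (x ord0 i)].
have cK : compact K by exact: (rV_compact (fun i => @segment_compact R (lo i) (hi i))).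
refine (@subclosed_compact _ _ K _ cK _); first exact: closed_closure.
have clK : closed K by apply: compact_closed => //; exact: norm_hausdorff.
rewrite closureE; apply: smallest_sub => //.
Qed.

Lemma test_prodf (H : 'I_d -> nat -> R -> R) (lo hi : 'I_d -> R) :
  (forall i, deriv_seq (H i)) ->
  (forall i t, ~~ (lo i <= t <= hi i) -> H i 0%N t = 0) ->
  test_function (prodf (fun i => H i 0%N)).
Proof.
move=> dH H0; split; first exact: smooth_prodf.
apply: (@compact_support_box _ lo hi) => x; apply: contra_neqP.
move=> /existsNP[i /negP h]; rewrite /prodf (bigD1 i)//= H0 ?mul0r//.
Qed.

Lemma bm_coord (h : R -> R) i : measurable_fun setT h -> (exists M, forall t, `|h t| <= M) ->
  bm (fun x : 'rV[R]_d => h (x ord0 i)).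
Proof.
move=> mh [M hM]; split; last by exists M => x; exact: hM.
by apply: (measurableT_comp mh); exact: measurable_coord.
Qed.

Lemma bm_prodf (h : 'I_d -> R -> R) : (forall i, measurable_fun setT (h i)) ->
  (forall i, exists M, forall t, `|h i t| <= M) -> bm (prodf h).
Proof. by move=> mh bh; apply: bm_prod => i _; exact: bm_coord. Qed.

End product_functions.

(** * Smooth approximations of the ramp and of the Heaviside function *)

Section mollified_ramp.
Variable R : realType.
Implicit Types (t c h l : R).

Definition pos t := Num.max 0 t.
Definition hv t : R := (0 <= t)%R%:R.

Lemma measurable_hv : measurable_fun setT hv.
Proof.
have -> : hv = \1_(`[0, +oo[%classic : set R).
  by apply/funext => t; rewrite /hv indicE; congr (nat_of_bool _)%:R; rewrite mem_setE in_itv/= andbT.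
exact: measurable_indic.
Qed.

Lemma measurable_pos : measurable_fun setT pos.
Proof. exact: measurable_maxr. Qed.

(** The model is t * step (2 t + 2), whose transition takes place in [-1, -1/2]. It equals t in a
    neighbourhood of 0, so the rescaled derivatives tend to [hv] at 0 as well, where [hv] is 1;
    indicators of half-open cubes are then exact pointwise limits. *)
Lemma mollified_ramp : exists2 p : nat -> nat -> R -> R,
  [/\ forall m, deriv_seq (p m), forall m t, t <= -1 -> p m 0%N t = 0,
      forall m t, 0 <= t -> p m 0%N t = t & forall m t, `|p m 0%N t - pos t| <= 1] &
  [/\ forall t, p m 0%N t @[m --> \oo] --> pos t,
      forall t, p m 1%N t @[m --> \oo] --> hv t,
      forall m t, t <= -1 -> p m 1%N t = 0,
      forall m t, 0 <= t -> p m 1%N t = 1 &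
      exists M, forall m t, `|p m 1%N t| <= M].
Proof.
have sF n : Ck n (fun t : R => t * step (2 * t + 2)).
  by apply: CkM; [exact: Ck_id|apply: Ck_affine; exact: Ck_step].
have [F F0 dF] := Ck_deriv_seq sF.
have F0l t : t <= -1 -> F 0%N t = 0 by move=> t1; rewrite F0 step0 ?mulr0//; lra.
have F0r t : - 2^-1 <= t -> F 0%N t = t by move=> t1; rewrite F0 step1 ?mulr1//; lra.
have F1l t : t <= -1 -> F 1%N t = 0.
  move=> t1.
  have dl x : x < -1 -> F 1%N x = 0.
    exact: (deriv_seq_cst_left dF (a := -1) (c := 0) (fun x x1 => F0l x (ltW x1))).
  have [tl|te] := ltP t (-1); first exact: dl.
  have -> : t = -1 by lra.
  (* The endpoint -1 is reached by continuity of the derivative, which vanishes to its left. *)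
  apply/eqP; rewrite -[_ == _]negbK; apply/negP => /eqP F1.
  have cF := @deriv_seq_continuous R F 1 dF (-1).
  have : \forall x \near (-1 : R), F 1%N x != 0.
    by apply: (cF [set y | y != 0]); apply: open_nbhs_nbhs; split; [exact: open_neq|exact/eqP].
  move=> /nbhs_ballP[e /= e0 eF].
  have /eF/eqP : ball (-1 : R) e (-1 - e / 2).
    by rewrite /ball/= opprB addrC subrK gtr0_norm ?divr_gt0//; lra.
  by apply; apply: dl; rewrite ltrBlDr ltrDl divr_gt0.
have F1r t : - 2^-1 < t -> F 1%N t = 1.
  move=> t1; rewrite -(@derive_val _ _ _ _ _ _ _ (dF 0%N t)).
  have near_id : \forall x \near t, F 0%N x = id x.
    by near=> x; apply: F0r; apply: ltW; near: x; exact: nbhs_gtr.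
  by rewrite (near_eq_derive _ near_id) derive_id.
have [M M0 FM] := @bounded_cst_outside R (F 1%N) (-1) (-2^-1) 0 1
  ltac:(lra) (@deriv_seq_continuous R F 1 dF) (fun x x1 => F1l x (ltW x1)) F1r.
have Fpos t : `|F 0%N t - pos t| <= 1.
  rewrite /pos; have [t0|t0] := leP 0 t.
    by rewrite F0r ?subrr ?normr0//; lra.
  rewrite subr0; have [t1|t1] := leP t (-1); first by rewrite F0l// normr0.
  rewrite F0 normrM -[leRHS]mulr1 ler_pM//; first by rewrite ltr0_norm//; lra.
  by rewrite ger0_norm ?step_le1 ?step_ge0.
have m0 (m : nat) : 0 < m.+1%:R :> R by [].
have le_m1 m t : t <= -1 -> m.+1%:R * t <= -1.
  move=> t1; have m1 : 1 <= m.+1%:R :> R by rewrite ler1n.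
  by nra.
have posM m t : pos t = m.+1%:R^-1 * pos (m.+1%:R * t).
  by rewrite /pos -{2}[0](mulr0 (m.+1%:R : R)) -maxr_pMr// mulKf ?gt_eqF.
have bnd m t : `|m.+1%:R ^+ 0 / m.+1%:R * F 0%N (m.+1%:R * t) - pos t| <= m.+1%:R^-1.
  rewrite expr0 mul1r (posM m) -mulrBr normrM gtr0_norm ?invr_gt0//.
  by rewrite -[leRHS]mulr1 ler_wpM2l ?invr_ge0.
have p1 m t : m.+1%:R ^+ 1 / m.+1%:R * F 1%N (m.+1%:R * t) = F 1%N (m.+1%:R * t).
  by rewrite expr1 mulfV ?mul1r ?gt_eqF.
(* The rescaling F ((m + 1) t) / (m + 1): F differs from the ramp by at most 1, so the error is at
   most 1 / (m + 1), while the first derivative keeps the bound M. *)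
exists (fun m n t => m.+1%:R ^+ n / m.+1%:R * F n (m.+1%:R * t)); split.
- move=> m n t.
  have d1 : is_derive t 1 (fun s : R => m.+1%:R * s) m.+1%:R.
    have := is_deriveZ (m.+1%:R : R) (is_derive_id t (1 : R)).
    by move=> /is_derive_eq; apply; exact: mulr1.
  have d2 := @is_derive1_comp R (F n) (fun s : R => m.+1%:R * s) t _ _ (dF n _) d1.
  have := is_deriveZ (m.+1%:R ^+ n / m.+1%:R : R) d2.
  by move=> /is_derive_eq; apply; rewrite /GRing.scale/= exprS; ring.
- by move=> m t t1; rewrite F0l ?mulr0//; exact: le_m1.
- move=> m t t0; rewrite F0r; first by rewrite expr0 mul1r mulKf ?gt_eqF.
  by rewrite (@le_trans _ _ 0) ?mulr_ge0//; lra.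
- move=> m t; apply: (le_trans (bnd m t)).
  by rewrite invf_le1// ler1n.
- move=> t; apply/cvgrPdist_le => e e0.
  have [N _ hN] := near_infty_natSinv_lt (PosNum e0).
  exists N => // m /= Nm; rewrite distrC; apply: (le_trans (bnd m t)).
  by apply: ltW; exact: hN.
- move=> t; have [t0|t0] := leP 0 t.
    rewrite /hv t0 (_ : (fun m => _) = cst 1); first exact: cvg_cst.
    by apply/funext => m; rewrite p1 F1r// (@lt_le_trans _ _ 0) ?mulr_ge0//; lra.
  rewrite /hv leNgt t0/=; apply: cvg_near_cst.
  exists (Num.truncn (- t)^-1) => // m /= tm; rewrite p1 F1l//.
  rewrite -(@opprK _ t) mulrN lerN2 -ler_pdivrMr ?oppr_gt0// mul1r.
  apply: (le_trans (ltW (truncnS_gt _))).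
  by rewrite ler_nat.
- by move=> m t t1; rewrite p1 F1l//; exact: le_m1.
- move=> m t t0; rewrite p1 F1r// (@lt_le_trans _ _ 0) ?mulr_ge0//; lra.
- by exists M => m t; rewrite p1.
Unshelve. all: by end_near. Qed.

End mollified_ramp.

(** * Weak derivatives tested on cubes and trapezoids *)

Section weak_formula.
Context {R : realType} {d : nat}.
Local Notation mu := (lebesgue_rV R d).
Implicit Types (v g : 'rV[R]_d -> R) (c : 'I_d -> R) (a : 'I_d) (h l t : R).

Definition weak_pair a v g := [/\ integ mu v, integ mu g &
  forall phi, test_function phi ->
    \int[mu]_x (v x * 'D_(delta_mx ord0 a) phi x) = - \int[mu]_x (g x * phi x)].

Definition ii h t := hv t - hv (t - h).

(** The primitive of [ii h t - ii h (t - l)], that is, the convolution of the indicators of [0, h)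
    and [0, l). *)
Definition trap h l t := pos t - pos (t - h) - pos (t - l) + pos (t - l - h).

Definition cubei c h := prodf (d := d) (fun i t => ii h (t - c i)).

(** A trapezoid in direction a and indicators in the other directions: its derivative along a is the
    indicator of a cube minus that of the cube translated by l. *)
Definition trapi a c h l := prodf (d := d)
  (fun i t => if i == a then trap h l (t - c i) else ii h (t - c i)).

Definition shiftc a l c : 'I_d -> R := fun i => c i + (if i == a then l else 0).

Lemma iiE h t : 0 <= h -> ii h t = (0 <= t < h)%R%:R.
Proof.
move=> h0; rewrite /ii /hv subr_ge0.
have [t0|t0] := leP 0 t; have [th|th] := leP h t; rewrite /= ?subr0 ?subrr//.
by exfalso; lra.
Qed.

Lemma ii_bounds h t : 0 <= h -> 0 <= ii h t <= 1.
Proof. by move=> h0; rewrite iiE// ler0n lern1 leq_b1. Qed.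

Lemma pos_trap h l t : 0 <= h -> 0 <= l -> 0 <= trap h l t <= l.
Proof.
move=> h0 l0; rewrite /trap /pos.
have [?|?] := leP 0 t; have [?|?] := leP 0 (t - h);
have [?|?] := leP 0 (t - l); have [?|?] := leP 0 (t - l - h); apply/andP; split; lra.
Qed.

Lemma measurable_shift (f : R -> R) (b : R) : measurable_fun setT f ->
  measurable_fun setT (fun t => f (t - b)).
Proof. by move=> mf; apply: (measurableT_comp mf); exact: measurable_funB. Qed.

Lemma measurable_ii h : measurable_fun setT (ii h).
Proof.
by apply: measurable_funB; [exact: measurable_hv|apply: measurable_shift; exact: measurable_hv].
Qed.

Lemma measurable_trap h l : measurable_fun setT (trap h l).
Proof.
have mp : measurable_fun setT (@pos R) by exact: measurable_pos.
rewrite /trap; apply: measurable_funD; last first.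
  rewrite (_ : (fun t => _) = (fun t => pos (t - (l + h)))); first exact: measurable_shift.
  by apply/funext => t; rewrite opprD addrA.
by apply: measurable_funB; [apply: measurable_funB|]; rewrite //; exact: measurable_shift.
Qed.

Lemma bm_cubei c h : 0 <= h -> bm (cubei c h).
Proof.
move=> h0; apply: bm_prodf => i; first by apply: measurable_shift; exact: measurable_ii.
by exists 1 => t; have /andP[? ?] := ii_bounds (t - c i) h0; rewrite ger0_norm.
Qed.

Lemma bm_trapi a c h l : 0 <= h -> 0 <= l -> bm (trapi a c h l).
Proof.
move=> h0 l0; apply: bm_prodf => i; case: (i == a) => /=.
- apply: measurable_shift; exact: measurable_trap.
- apply: measurable_shift; exact: measurable_ii.
- by exists l => t; have /andP[? ?] := pos_trap (t - c i) h0 l0; rewrite ger0_norm.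
- by exists 1 => t; have /andP[? ?] := ii_bounds (t - c i) h0; rewrite ger0_norm.
Qed.

Lemma cubei_ge0 c h x : 0 <= h -> 0 <= cubei c h x.
Proof. by move=> h0; apply: prodr_ge0 => i _; case/andP: (ii_bounds (x ord0 i - c i) h0). Qed.

Lemma trapi_ge0 a c h l x : 0 <= h -> 0 <= l -> 0 <= trapi a c h l x.
Proof.
move=> h0 l0; apply: prodr_ge0 => i _; case: ifP => _.
  by case/andP: (pos_trap (x ord0 i - c i) h0 l0).
by case/andP: (ii_bounds (x ord0 i - c i) h0).
Qed.

Lemma cvg_prodf (w : nat -> 'I_d -> R -> R) (w' : 'I_d -> R -> R) x :
  (forall i t, w m i t @[m --> \oo] --> w' i t) ->
  prodf (w m) x @[m --> \oo] --> prodf w' x.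
Proof.
move=> ww'; rewrite /prodf; elim: (index_enum _) => [|i s IHs].
  rewrite big_nil (_ : (fun m => _) = cst 1); first exact: cvg_cst.
  by apply/funext => m; rewrite big_nil.
rewrite big_cons (_ : (fun m => _) = (fun m => w m i (x ord0 i)) \*
    (fun m => \prod_(j <- s) w m j (x ord0 j))); first exact: cvgM.
by apply/funext => m; rewrite big_cons.
Qed.

Lemma prodf_bound (w : 'I_d -> R -> R) M x : (forall i t, `|w i t| <= M) ->
  `|prodf w x| <= M ^+ d.
Proof.
move=> wM; rewrite /prodf normr_prod -[X in _ ^+ X]card_ord -prodr_const.
by apply: ler_prod => i _; rewrite normr_ge0 wM.
Qed.

Lemma deriv_seq_shift (H : nat -> R -> R) (b : R) : deriv_seq H ->
  deriv_seq (fun n t => H n (t - b)).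
Proof.
move=> dH n t.
have d1 : is_derive t 1 (fun s : R => s - b) 1.
  have := is_deriveD (is_derive_id t (1 : R)) (is_derive_cst (- b) t (1 : R)).
  by rewrite addr0.
have := @is_derive1_comp R (H n) (fun s : R => s - b) t _ _ (dH n _) d1.
by rewrite mulr1.
Qed.

Lemma deriv_seqD (H K : nat -> R -> R) : deriv_seq H -> deriv_seq K ->
  deriv_seq (fun n t => H n t + K n t).
Proof. by move=> dH dK n t; exact: is_deriveD. Qed.

Lemma deriv_seqB (H K : nat -> R -> R) : deriv_seq H -> deriv_seq K ->
  deriv_seq (fun n t => H n t - K n t).
Proof. by move=> dH dK n t; exact: is_deriveB. Qed.

(* The trapezoid is the limit of test functions whose derivatives tend to the
   difference of the indicators of the two cubes. *)
Lemma weak_trap a v g c h l : weak_pair a v g -> 0 < h -> 0 <= l ->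
  II mu v (cubei c h) - II mu v (cubei (shiftc a l c) h) = - II mu g (trapi a c h l).
Proof.
move=> [iv ig vg] h0 l0; have h0' := ltW h0.
have [p [dp pl pr pbnd] [p0 p1 p1l p1r [M pM]]] := mollified_ramp R.
(* [A] smooths the trapezoid and [B] the indicator of [0, h). The shifted index in [B] comes from
   the indicator being a difference of derivatives of ramps. *)
pose A m n t := p m n t - p m n (t - h) - p m n (t - l) + p m n (t - l - h).
pose B m n t := p m n.+1 t - p m n.+1 (t - h).
pose H m i n t := if i == a then A m n (t - c i) else B m n (t - c i).
have dA m : deriv_seq (A m).
  apply: deriv_seqD; last first.
    by apply: (@deriv_seq_shift (fun n t => p m n (t - h)) l); exact: deriv_seq_shift.
  by apply: deriv_seqB; [apply: deriv_seqB|]; rewrite //; exact: deriv_seq_shift.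
have dB m : deriv_seq (B m).
  have dp' : deriv_seq (fun n => p m n.+1) by move=> n; exact: dp.
  apply: deriv_seqB => //; exact: (deriv_seq_shift _ dp').
have dH m i : deriv_seq (H m i).
  by rewrite /H; case: (i == a); exact: deriv_seq_shift.
have tH m : test_function (prodf (fun i => H m i 0%N)).
  apply: (@test_prodf _ _ _ (fun i => c i - 1) (fun i => c i + h + l)) => // i t.
  rewrite negb_and -!ltNge => /orP[t1|t1]; rewrite /H /A /B; case: ifP => _.
  - by rewrite !pl ?subrr ?addr0//; lra.
  - by rewrite !p1l ?subrr//; lra.
  - by rewrite !pr; lra.
  - by rewrite !p1r ?subrr//; lra.
pose D m x := prodf (fun i => H m i (i == a)%:R) x.
have DE m x : 'D_(delta_mx ord0 a) (prodf (fun i => H m i 0%N)) x = D m x.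
  rewrite (@derive_val _ _ _ _ _ _ _ (is_derive_prodf_seq (fun=> 0%N) x a (dH m))).
  by apply: eq_bigr => i _; rewrite addn0; case: (i == a).
have mH m i n : measurable_fun setT (H m i n).
  by apply: continuous_measurable_fun; exact: deriv_seq_continuous.
pose N := 4 * `|M| + 4 + l.
have H1N m i t : `|H m i (i == a)%:R t| <= N.
  have MM s : `|p m 1%N s| <= `|M| by rewrite (le_trans (pM m s)) ?ler_norm.
  rewrite /H /A /B; case: eqP => _ /=.
    have := MM (t - c i); have := MM (t - c i - h); have := MM (t - c i - l).
    have := MM (t - c i - l - h); rewrite /N !ler_norml => /andP[? ?] /andP[? ?] /andP[? ?] /andP[? ?].
    by apply/andP; split; lra.
  have := MM (t - c i); have := MM (t - c i - h).
  rewrite /N !ler_norml => /andP[? ?] /andP[? ?].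
  by apply/andP; split; lra.
have H0N m i t : `|H m i 0%N t| <= N.
  have MM s : `|p m 1%N s| <= `|M| by rewrite (le_trans (pM m s)) ?ler_norm.
  rewrite /H; case: eqP => _ /=.
    have := pbnd m (t - c i); have := pbnd m (t - c i - h); have := pbnd m (t - c i - l).
    have := pbnd m (t - c i - l - h); have := pos_trap (t - c i) h0' l0.
    rewrite /N /A /trap !ler_norml => /andP[? ?] /andP[? ?] /andP[? ?] /andP[? ?] /andP[? ?].
    by have := normr_ge0 M; move=> ?; apply/andP; split; lra.
  have := MM (t - c i); have := MM (t - c i - h).
  rewrite /N /B !ler_norml => /andP[? ?] /andP[? ?].
  by apply/andP; split; lra.
have mprod w : (forall i, measurable_fun setT (w i)) -> measurable_fun setT (prodf (d := d) w).
  move=> mw; apply: measurable_prod => i _.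
  by apply: (measurableT_comp (mw i)); exact: measurable_coord.
have bc := bm_cubei c h0'; have bs := bm_cubei (shiftc a l c) h0'.
have cv1 : II mu v (D m) @[m --> \oo] --> II mu v (fun x => cubei c h x - cubei (shiftc a l c) h x).
  apply: (@II_cvg _ _ _ _ _ _ _ (N ^+ d)) => //.
  - by move=> m; apply: mprod.
  - exact: (bmB bc bs).1.
  - by move=> m x; apply: prodf_bound => i t; exact: H1N.
  move=> x; have -> : cubei c h x - cubei (shiftc a l c) h x =
      prodf (fun i t => if i == a then ii h (t - c i) - ii h (t - c i - l) else ii h (t - c i)) x.
    rewrite /cubei /prodf (bigD1 a)//= [X in _ - X](bigD1 a)//= [RHS](bigD1 a)//= eqxx.
    rewrite /shiftc eqxx [X in X - _ = _](_ : _ = ii h (x ord0 a - c a) *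
       \prod_(i | i != a) ii h (x ord0 i - c i))//.
    rewrite [X in _ * _ - _ * X](_ : _ = \prod_(i | i != a) ii h (x ord0 i - c i)).
      rewrite [in RHS](eq_bigr (fun i => ii h (x ord0 i - c i))) -?mulrBl.
        by congr (_ * _); congr (_ - ii h _); rewrite opprD addrA.
      by move=> i /negbTE ->.
    by apply: eq_bigr => i /negbTE ->; rewrite addr0.
  apply: cvg_prodf => i t; rewrite /H /A /B /ii; case: eqP => _ /=; last by apply: cvgB; exact: p1.
  rewrite (_ : hv (t - c i) - _ - _ = hv (t - c i) - hv (t - c i - h) - hv (t - c i - l) +
     hv (t - c i - l - h)); last by ring.
  by apply: cvgD; [apply: cvgB; [apply: cvgB|]|]; exact: p1.
have cv2 : II mu g (prodf (fun i => H m i 0%N)) @[m --> \oo] --> II mu g (trapi a c h l).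
  apply: (@II_cvg _ _ _ _ _ _ _ (N ^+ d)) => //.
  - by move=> m; apply: mprod.
  - by have [] := bm_trapi a c h0' l0.
  - by move=> m x; apply: prodf_bound => i t; exact: H0N.
  move=> x; apply: cvg_prodf => i t; rewrite /H /A /B /ii /trap; case: eqP => _ /=.
    by apply: cvgD; [apply: cvgB; [apply: cvgB|]|]; exact: p0.
  by apply: cvgB; exact: p1.
rewrite -II_B//; have E : (fun m => II mu v (D m)) =
    (fun m => - II mu g (prodf (fun i => H m i 0%N))).
  apply/funext => m; rewrite -(vg _ (tH m)); apply: eq_Rintegral => x _.
  by rewrite DE.
by rewrite E in cv1; apply: (cvg_unique _ cv1 (cvgN cv2)).
Qed.

End weak_formula.

(** * Subdivision of a cube into equal subcubes *)

Section subdivision.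
Context {R : realType} {d : nat}.
Implicit Types (c : 'I_d -> R) (a : 'I_d) (h l t : R) (K : nat) (x : 'rV[R]_d).

Definition sub c h K (z : {ffun 'I_d -> 'I_K}) : 'I_d -> R := fun i => c i + (z i)%:R * h.

Lemma ii_sum h K t : ii (K%:R * h) t = \sum_(k < K) ii h (t - k%:R * h).
Proof.
have E := telescope_sumr (fun k => hv (t - k%:R * h)) (leq0n K).
rewrite /= mul0r subr0 in E.
rewrite /ii -opprB -E -sumrN big_mkord; apply: eq_bigr => k _.
by rewrite opprB -natr1 mulrDl mul1r opprD addrA.
Qed.

Lemma trap_sum h l K t : trap (K%:R * h) l t = \sum_(k < K) trap h l (t - k%:R * h).
Proof.
pose u s : R := pos s - pos (s - l).
have trapE h' s : trap h' l s = u s - u (s - h').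
  rewrite /trap /u opprD opprK [s - h' - l]addrAC; ring.
have E := telescope_sumr (fun k => u (t - k%:R * h)) (leq0n K).
rewrite /= mul0r subr0 in E.
rewrite trapE -opprB -E -sumrN big_mkord; apply: eq_bigr => k _.
rewrite trapE opprB -natr1 mulrDl mul1r; congr (_ - u _).
by rewrite opprD addrA.
Qed.

(** Expanding a product over coordinates of sums over K intervals gives one term for each choice of
    an interval in every coordinate, that is, for each subcube. *)
Lemma prodf_sub (w W : 'I_d -> R -> R) c h K x :
  (forall i t, W i t = \sum_(k < K) w i (t - k%:R * h)) ->
  prodf (fun i t => W i (t - c i)) x =
  \sum_(z : {ffun 'I_d -> 'I_K}) prodf (fun i t => w i (t - sub c h z i)) x.
Proof.
move=> Ww; rewrite /prodf; under eq_bigr do rewrite Ww.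
rewrite bigA_distr_bigA; apply: eq_bigr => z _; apply: eq_bigr => i _.
by rewrite /sub opprD addrA.
Qed.

Lemma cubei_sub c h K x :
  cubei c (K%:R * h) x = \sum_(z : {ffun 'I_d -> 'I_K}) cubei (sub c h z) h x.
Proof.
exact: (@prodf_sub (fun=> ii h) (fun=> ii (K%:R * h)) c h K x (fun _ t => ii_sum h K t)).
Qed.

Lemma trapi_sub a c h l K x :
  trapi a c (K%:R * h) l x = \sum_(z : {ffun 'I_d -> 'I_K}) trapi a (sub c h z) h l x.
Proof.
have := @prodf_sub (fun i => if i == a then trap h l else ii h)
  (fun i => if i == a then trap (K%:R * h) l else ii (K%:R * h)) c h K x.
have E h' c' : trapi a c' h' l x =
    prodf (fun i t => (if i == a then trap h' l else ii h') (t - c' i)) x.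
  by apply: eq_bigr => i _; case: ifP.
rewrite E => ->; first by apply: eq_bigr => z _; rewrite E.
by move=> i t; case: ifP => _; [exact: trap_sum|exact: ii_sum].
Qed.

Lemma shiftc_sub a l c h K (z : {ffun 'I_d -> 'I_K}) :
  shiftc a l (sub c h z) = sub (shiftc a l c) h z.
Proof. by apply/funext => i; rewrite /shiftc /sub addrAC. Qed.

Lemma cubeiE c h x : 0 <= h ->
  cubei c h x = [forall i, c i <= x ord0 i < c i + h]%:R.
Proof.
move=> h0; rewrite /cubei /prodf.
rewrite (eq_bigr (fun i => (c i <= x ord0 i < c i + h)%R%:R)); last first.
  by move=> i _; rewrite iiE// subr_ge0 ltrBlDl.
case: (boolP [forall i, _]) => [/forallP H|].
  by rewrite big1// => i _; rewrite H.
by rewrite negb_forall => /existsP[i /negbTE H]; rewrite (bigD1 i)//= H mul0r.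
Qed.

Lemma trapi_le a c h x : 0 <= h ->
  trapi a c h h x <= h * (cubei c h x + cubei (shiftc a h c) h x).
Proof.
move=> h0; rewrite /trapi /cubei /prodf (bigD1 a)//= eqxx.
rewrite [X in _ <= _ * (X + _)](bigD1 a)//= [X in _ <= _ * (_ + X)](bigD1 a)//= /shiftc eqxx.
rewrite (eq_bigr (fun i => ii h (x ord0 i - c i))); last by move=> i /negbTE ->.
rewrite [X in _ <= _ * (_ + _ * X)](eq_bigr (fun i => ii h (x ord0 i - c i))); last first.
  by move=> i /negbTE ->; rewrite addr0.
rewrite -mulrDl mulrA ler_wpM2r//.
  by apply: prodr_ge0 => i _; case/andP: (ii_bounds (x ord0 i - c i) h0).
have -> : x ord0 a - (c a + h) = x ord0 a - c a - h by ring.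
set t := x ord0 a - c a; rewrite /trap /pos !iiE//.
have b1 : (nat_of_bool true)%:R = 1 :> R by [].
have b0 : (nat_of_bool false)%:R = 0 :> R by [].
have [?|?] := leP 0 t; have [?|?] := leP 0 (t - h); have [?|?] := leP 0 (t - h - h);
have [?|?] := ltP t h; have [?|?] := ltP (t - h) h; rewrite !(andbT, andbF) ?b1 ?b0; lra.
Qed.

(** The indicators of the subcubes take the values 0 and 1 and add up to 1 at x, so exactly one of
    them is 1. *)
Lemma sub_cell c h K x : 0 <= h -> cubei c (K%:R * h) x != 0 ->
  exists z0 : {ffun 'I_d -> 'I_K}, cubei c (K%:R * h) x = 1 /\
    forall z : {ffun 'I_d -> 'I_K}, cubei (sub c h z) h x = (z == z0)%:R.
Proof.
move=> h0 q0.
have q1 : cubei c (K%:R * h) x = 1.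
  by move: q0; rewrite cubeiE ?mulr_ge0//; case: [forall _, _] => //; rewrite eqxx.
have S1 : \sum_(z : {ffun 'I_d -> 'I_K}) cubei (sub c h z) h x = 1 by rewrite -cubei_sub.
have : \sum_(z : {ffun 'I_d -> 'I_K}) cubei (sub c h z) h x != 0 by rewrite S1 oner_neq0.
case: (pickP (fun z : {ffun 'I_d -> 'I_K} => cubei (sub c h z) h x != 0)) => [z0 hz0 _|hz]; last first.
  by rewrite big1 ?eqxx// => z _; have := hz z => /negbFE/eqP.
have z01 : cubei (sub c h z0) h x = 1.
  by move: hz0; rewrite cubeiE//; case: [forall _, _] => //; rewrite eqxx.
exists z0; split => // z; have [->|zz0] := eqVneq z z0; first by rewrite z01.
have S0 : \sum_(z | z != z0) cubei (sub c h z) h x = 0.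
  by move: S1; rewrite (bigD1 z0)//= z01 => /eqP; rewrite addrC eq_sym -subr_eq subrr eq_sym => /eqP.
by apply/eqP; move/psumr_eq0P : S0 => ->// w _; exact: cubei_ge0.
Qed.

Lemma sub_cell0 c h K x (z : {ffun 'I_d -> 'I_K}) : 0 <= h ->
  cubei c (K%:R * h) x = 0 -> cubei (sub c h z) h x = 0.
Proof.
by move=> h0; rewrite cubei_sub => /psumr_eq0P ->// w _; exact: cubei_ge0.
Qed.

End subdivision.

(** * Approximation of the sign of an integrable function on dyadic subcubes *)

Section dyadic_approximation.
Context {R : realType} {d : nat}.
Local Notation mu := (lebesgue_rV R d).
Variables (v : 'rV[R]_d -> R) (c : 'I_d -> R) (H : R).
Hypotheses (iv : integ mu v) (H0 : 0 < H).

Let mesh m : R := H / (2 ^ m)%:R.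

Let mesh_gt0 m : 0 < mesh m.
Proof. by rewrite divr_gt0// ltr0n expn_gt0. Qed.

Let mesh_ge0 m : 0 <= mesh m. Proof. exact: ltW. Qed.

Let meshE m : (2 ^ m)%:R * mesh m = H.
Proof. by rewrite mulrC divfK// pnatr_eq0 -lt0n expn_gt0. Qed.

Let cell m (z : {ffun 'I_d -> 'I_(2 ^ m)}) x := cubei (sub c (mesh m) z) (mesh m) x.

Let q x := cubei c H x.

Let un m (e : {ffun 'I_d -> 'I_(2 ^ m)} -> bool) x := \sum_z (e z)%:R * cell z x.

Let cellP m x : q x = 0 /\ (forall z : {ffun 'I_d -> 'I_(2 ^ m)}, cell z x = 0) \/
  exists z0 : {ffun 'I_d -> 'I_(2 ^ m)}, q x = 1 /\ forall z, cell z x = (z == z0)%:R.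
Proof.
rewrite /q /cell -(meshE m).
have [q0|] := eqVneq (cubei c ((2 ^ m)%:R * mesh m) x) 0; last first.
  by move=> /(sub_cell (mesh_ge0 m)) ?; right.
by left; split => // z; exact: sub_cell0.
Qed.

Let un0 m (e : {ffun 'I_d -> 'I_(2 ^ m)} -> bool) x : (forall z : {ffun 'I_d -> 'I_(2 ^ m)}, cell z x = 0) -> un e x = 0.
Proof. by move=> z0; rewrite /un big1// => z _; rewrite z0 mulr0. Qed.

Let un1 m (e : {ffun 'I_d -> 'I_(2 ^ m)} -> bool) x (z0 : {ffun 'I_d -> 'I_(2 ^ m)}) : (forall z : {ffun 'I_d -> 'I_(2 ^ m)}, cell z x = (z == z0)%:R) ->
  un e x = (e z0)%:R.
Proof.
move=> zz0; rewrite /un (bigD1 z0)//= zz0 eqxx mulr1 big1 ?addr0// => z /negbTE zn.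
by rewrite zz0 zn mulr0.
Qed.

Let bm_q : bm q. Proof. by apply: bm_cubei; exact: ltW. Qed.

Let bm_un m (e : {ffun 'I_d -> 'I_(2 ^ m)} -> bool) : bm (un e).
Proof. by apply: bm_sum => z _; apply: bmZ; exact: bm_cubei. Qed.

Let w x := `|v x|.
Let iw : integ mu w. Proof. exact: integ_norm. Qed.

Let dist A m (e : {ffun 'I_d -> 'I_(2 ^ m)} -> bool) :=
  II mu w (fun x => `|q x * \1_A x - un e x|).

(** Sets whose trace on the cube is approximated in L^1(|v|) by unions of dyadic subcubes; [un e] is
    the indicator of the union selected by e. Approximation is required at every sufficiently fine
    level, so that two sets can be treated at a common one. Good sets form a sigma-algebra
    containing the half-spaces, hence all measurable sets. *)
Let good A := measurable A /\ forall eps, 0 < eps ->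
  exists m0, forall m, (m0 <= m)%N -> exists e : {ffun 'I_d -> 'I_(2 ^ m)} -> bool,
    dist A e < eps.

Let bm_dist A m (e : {ffun 'I_d -> 'I_(2 ^ m)} -> bool) : measurable A ->
  bm (fun x => `|q x * \1_A x - un e x|).
Proof.
by move=> mA; apply/bm_norm/bmB => //; apply: bmM => //; exact: bm_indic.
Qed.

Let bm_dist2 A B : measurable A -> measurable B -> bm (fun x => `|q x * \1_A x - q x * \1_B x|).
Proof.
by move=> mA mB; apply/bm_norm/bmB; apply: bmM => //; exact: bm_indic.
Qed.

Let good0 : good set0.
Proof.
split=> // eps e0; exists 0%N => m _; exists (fun=> false); rewrite /dist.
rewrite (_ : (fun x => _) = (fun=> 0)) ?II_0//; apply/funext => x.
rewrite indic0 mulr0 /un big1 ?subrr ?normr0// => z _.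
by rewrite mul0r.
Qed.

Let goodC A : good A -> good (setT `\` A).
Proof.
move=> [mA gA]; split; first by rewrite setTD; exact: measurableC.
move=> eps e0; have [m0 hm0] := gA _ e0; exists m0 => m /hm0[e he].
exists (fun z => ~~ e z); apply: le_lt_trans he; rewrite le_eqVlt; apply/orP; left.
apply/eqP; congr II; apply/funext => x.
rewrite setTD indicC.
have [[q0 z0]|[z0 [q1 z1]]] := cellP m x; first by rewrite q0 !mul0r !un0.
rewrite q1 (un1 _ z1) (un1 _ z1) !mul1r.
rewrite indicE; case: (x \in A); case: (e z0) => /=; rewrite ?subrr ?sub0r ?subr0 ?normrN//.
Qed.

Let goodU A B : good A -> good B -> good (A `|` B).
Proof.
move=> [mA gA] [mB gB]; split; first exact: measurableU.
move=> eps e0; have e20 : 0 < eps / 2 by rewrite divr_gt0.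
have [m1 h1] := gA _ e20; have [m2 h2] := gB _ e20.
exists (maxn m1 m2) => m; rewrite geq_max => /andP[/h1[e1 he1] /h2[e2 he2]].
exists (fun z => e1 z || e2 z).
apply: (@le_lt_trans _ _ (dist A e1 + dist B e2)); last by rewrite [ltRHS]splitr ltrD.
rewrite /dist -II_D//; [|exact: bm_dist..].
apply: II_le => //.
- by apply: bm_dist; exact: measurableU.
- by apply: bmD; exact: bm_dist.
- by move=> x; exact: normr_ge0.
move=> x.
have [[q0 z0]|[z0 [q1 z1]]] := cellP m x; first by rewrite q0 !mul0r !un0// subrr normr0 addr0.
rewrite q1 !(un1 _ z1) !mul1r !indicE in_setU.
by case: (x \in A); case: (x \in B); case: (e1 z0); case: (e2 z0) => /=;
  rewrite ?subrr ?sub0r ?subr0 ?normrN ?normr0 ?normr1 ?addr0 ?add0r//; lra.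
Qed.

(** Half of eps pays for replacing A by some [U n], by dominated convergence, the other half for the
    dyadic approximation of that [U n]. *)
Let good_approx A (U : nat -> set 'rV[R]_d) : measurable A -> (forall n, good (U n)) ->
  (forall x, \forall n \near \oo, (x \in U n) = (x \in A)) -> good A.
Proof.
move=> mA gU UA; split=> // eps e0; have e20 : 0 < eps / 2 by rewrite divr_gt0.
have mU n : measurable (U n) by have [] := gU n.
have cv : II mu w (fun x => `|q x * \1_A x - q x * \1_(U n) x|) @[n --> \oo] --> (0 : R).
  rewrite -[X in _ --> X](II_0 mu w).
  have [_ [M qM]] := bm_q.
  apply: (@II_cvg _ _ _ _ _ _ _ M) => //.
  - by move=> n; have [] := bm_dist2 mA (mU n).
  - move=> n x; rewrite normr_id -mulrBr normrM -[leRHS]mulr1 ler_pM// !indicE.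
    by case: (x \in A); case: (x \in U n) => /=; rewrite ?subrr ?sub0r ?subr0 ?normrN ?normr0 ?normr1.
  move=> x; apply: cvg_near_cst; near=> n.
  rewrite !indicE (_ : (x \in U n) = (x \in A)) ?subrr ?normr0//.
  by near: n; exact: UA.
have [n _ hn] := (cvgrPdist_lt _ _).1 cv _ e20.
have [m0 hm0] := (gU n).2 _ e20; exists m0 => m /hm0[e he]; exists e.
have hn' : II mu w (fun x => `|q x * \1_A x - q x * \1_(U n) x|) < eps / 2.
  by have := hn n (leqnn n); rewrite /= sub0r normrN => /(le_lt_trans (ler_norm _)).
apply: (@le_lt_trans _ _ (II mu w (fun x => `|q x * \1_A x - q x * \1_(U n) x|) + dist (U n) e)).
  rewrite /dist -II_D//; [|exact: bm_dist2|exact: bm_dist].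
  apply: II_le => //.
  - exact: bm_dist.
  - by apply: bmD; [exact: bm_dist2|exact: bm_dist].
  - by move=> x; exact: normr_ge0.
  move=> x; apply: le_trans (ler_normD _ _).
  by rewrite addrA subrK.
by rewrite [ltRHS]splitr ltrD.
Unshelve. all: by end_near. Qed.

Let good_bigcup (A : (set 'rV[R]_d)^nat) : (forall n, good (A n)) -> good (\bigcup_n A n).
Proof.
move=> gA; apply: (@good_approx _ (fun n => \big[setU/set0]_(k < n) A k)).
- by apply: bigcup_measurable => n _; have [] := gA n.
- elim=> [|n IHn]; first by rewrite big_ord0; exact: good0.
  by rewrite big_ord_recr/=; exact: goodU.
move=> x; have [xA|xA] := boolP (x \in \bigcup_n A n).
  move: xA; rewrite inE => -[k _ Ak]; exists k.+1 => // n /= kn.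
  by rewrite -bigcup_mkord; apply/mem_set; exists k.
near=> n; apply/negbTE; apply: contra xA; rewrite !inE -bigcup_mkord => -[k _ Ak].
by exists k.
Unshelve. all: by end_near. Qed.

Let sigma_good : sigma_algebra setT good.
Proof. by split; [exact: good0|exact: goodC|exact: good_bigcup]. Qed.

Let good_ray i y : good [set x : 'rV[R]_d | y < x ord0 i].
Proof.
have mA : measurable [set x : 'rV[R]_d | y < x ord0 i].
  rewrite (_ : [set _ | _] = (fun x : 'rV[R]_d => x ord0 i) @^-1` `]y, +oo[%classic).
    rewrite -[X in measurable X]setTI; apply: measurable_coord => //.
  by apply/seteqP; split => x /=; rewrite in_itv/= andbT.
split=> // eps e0.
pose e m (z : {ffun 'I_d -> 'I_(2 ^ m)}) := y < sub c (mesh m) z i.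
(* A subcube is selected when its corner lies beyond y. If x is beyond y, so is the corner as soon
   as the mesh is less than the distance; if x is not, the corner never is. The indicators are thus
   eventually equal at each point. *)
have cv : II mu w (fun x => `|q x * \1_[set x : 'rV[R]_d | y < x ord0 i] x - un (@e n) x|)
    @[n --> \oo] --> (0 : R).
  rewrite -[X in _ --> X](II_0 mu w).
  apply: (@II_cvg _ _ _ _ _ _ _ 1) => //.
  - by move=> n; have [] := bm_dist (@e n) mA.
  - move=> n x; rewrite normr_id.
    have [[q0 z0]|[z0 [q1 z1]]] := cellP n x; first by rewrite q0 un0// mul0r subrr normr0.
    rewrite q1 (un1 _ z1) mul1r indicE.
    by case: (x \in _); case: (e _ _); rewrite /= ?subrr ?sub0r ?subr0 ?normrN ?normr0 ?normr1.
  move=> x; apply: cvg_near_cst.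
  have [yx|xy] := ltP y (x ord0 i).
    have : \forall n \near \oo, mesh n < x ord0 i - y.
      exists (Num.truncn (H / (x ord0 i - y))) => // n /= tn.
      rewrite /mesh ltr_pdivrMr ?ltr0n ?expn_gt0// mulrC -ltr_pdivrMr ?subr_gt0//.
      apply: (lt_le_trans (truncnS_gt _)); rewrite ler_nat.
      by rewrite (leq_ltn_trans tn)// ltn_expl.
    apply: filterS => n hn.
    have [[q0 z0]|[z0 [q1 z1]]] := cellP n x; first by rewrite q0 un0// mul0r subrr normr0.
    rewrite q1 (un1 _ z1) mul1r indicE mem_set//= (_ : e n z0) ?subrr ?normr0//.
    have := z1 z0; rewrite eqxx /cell cubeiE ?mesh_ge0//.
    case: (boolP [forall j, _]) => [/forallP/(_ i)/andP[_ xi] _|_ /eqP]; last first.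
      by rewrite eq_sym oner_eq0.
    by rewrite /e; lra.
  near=> n.
  have [[q0 z0]|[z0 [q1 z1]]] := cellP n x; first by rewrite q0 un0// mul0r subrr normr0.
  rewrite q1 (un1 _ z1) mul1r indicE memNset/=; last by rewrite /= ltNge xy.
  have := z1 z0; rewrite eqxx /cell cubeiE ?mesh_ge0//.
  case: (boolP [forall j, _]) => [/forallP/(_ i)/andP[xi _] _|_ /eqP]; last first.
    by rewrite eq_sym oner_eq0.
  by rewrite /e ltNge (le_trans xi xy)/= subrr normr0.
have [m0 _ hm0] := (cvgrPdist_lt _ _).1 cv _ e0.
exists m0 => m m0m; exists (@e m); rewrite /dist.
by have := hm0 m m0m; rewrite /= sub0r normrN => /(le_lt_trans (ler_norm _)).
Unshelve. all: by end_near. Qed.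

Let good_measurable A : measurable A -> good A.
Proof.
apply: smallest_sub => // B; rewrite -bigcup_seq/= => -[i _ [Y mY <-]].
rewrite setTI; have {}mY : (@RGenOInfty.G R).-sigma.-measurable Y.
  by rewrite -RGenOInfty.measurableE.
move: Y mY.
pose C := [set Y : set R | good ((fun x : 'rV[R]_d => x ord0 i) @^-1` Y)].
apply: (@smallest_sub _ _ _ C); last first.
  move=> _ [y ->]; rewrite /C/= (_ : _ @^-1` _ = [set x : 'rV[R]_d | y < x ord0 i]).
    exact: good_ray.
  by apply/seteqP; split => x /=; rewrite in_itv/= andbT.
split.
- by rewrite /C/= preimage_set0; exact: good0.
- by move=> Z CZ; rewrite /C/= setTD preimage_setC -setTD; exact: goodC.
- by move=> F CF; rewrite /C/= preimage_bigcup; exact: good_bigcup.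
Qed.

(** The sign of v is 2 times the indicator of {v >= 0} minus 1. Replacing that set by a union of
    subcubes makes the sign constant on each subcube, where the integral of v times the sign is at
    most the absolute value of the integral of v. *)
Lemma dyadic_approximation eps : 0 < eps -> exists m0, forall m, (m0 <= m)%N ->
  II mu (fun x => `|v x|) (cubei c H) <=
  \sum_(z : {ffun 'I_d -> 'I_(2 ^ m)})
     `|II mu v (cubei (sub c (H / (2 ^ m)%:R) z) (H / (2 ^ m)%:R))| + eps.
Proof.
move=> e0; pose A := [set x | 0 <= v x].
have mv : measurable_fun setT v by move/integrableP : iv => [/measurable_EFinP].
have mA : measurable A.
  rewrite (_ : A = v @^-1` `[0, +oo[%classic).
    by rewrite -[X in measurable X]setTI; exact: mv.
  by apply/seteqP; split => x /=; rewrite in_itv/= andbT.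
have e20 : 0 < eps / 2 by rewrite divr_gt0.
have [m0 hm0] := (good_measurable mA).2 _ e20; exists m0 => m /hm0[e he].
have -> : II mu (fun x => `|v x|) (cubei c H) =
    II mu v (fun x => q x * (2 * \1_A x - 1)).
  apply: eq_Rintegral => x _; suff -> : `|v x| = v x * (2 * \1_A x - 1) by rewrite mulrAC -mulrA.
  rewrite indicE /A; have [v0|v0] := leP 0 (v x).
    by rewrite mem_set//= ger0_norm//; ring.
  rewrite memNset/= ?ltr0_norm//; first by ring.
  by rewrite leNgt v0.
have bA : bm (fun x => q x * (2 * \1_A x - 1)).
  by apply: bmM => //; apply: bmB; [apply: bmZ; exact: bm_indic|exact: bm_cst].
have b2 : bm (fun x => 2 * un e x - q x) by apply: bmB => //; exact: bmZ.
have bc z : bm (@cell m z) by exact: bm_cubei.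
(* The sign constant on subcubes, plus an error that is twice the approximation error: hence eps / 2
   above. *)
have -> : II mu v (fun x => q x * (2 * \1_A x - 1)) =
  II mu v (fun x => 2 * un e x - q x) + II mu v (fun x => 2 * (q x * \1_A x - un e x)).
  rewrite -II_D//; last by apply: bmZ; apply: bmB => //; apply: bmM => //; exact: bm_indic.
  by congr II; apply/funext => x; ring.
apply: lerD.
  rewrite (_ : (fun x => 2 * un e x - q x) = (fun x => \sum_z (2 * (e z)%:R - 1) * cell z x)).
    rewrite II_sum//; last by move=> z; exact: bmZ.
    apply: ler_sum => z _; rewrite II_Z//; case: (e z).
      by rewrite mulr1 (_ : 2 - 1 = 1) ?mul1r ?ler_norm//; ring.
    by rewrite mulr0 sub0r mulN1r -normrN ler_norm.
  apply/funext => x; have -> : q x = \sum_(z : {ffun 'I_d -> 'I_(2 ^ m)}) cell z x.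
    by rewrite /q /cell -cubei_sub meshE.
  rewrite /un mulr_sumr -sumrB; apply: eq_bigr => z _; ring.
apply: (le_trans (ler_norm _)); apply: (le_trans (ler_norm_II _ _)) => //.
  by apply: bmZ; apply: bmB => //; apply: bmM => //; exact: bm_indic.
rewrite (_ : (fun x => `|2 * _|) = (fun x => 2 * `|q x * \1_A x - un e x|)); last first.
  by apply/funext => x; rewrite normrM ger0_norm.
rewrite II_Z//; last exact: bm_dist.
by rewrite mulrC -ler_pdivlMr// ltW.
Qed.

End dyadic_approximation.

(** * Comparison of |v| on two adjacent cubes *)

Section adjacent_cubes.
Context {R : realType} {d : nat}.
Local Notation mu := (lebesgue_rV R d).

(** [weak_trap] compares signed integrals over each small subcube and its translate. Summing
    absolute values over the subcubes gives the integrals of |v|, up to eps, by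
    [dyadic_approximation]. *)
Lemma adjacent_cubes (a : 'I_d) (v g : 'rV[R]_d -> R) (c : 'I_d -> R) h :
  weak_pair a v g -> 0 < h ->
  `|II mu (fun x => `|v x|) (cubei c h) - II mu (fun x => `|v x|) (cubei (shiftc a h c) h)|
  <= h * (II mu (fun x => `|g x|) (cubei c h) +
          II mu (fun x => `|g x|) (cubei (shiftc a h c) h)).
Proof.
move=> vg h0; have h0' := ltW h0; have [iv ig _] := vg; have ing := integ_norm ig.
apply/ler_addgt0Pr => eps e0.
have [m1 hm1] := dyadic_approximation c iv h0 e0.
have [m2 hm2] := dyadic_approximation (shiftc a h c) iv h0 e0.
pose m := maxn m1 m2.
have {}hm1 := hm1 m (leq_maxl _ _); have {}hm2 := hm2 m (leq_maxr _ _).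
set k := h / (2 ^ m)%:R in hm1 hm2.
have k0 : 0 < k by rewrite divr_gt0// ltr0n expn_gt0.
have k0' := ltW k0.
have kE : (2 ^ m)%:R * k = h by rewrite mulrC divfK// pnatr_eq0 -lt0n expn_gt0.
have upper c' : \sum_(z : {ffun 'I_d -> 'I_(2 ^ m)}) `|II mu v (cubei (sub c' k z) k)| <=
    II mu (fun x => `|v x|) (cubei c' h).
  rewrite -kE (_ : cubei c' _ = (fun x => \sum_(z : {ffun 'I_d -> 'I_(2 ^ m)})
      cubei (sub c' k z) k x)); last by apply/funext => x; exact: cubei_sub.
  rewrite II_sum//; [|exact: integ_norm|by move=> z; exact: bm_cubei].
  apply: ler_sum => z _; apply: (le_trans (ler_norm_II _ _)) => //; first exact: bm_cubei.
  rewrite le_eqVlt; apply/orP; left; apply/eqP; congr II; apply/funext => x.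
  by rewrite ger0_norm// cubei_ge0.
have mid : \sum_(z : {ffun 'I_d -> 'I_(2 ^ m)})
    `|II mu v (cubei (sub c k z) k) - II mu v (cubei (sub (shiftc a h c) k z) k)| <=
    h * (II mu (fun x => `|g x|) (cubei c h) +
          II mu (fun x => `|g x|) (cubei (shiftc a h c) h)).
  apply: (@le_trans _ _ (\sum_(z : {ffun 'I_d -> 'I_(2 ^ m)})
      II mu (fun x => `|g x|) (trapi a (sub c k z) k h))).
    apply: ler_sum => z _; rewrite -shiftc_sub (weak_trap _ vg)// normrN.
    apply: (le_trans (ler_norm_II _ _)) => //; first exact: bm_trapi.
    rewrite le_eqVlt; apply/orP; left; apply/eqP; congr II; apply/funext => x.
    by rewrite ger0_norm// trapi_ge0.
  (* The subcubes have side k but are translated by the full h, so their trapezoids add up to the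
     trapezoid of the whole cube, which is at most h on the two cubes and 0 elsewhere. *)
  rewrite -II_sum//; last by move=> z; exact: bm_trapi.
  rewrite -II_D//; [|exact: bm_cubei..].
  rewrite -II_Z//; last by apply: bmD; exact: bm_cubei.
  apply: II_le => //.
  - by apply: bm_sum => z _; exact: bm_trapi.
  - by apply: bmZ; apply: bmD; exact: bm_cubei.
  by move=> x; rewrite -trapi_sub kE; exact: trapi_le.
have up1 := upper c; have up2 := upper (shiftc a h c).
have dif : `|\sum_(z : {ffun 'I_d -> 'I_(2 ^ m)}) `|II mu v (cubei (sub c k z) k)| -
   \sum_(z : {ffun 'I_d -> 'I_(2 ^ m)}) `|II mu v (cubei (sub (shiftc a h c) k z) k)| | <=
    h * (II mu (fun x => `|g x|) (cubei c h) +
          II mu (fun x => `|g x|) (cubei (shiftc a h c) h)).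
  apply: le_trans mid; rewrite -sumrB; apply: (le_trans (ler_norm_sum _ _ _)).
  by apply: ler_sum => z _; exact: ler_dist_dist.
move: dif; rewrite !ler_norml => /andP[? ?]; apply/andP; split; lra.
Qed.

End adjacent_cubes.

(** * From functions on R^d to functions on the grid *)

Section grid_integrals.
Context {R : realType} {d : nat}.
Local Notation mu := (lebesgue_rV R d).
Variables (c0 : 'I_d -> R) (L : R) (T n : nat).
Hypothesis L0 : 0 < L.
Implicit Types (W : 'rV[R]_d -> R) (x y : grid d T n) (p : 'rV[R]_d) (a : 'I_d).

Local Notation side := (side n).
Local Notation avg := (avg n (2 ^ d) (@same_cell d T n)).

Definition msh j : R := L / (2 ^ j)%:R.

Lemma msh_gt0 j : 0 < msh j.
Proof. by rewrite divr_gt0// ltr0n expn_gt0. Qed.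

Lemma msh_ge0 j : 0 <= msh j. Proof. exact/ltW/msh_gt0. Qed.

Lemma mshE j : msh j = L * 2^-1 ^+ j.
Proof. by rewrite /msh natrX exprVn. Qed.

Lemma side_msh j : (j <= n)%N -> (side j)%:R * msh n = msh j.
Proof.
move=> jn; rewrite !mshE !sideE natrX mulrCA; congr (_ * _).
by rewrite -{2}(subnK jn) exprD mulrA exprVn mulfV ?mul1r// expf_neq0// pnatr_eq0.
Qed.

(** Integrals over the finest cells, not divided by their volume; the volume is restored in the
    thresholds used for the capacity. *)
Definition fcell W x : R := II mu W (cubei (sub c0 (msh n) x) (msh n)).

Definition corner j x : 'I_d -> R := fun i => c0 i + (x i %/ side j)%:R * msh j.

Lemma ii_block (h t : R) (K s u : nat) : (0 < s)%N -> (u.+1 * s <= K)%N ->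
  \sum_(k < K | (u == k %/ s)%N) ii h (t - k%:R * h) = ii (s%:R * h) (t - u%:R * (s%:R * h)).
Proof.
move=> s0 uK.
have -> : \sum_(k < K | (u == k %/ s)%N) ii h (t - k%:R * h) =
          \sum_(u * s <= k < u.+1 * s) ii h (t - k%:R * h).
  rewrite (big_nat_widen _ _ _ _ _ uK) (big_nat_widenl _ _ _ _ _ (leq0n (u * s))) big_mkord.
  apply: eq_bigl => k; rewrite eqn_leq leq_divRL// -[X in _ && X]ltnS ltn_divLR//.
  by case: (u * s <= k)%N; case: (k < u.+1 * s)%N.
have := telescope_sumr (fun k => hv (t - k%:R * h)) (_ : (u * s <= u.+1 * s)%N).
rewrite leq_mul2r leqnSn orbT => /(_ isT)/= E.
rewrite /ii -opprB (_ : t - u%:R * (s%:R * h) - s%:R * h = t - (u.+1 * s)%:R * h); last first.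
  by rewrite natrM -natr1; ring.
rewrite (_ : t - u%:R * (s%:R * h) = t - (u * s)%:R * h); last by rewrite natrM; ring.
rewrite -E -sumrN; apply: eq_bigr => k _.
by rewrite opprB -natr1 mulrDl mul1r opprD addrA.
Qed.

Lemma cell_sum j x p : (j <= n)%N ->
  \sum_(y | same_cell j x y) cubei (sub c0 (msh n) y) (msh n) p = cubei (corner j x) (msh j) p.
Proof.
move=> jn.
rewrite (eq_bigl (fun y : grid d T n => y \in family (fun i =>
  [pred k : 'I_(T * 2 ^ n) | (x i %/ side j == k %/ side j)%N]))); last first.
  by move=> y; apply/forallP/familyP => h i; exact: (h i).
rewrite /cubei /prodf -(bigA_distr_big_dep _ (fun i (k : 'I_(T * 2 ^ n)) =>
  ii (msh n) (p ord0 i - (c0 i + k%:R * msh n)))).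
apply: eq_bigr => i _; rewrite /corner -(side_msh jn) [in RHS]opprD [in RHS]addrA.
rewrite -(@ii_block _ _ (T * 2 ^ n))//.
- by apply: eq_bigr => k _; rewrite opprD addrA.
- exact: side_gt0.
- have E : (T * 2 ^ n = T * 2 ^ j * side j)%N by rewrite -mulnA -expnD subnKC.
  rewrite [leqRHS]E leq_mul2r ltn_divLR ?side_gt0//; apply/orP; right.
  by rewrite -E.
Qed.

Lemma avg_fcell W j x : integ mu W -> (j <= n)%N ->
  avg j (fcell W) x = (csize R n (2 ^ d) j)^-1 * II mu W (cubei (corner j x) (msh j)).
Proof.
move=> iW jn; congr (_ * _).
rewrite (_ : cubei (corner j x) _ = (fun p => \sum_(y | same_cell j x y)
    cubei (sub c0 (msh n) y) (msh n) p)); last by apply/funext => p; rewrite cell_sum.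
rewrite -big_filter (_ : (fun p => _) = (fun p => \sum_(y <- [seq y <- index_enum _ | same_cell j x y])
    cubei (sub c0 (msh n) y) (msh n) p)); last by apply/funext => p; rewrite big_filter.
by rewrite II_sum// => y; apply: bm_cubei; exact: msh_ge0.
Qed.

Lemma fcell_ge0 W x : (forall p, 0 <= W p) -> 0 <= fcell W x.
Proof. by move=> W0; apply: II_ge0 => // p; apply: cubei_ge0; exact: msh_ge0. Qed.

(* The trace on cubes of |grad W| <= W'. *)
Definition adj W W' := forall a c h, 0 < h ->
  `|II mu W (cubei c h) - II mu W (cubei (shiftc a h c) h)| <=
  h * (II mu W' (cubei c h) + II mu W' (cubei (shiftc a h c) h)).

Lemma adj_cell W W' j a x y : integ mu W -> integ mu W' -> adj W W' -> (j <= n)%N ->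
  (forall b, b != a -> x b = y b) -> (y a %/ side j = (x a %/ side j).+1)%N ->
  `|avg j (fcell W) x - avg j (fcell W) y| <=
  msh j * (avg j (fcell W') x + avg j (fcell W') y).
Proof.
move=> iW iW' aW jn xy xya; rewrite !avg_fcell//.
have -> : corner j y = shiftc a (msh j) (corner j x).
  apply/funext => i; rewrite /corner /shiftc; have [->|ia] := eqVneq i a.
    by rewrite xya -natr1 mulrDl mul1r addrA.
  by rewrite xy// addr0.
rewrite -mulrBr -mulrDr normrM gtr0_norm ?invr_gt0 ?csize_gt0 ?expn_gt0// mulrCA.
by rewrite ler_wpM2l ?aW ?msh_gt0// invr_ge0 ltW// csize_gt0// expn_gt0.
Qed.

(** Siblings differing in one direction lie on the two sides of the middle of their parent, since
    their indices have the same half. [avgS_le] bounds the averages of [fcell W'] over both children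
    by the parent's: this is the factor 2^d. *)
Lemma adj_avg W W' j a x y : integ mu W -> integ mu W' -> (forall p, 0 <= W' p) ->
  adj W W' -> (j < n)%N -> (forall b, b != a -> x b = y b) -> same_cell j x y ->
  avg j.+1 (fcell W) x - avg j.+1 (fcell W) y <=
  L * (2 ^ d)%:R * 2^-1 ^+ j * avg j (fcell W') x.
Proof.
move=> iW iW' W0 aW jn xy r.
have B0 : (0 < 2 ^ d)%N by rewrite expn_gt0.
have f0 z : 0 <= fcell W' z by exact: fcell_ge0.
have h0 : 0 <= (2^-1 : R) ^+ j by rewrite exprn_ge0// invr_ge0.
have main (u v : grid d T n) : (forall b, b != a -> u b = v b) -> same_cell j u v ->
    (v a %/ side j.+1 = (u a %/ side j.+1).+1)%N ->
    `|avg j.+1 (fcell W) u - avg j.+1 (fcell W) v| <=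
    L * (2 ^ d)%:R * 2^-1 ^+ j * avg j (fcell W') u.
  move=> uv ruv uva; apply: (le_trans (adj_cell iW iW' aW jn uv uva)).
  have le1 := avgS_le (@same_cell_le d T n) B0 u jn f0.
  have le2 := avgS_le (@same_cell_le d T n) B0 v jn f0.
  rewrite -(avg_inv n (2 ^ d) (@same_cell_sym d T n) (@same_cell_trans d T n) _ ruv) in le2.
  apply: (@le_trans _ _ (msh j.+1 * (2 * ((2 ^ d)%:R * avg j (fcell W') u)))).
    by rewrite ler_wpM2l ?msh_ge0//; lra.
  by rewrite mshE exprS le_eqVlt; apply/orP; left; apply/eqP; field.
have := xy a; have yx b : b != a -> y b = x b by move=> ba; rewrite xy.
have ryx : same_cell j y x by rewrite same_cell_sym.
have quo := r; move/same_cellP/(_ a) : quo; rewrite (sideS jn) !divnMA => quo _.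
have [lt|lt|eq] := ltngtP (x a %/ side j.+1)%N (y a %/ side j.+1)%N.
- apply: (le_trans (ler_norm _)); apply: main => //.
  by move: quo lt; move: (_ %/ side j.+1)%N (_ %/ side j.+1)%N => u v; lia.
- apply: (le_trans (ler_norm _)); rewrite distrC.
  rewrite (avg_inv n (2 ^ d) (@same_cell_sym d T n) (@same_cell_trans d T n) _ r).
  apply: main => //.
  by move: quo lt; move: (_ %/ side j.+1)%N (_ %/ side j.+1)%N => u v; lia.
- rewrite (_ : avg j.+1 (fcell W) x = avg j.+1 (fcell W) y); last first.
    apply: (avg_inv _ _ (@same_cell_sym d T n) (@same_cell_trans d T n)).
    by apply/same_cellP => b; have [->|/xy->] := eqVneq b a.
  rewrite subrr; apply: mulr_ge0; first by rewrite !mulr_ge0 ?ler0n ?(ltW L0).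
  exact: avg_ge0.
Qed.

Lemma adj_increment W W' j x : integ mu W -> integ mu W' -> (forall p, 0 <= W' p) ->
  adj W W' -> (j < n)%N ->
  avg j.+1 (fcell W) x <= avg j (fcell W) x +
    (d%:R * (L * (2 ^ d)%:R)) * 2^-1 ^+ j * avg j (fcell W') x.
Proof.
move=> iW iW' W0 aW jn; rewrite -lerBlDl; apply: (le_trans (ler_norm _)).
rewrite -[X in X * avg _ _ _]mulrA.
apply: sibling_increment => // a {}x y xy r.
exact: (adj_avg (a := a)).
Qed.

Lemma card_edge x : (#|[pred y | edge x y]| <= d)%N /\ (#|[pred y | edge y x]| <= d)%N.
Proof.
pose u a k : grid d T n := [ffun b => if b == a then insubd (x a) k else x b].
split.
  apply: (@leq_trans #|[seq u a (x a).+1 | a : 'I_d]|); last first.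
    by apply: (leq_trans (card_size _)); rewrite size_map -cardE card_ord.
  apply: subset_leq_card; apply/fintype.subsetP => y; rewrite inE => /existsP[a /andP[/eqP ya /forallP h]].
  apply/mapP; exists a; first by rewrite mem_enum.
  apply/ffunP => b; rewrite ffunE; have [->|ba] := eqVneq b a.
    by apply: val_inj; rewrite /= insubdK// -ya; exact: ltn_ord.
  by have := h b; rewrite ba/= => /eqP.
apply: (@leq_trans #|[seq u a (x a).-1 | a : 'I_d]|); last first.
  by apply: (leq_trans (card_size _)); rewrite size_map -cardE card_ord.
apply: subset_leq_card; apply/fintype.subsetP => y; rewrite inE => /existsP[a /andP[/eqP ya /forallP h]].
apply/mapP; exists a; first by rewrite mem_enum.
apply/ffunP => b; rewrite ffunE; have [->|ba] := eqVneq b a.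
  by apply: val_inj; rewrite /= ya/= insubdK//; exact: ltn_ord.
by have := h b; rewrite ba/= => /eqP.
Qed.

(** At level n the mesh is L 2^-n, which cancels the factor 2^n of [grad]. Each point has at most d
    outgoing and d incoming edges, hence the constant 2 d L. *)
Lemma adj_variation W W' : integ mu W -> integ mu W' -> (forall p, 0 <= W' p) -> adj W W' ->
  \sum_x grad n (@edge d T n) (fcell W) x <= 2 * d%:R * L * \sum_x fcell W' x.
Proof.
move=> iW iW' W0 aW.
have f0 z : 0 <= fcell W' z by exact: fcell_ge0.
have edge_le x y : edge x y -> 2 ^+ n * `|fcell W x - fcell W y| <= L * (fcell W' x + fcell W' y).
  move=> /existsP[a /andP[/eqP ya /forallP h]].
  have s1 : side n = 1%N by rewrite !sideE subnn.
  have := @adj_cell W W' n a x y iW iW' aW (leqnn n).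
  rewrite s1 !divn1 !(avg_last (@same_cell_refl d T n) (@card_same_cell d T n) (expn_gt0 2 d)).
  rewrite ya => /(_ _ erefl) => H.
  rewrite -ler_pdivlMl ?exprn_gt0//; apply: (le_trans (H _)).
    by move=> b ba; have := h b; rewrite ba/= => /eqP.
  by rewrite mshE exprVn mulrCA mulrA.
apply: (@le_trans _ _ (\sum_x \sum_(y | edge x y) L * (fcell W' x + fcell W' y))).
  by apply: ler_sum => x _; rewrite /grad mulr_sumr; apply: ler_sum => y; exact: edge_le.
rewrite (eq_bigr (fun x => L * (\sum_(y | edge x y) fcell W' x) +
   L * \sum_(y | edge x y) fcell W' y)); last first.
  by move=> x _; rewrite -mulr_sumr big_split mulrDr.
rewrite big_split/= -!mulr_sumr [X in _ + _ * X](exchange_big_dep xpredT)//= -mulrDr.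
rewrite [leRHS](_ : _ = L * (d%:R * \sum_x fcell W' x + d%:R * \sum_x fcell W' x)); last by ring.
rewrite ler_wpM2l ?(ltW L0)// lerD// mulr_sumr; apply: ler_sum => x _.
  rewrite sumr_const -[leLHS]mulr_natl ler_wpM2r// ler_nat.
  exact: (card_edge x).1.
by rewrite sumr_const -[leLHS]mulr_natl ler_wpM2r// ler_nat; exact: (card_edge x).2.
Qed.

End grid_integrals.

(** * Lifting domination through all orders of derivation *)

Section chain.
Context {R : realType} {d : nat}.
Local Notation mu := (lebesgue_rV R d).
Local Notation domin n := (domin n (@same_cell d _ n)).

(** [domin_lift] is iterated from [W m] down to [W 0]; each step doubles the weight and adds one L^1
    norm. The constant is chosen before the grid, as the limit n -> oo requires. *)
Lemma domin_chain (L : R) (m : nat) (q : R) : 0 < L -> 1 < q ->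
  exists2 C, 0 <= C & forall (T n : nat) (c0 : 'I_d -> R) (W : nat -> 'rV[R]_d -> R) c,
    0 <= c -> (forall i, (i <= m)%N -> integ mu (W i)) -> (forall i p, 0 <= W i p) ->
    (forall i, (i < m)%N -> adj (W i) (W i.+1)) ->
    domin n q (fcell c0 L (W m) : grid d T n -> R) c ->
    domin n (2 ^+ m * q) (fcell c0 L (W 0%N) : grid d T n -> R)
      (C * (\sum_(i < m) \sum_(x : grid d T n) fcell c0 L (W i) x + c)).
Proof.
move=> L0 q1; elim: m => [|m [C C0 IHm]].
  exists 1 => // T n c0 W c c0' iW W0 aW; rewrite expr0 mul1r big_ord0 add0r mul1r.
  exact.
pose K := d%:R * (L * (2 ^ d)%:R) * (2 + 2 ^+ m * q / (2 ^+ m * q - 1)).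
have q1' : 1 < 2 ^+ m * q.
  by rewrite (lt_le_trans q1)// ler_peMl ?(ltW (lt_trans _ q1))// exprn_ege1// ler1n.
have K0 : 0 <= K.
  apply: mulr_ge0; first by rewrite !mulr_ge0 ?ler0n// ltW.
  by rewrite addr_ge0// divr_ge0; lra.
exists (1 + K * C); first by rewrite addr_ge0// mulr_ge0.
move=> T n c0 W c c0' iW W0 aW dm.
have S0 i : 0 <= \sum_(x : grid d T n) fcell c0 L (W i) x.
  by apply: sumr_ge0 => x _; exact: fcell_ge0.
have := IHm T n c0 (fun i => W i.+1) c c0' (fun i im => iW i.+1 im) (fun i => W0 i.+1)
  (fun i im => aW i.+1 im) dm.
move=> d1; have := domin_lift (@same_cell_refl d T n) (@same_cell_sym d T n)
  (@same_cell_trans d T n) (@same_cell_le d T n) (@card_same_cell d T n) (expn_gt0 2 d) q1'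
  (_ : 0 <= d%:R * (L * (2 ^ d)%:R)) _ _ d1.
move=> /(_ (fcell c0 L (W 0%N))) dl.
rewrite exprS -mulrA; apply: (domin_le (dl _ _ _)) => //.
- by rewrite !mulr_ge0 ?ler0n// ltW.
- by move=> x; exact: fcell_ge0.
- by move=> j x jn; apply: adj_increment => //; [exact: iW|exact: iW|exact: aW].
rewrite -/K big_ord_recl/= mulrDl mul1r lerD//.
  by rewrite -addrA lerDl addr_ge0// sumr_ge0.
rewrite -[leRHS]mulrA; apply: ler_wpM2l => //; apply: ler_wpM2l => //.
by rewrite lerD2r lerDr.
Qed.

End chain.

(** * Lebesgue measure of cubes *)

Section cube_measure.
Context {R : realType} {d : nat}.
Local Notation mu := (lebesgue_rV R d).
Implicit Types (c : 'I_d -> R) (h : R).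

Definition cube c h := [set x : 'rV[R]_d | forall i, c i <= x ord0 i < c i + h].

Lemma cube_prod c h : cube c h =
  [set x : 'rV[R]_d | forall i, (`[c i, c i + h[%classic : set (measurableTypeR R)) (x ord0 i)].
Proof. by apply/seteqP; split => x /= H i; have := H i; rewrite in_itv. Qed.

Lemma measurable_cube c h : measurable (cube c h).
Proof.
rewrite (_ : cube c h = \bigcap_(i in [set: 'I_d])
    (fun x : 'rV[R]_d => x ord0 i) @^-1` `[c i, c i + h[%classic).
  apply: fin_bigcap_measurable => [|i _]; first exact: finite_finset.
  by rewrite -[X in measurable X]setTI; exact: measurable_coord.
by apply/seteqP; split=> x /= H i; [move=> _|]; have := H i; rewrite /= in_itv//=; apply.
Qed.

Lemma mu_cube c h : 0 <= h -> mu (cube c h) = (h ^+ d)%:E.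
Proof.
move=> h0; rewrite cube_prod (@lebesgue_rV_box R d (fun i => `[c i, c i + h[%classic))//.
have E n : (\prod_(i < n) h%:E = (h ^+ n)%:E)%E.
  by elim: n => [|n IHn]; rewrite ?big_ord0 ?expr0// big_ord_recl IHn exprS EFinM.
rewrite (eq_bigr (fun=> h%:E)); first exact: E.
move=> i _; rewrite lebesgue_measure_itv/= lte_fin ltrDl.
by case: ltP => [_|h0']; [rewrite -EFinB addrAC subrr add0r|congr EFin; lra].
Qed.

Lemma cubei_indic c h : 0 <= h -> cubei c h = \1_(cube c h).
Proof.
move=> h0; apply/funext => x; rewrite cubeiE// indicE; congr (nat_of_bool _)%:R.
by apply/forallP/idP => [H|]; [rewrite inE => i; exact: H|rewrite inE].
Qed.

Lemma integ_cubei c h : 0 <= h -> integ mu (cubei c h).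
Proof.
move=> h0; rewrite /integ cubei_indic//; apply/integrableP; split.
  by apply/measurable_EFinP/measurable_indic; exact: measurable_cube.
rewrite (eq_integral (fun x => (\1_(cube c h) x)%:E)); last first.
  by move=> x _; rewrite /= ger0_norm// indicE ler0n.
by rewrite integral_indic//; [rewrite setIT [X in (X < _)%E](mu_cube c h0) ltry|exact: measurable_cube].
Qed.

Lemma integral_cubei c h : 0 <= h -> \int[mu]_x cubei c h x = h ^+ d.
Proof.
move=> h0; rewrite /Rintegral cubei_indic// integral_indic//; last exact: measurable_cube.
by rewrite setIT [X in fine X](mu_cube c h0).
Qed.

Lemma sum_fcell (c0 : 'I_d -> R) (L : R) T n W : 0 < L -> integ mu W -> (forall p, 0 <= W p) ->
  \sum_(x : grid d T n) fcell c0 L W x <= \int[mu]_p W p.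
Proof.
move=> L0 iW W0; rewrite /fcell -II_sum//; last by move=> x; apply: bm_cubei; exact: msh_ge0.
rewrite (_ : \int[mu]_p W p = II mu W (fun=> 1)); last first.
  by apply: eq_Rintegral => p _; rewrite mulr1.
apply: II_le => //; [|exact: bm_cst|].
  by apply: bm_sum => x _; apply: bm_cubei; exact: msh_ge0.
move=> p; rewrite -cubei_sub; apply: prodr_ile1 => i _.
by apply: ii_bounds; rewrite mulr_ge0 ?ler0n// msh_ge0.
Qed.

End cube_measure.

(** * Double integrals of nonnegative kernels *)

Section double_integrals.
Context {R : realType} {d : nat}.
Local Notation mu := (lebesgue_rV R d).
Implicit Types (F G : 'rV[R]_d -> 'rV[R]_d -> R).

Definition mf2 F := measurable_fun setT (fun z : 'rV[R]_d * 'rV[R]_d => F z.1 z.2).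

(** The inner integral runs over the first argument, the order used in [gagliardo]. *)
Definition DI F : \bar R := (\int[mu]_r \int[mu]_p (F p r)%:E)%E.

Lemma mf2_fst F r : mf2 F -> measurable_fun setT (F ^~ r).
Proof.
move=> mF; have := measurableT_comp mF (@measurable_pair2 _ _ _ _ r).
by apply.
Qed.

Lemma mf2_inner F : mf2 F -> (forall p r, 0 <= F p r) ->
  measurable_fun setT (fun r => \int[mu]_p (F p r)%:E)%E.
Proof.
move=> mF F0; have := (@measurable_fun_fubini_tonelli_G _ _ _ _ _ mu
  (fun z => (F z.1 z.2)%:E)).
by apply; [apply/measurable_EFinP|move=> z; rewrite lee_fin].
Qed.

Lemma DI_ge0 F : (forall p r, 0 <= F p r) -> (0 <= DI F)%E.
Proof.
move=> F0; apply: integral_ge0 => r _; apply: integral_ge0 => p _.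
by rewrite lee_fin.
Qed.

Lemma DI_le F G : mf2 F -> mf2 G -> (forall p r, 0 <= F p r) ->
  (forall p r, F p r <= G p r) -> (DI F <= DI G)%E.
Proof.
move=> mF mG F0 FG; have G0 p r : 0 <= G p r by exact: le_trans (F0 p r) (FG p r).
apply: ge0_le_integral => //; [|exact: mf2_inner..|].
  by move=> r _; apply: integral_ge0 => p _; rewrite lee_fin.
move=> r _; apply: ge0_le_integral => //.
- by move=> p _; rewrite lee_fin.
- by apply/measurable_EFinP; exact: mf2_fst.
- by apply/measurable_EFinP; exact: mf2_fst.
- by move=> p _; rewrite lee_fin.
Qed.

Lemma DI_sum (I : Type) (s : seq I) (F : I -> 'rV[R]_d -> 'rV[R]_d -> R) :
  (forall i, mf2 (F i)) -> (forall i p r, 0 <= F i p r) ->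
  DI (fun p r => \sum_(i <- s) F i p r) = (\sum_(i <- s) DI (F i))%E.
Proof.
move=> mF F0; rewrite /DI -ge0_integral_sum//.
- apply: eq_integral => r _; rewrite -ge0_integral_sum//.
  + by apply: eq_integral => p _; rewrite sumEFin.
  + by move=> i; apply/measurable_EFinP; exact: mf2_fst.
  + by move=> i p _; rewrite lee_fin.
- by move=> i; exact: mf2_inner.
- by move=> i r _; apply: integral_ge0 => p _; rewrite lee_fin.
Qed.

Lemma DI_Z F c : mf2 F -> (forall p r, 0 <= F p r) -> 0 <= c ->
  DI (fun p r => c * F p r) = (c%:E * DI F)%E.
Proof.
move=> mF F0 c0; rewrite /DI -ge0_integralZl//.
- apply: eq_integral => r _; rewrite -ge0_integralZl//.
  + by apply/measurable_EFinP; exact: mf2_fst.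
  + by move=> p _; rewrite lee_fin.
- exact: mf2_inner.
- by move=> r _; apply: integral_ge0 => p _; rewrite lee_fin.
Qed.

Lemma mf2_fst_only (w : 'rV[R]_d -> R) : measurable_fun setT w -> mf2 (fun p _ => w p).
Proof. by move=> mw; apply: (measurableT_comp mw); exact: measurable_fst. Qed.

Lemma mf2_snd_only (w : 'rV[R]_d -> R) : measurable_fun setT w -> mf2 (fun _ r => w r).
Proof. by move=> mw; apply: (measurableT_comp mw); exact: measurable_snd. Qed.

Lemma measurable_enorm : measurable_fun setT (@enorm R d).
Proof.
rewrite (_ : @enorm R d = (fun x => (\sum_(i < d) x ord0 i ^+ 2) `^ 2^-1)).
  apply: (measurableT_comp (measurable_powR _)).
  apply: measurable_sum => i; apply: measurable_funX.
  exact: measurable_coord.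
apply/funext => x; rewrite powR12_sqrt// sumr_ge0// => i _.
exact: sqr_ge0.
Qed.

Lemma mf2_enorm : mf2 (fun p r => enorm (p - r)).
Proof.
apply: (measurableT_comp measurable_enorm); apply: measurable_fun_rV => i.
rewrite (_ : (fun z : 'rV[R]_d * 'rV[R]_d => (z.1 - z.2) ord0 i) =
   (fun z : 'rV[R]_d * 'rV[R]_d => z.1 ord0 i - z.2 ord0 i)); last first.
  by apply/funext => z; rewrite !mxE.
apply: measurable_funB.
  by apply: (measurableT_comp (measurable_coord i)); exact: measurable_fst.
by apply: (measurableT_comp (measurable_coord i)); exact: measurable_snd.
Qed.

Lemma mf2_quotient F s : mf2 F -> mf2 (fun p r => F p r / enorm (p - r) `^ s).
Proof.
move=> mF; rewrite (_ : (fun p r => _) = (fun p r => F p r * enorm (p - r) `^ (- s))).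
  apply: measurable_funM => //.
  by apply: (measurableT_comp (measurable_powR _)); exact: mf2_enorm.
by apply/funext => p; apply/funext => r; rewrite powRN.
Qed.

Lemma enorm_ge0 (x : 'rV[R]_d) : 0 <= enorm x. Proof. exact: sqrtr_ge0. Qed.

Lemma enorm_eq0 (x : 'rV[R]_d) : enorm x = 0 -> x = 0.
Proof.
move=> /eqP; rewrite sqrtr_eq0 => x0; apply/rowP => i; rewrite mxE.
have S0 : \sum_(j < d) x ord0 j ^+ 2 = 0.
  by apply/le_anti; rewrite x0 sumr_ge0// => j _; exact: sqr_ge0.
have /eqP := psumr_eq0P (fun j _ => sqr_ge0 (x ord0 j)) S0 (erefl : xpredT i).
by rewrite sqrf_eq0 => /eqP.
Qed.

Lemma enorm_le (x : 'rV[R]_d) b : 0 <= b -> (forall i, `|x ord0 i| <= b) -> enorm x <= d%:R * b.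
Proof.
move=> b0 xb; rewrite -[leRHS]ger0_norm ?mulr_ge0 ?ler0n// -sqrtr_sqr ler_wsqrtr//.
apply: (@le_trans _ _ (\sum_(i < d) b ^+ 2)).
  apply: ler_sum => i _; rewrite -real_normK ?num_real// lerXn2r ?nnegrE//.
rewrite sumr_const card_ord exprMn -[leLHS]mulr_natl ler_wpM2r ?sqr_ge0//.
by rewrite -natrX ler_nat; case: (d) => // m; rewrite leq_pmulr.
Qed.

End double_integrals.

(** * The Gagliardo seminorm controls the increments of averages *)

Section gagliardo_increments.
Context {R : realType} {d : nat}.
Local Notation mu := (lebesgue_rV R d).
Variables (c0 : 'I_d -> R) (L : R) (T n : nat).
Hypothesis L0 : 0 < L.
Variables (W : 'rV[R]_d -> R) (theta : R).
Hypotheses (iW : integ mu W) (theta0 : 0 < theta).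

Local Notation avg := (avg n (2 ^ d) (@same_cell d T n)).
Local Notation f := (fcell c0 L W : grid d T n -> R).
Local Notation ind x := (cubei (sub c0 (msh L n) (x : grid d T n)) (msh L n)).

Let q : R := 2 `^ theta.
(** b = 2^(theta + d): the factor gained by the kernel when the distance is halved. *)
Let b : R := q * (2 ^ d)%:R.

Let q1 : 1 < q.
Proof.
have := @gt0_ltr_powR R theta theta0 1 2; rewrite powR1; apply; rewrite ?nnegrE//.
by rewrite ltr1n.
Qed.

Let kern p r := `|W p - W r| / enorm (p - r) `^ (theta + d%:R).

Let mW : measurable_fun setT W.
Proof. by move/integrableP : iW => [/measurable_EFinP]. Qed.

Let B_gt0 : (0 < 2 ^ d)%N. Proof. by rewrite expn_gt0. Qed.

(** The increment is the average at level j + 1 of f minus its average at level j; writing the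
    latter as an average over y leaves pairs in a common cell of level j. *)
Let increment_le j : (j < n)%N -> \sum_x `|avg j.+1 f x - avg j f x| <=
  (csize R n (2 ^ d) j)^-1 * \sum_x \sum_(y | same_cell j x y) `|f x - f y|.
Proof.
move=> jn; have cr := @card_same_cell d T n; have sy := @same_cell_sym d T n.
have tr := @same_cell_trans d T n; have le := @same_cell_le d T n.
apply: (@le_trans _ _ (\sum_x avg j.+1 (fun y => `|f y - avg j f y|) x)).
  apply: ler_sum => x _; rewrite -[X in `|_ - X|](avg_avg_ge sy tr le cr B_gt0 (i := j) (j := j.+1)).
    by rewrite -avgB ler_norm_avg.
  by rewrite leqnSn.
rewrite sum_avg// mulr_sumr; apply: ler_sum => x _.
rewrite -[X in `|X - _|](avg_cst cr B_gt0 (f x) x (ltnW jn)) -avgB.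
exact: ler_norm_avg.
Qed.

Let m := msh L n ^+ d.

(** Here m is the volume of a finest cell, so m (f x - f y) is the integral of W p - W r over the
    product of the two cells. *)
Let pair_le x y : ((m * `|f x - f y|)%:E <=
   DI (fun p r => (`|W p - W r| * (ind x p * ind y r))%R))%E.
Proof.
have h0 := msh_ge0 L0 n.
have bx z := bm_cubei (sub c0 (msh L n) (z : grid d T n)) h0.
have ix z := integ_cubei (sub c0 (msh L n) (z : grid d T n)) h0.
have mx z : measurable_fun setT (ind z) by have [] := bx z.
have mF : mf2 (fun p r => `|W p - W r| * (ind x p * ind y r)).
  apply: measurable_funM; last first.
    by apply: measurable_funM; [exact: mf2_fst_only|exact: mf2_snd_only].
  apply: measurableT_comp => //; apply: measurable_funB; [exact: mf2_fst_only|exact: mf2_snd_only].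
have F0 p r : 0 <= `|W p - W r| * (ind x p * ind y r).
  by rewrite !mulr_ge0 ?cubei_ge0.
have inner r : ((`|(f x - W r * m) * ind y r|)%R%:E <=
    \int[mu]_p (`|W p - W r| * (ind x p * ind y r))%R%:E)%E.
  have i1 : integ mu (fun p => (W p - W r) * (ind x p * ind y r)).
    rewrite (_ : (fun p => _) = (fun p => W p * ind x p * ind y r + (- W r * ind y r) * ind x p)).
      apply: integD; last by have := integrableZl measurableT (- W r * ind y r) (ix x).
      by apply: integ_bm; [exact: integ_bm|exact: bm_cst].
    by apply/funext => p; ring.
  have -> : (f x - W r * m) * ind y r = \int[mu]_p ((W p - W r) * (ind x p * ind y r)).
    have Ep : (fun p => (W p - W r) * (ind x p * ind y r)) =
              (fun p => ind y r * (W p * ind x p) - (ind y r * W r) * ind x p).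
      by apply/funext => p; ring.
      rewrite Ep RintegralB//; last 2 first.
      - by have := integrableZl measurableT (ind y r) (integ_bm iW (bx x)).
      - by have := integrableZl measurableT (ind y r * W r) (ix x).
      rewrite !RintegralZl//; [|exact: ix|exact: integ_bm].
      by rewrite integral_cubei// /fcell /II -/m; ring.
  apply: (@le_trans _ _ (`|\int[mu]_p ((W p - W r) * (ind x p * ind y r))%R%:E|)%E).
    by rewrite -(EFin_normr_Rintegral measurableT i1).
  apply: (le_trans (le_abse_integral _ _ _)) => //.
    by have /integrableP[] := i1.
  rewrite le_eqVlt; apply/orP; left; apply/eqP/eq_integral => p _.
  by rewrite abse_EFin normrM [`|ind x p * _|]ger0_norm// mulr_ge0 ?cubei_ge0.
have i2 : integ mu (fun r => (f x - W r * m) * ind y r).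
  rewrite (_ : (fun r => _) = (fun r => f x * ind y r + (- m) * (W r * ind y r))).
    apply: integD; first by have := integrableZl measurableT (f x) (ix y).
    by have := integrableZl measurableT (- m) (integ_bm iW (bx y)).
  by apply/funext => r; ring.
have -> : m * `|f x - f y| = `|\int[mu]_r ((f x - W r * m) * ind y r)|.
  have Er : (fun r => (f x - W r * m) * ind y r) = (fun r => f x * ind y r - m * (W r * ind y r)).
    by apply/funext => r; ring.
    rewrite Er RintegralB//; last 2 first.
    - by have := integrableZl measurableT (f x) (ix y).
    - by have := integrableZl measurableT m (integ_bm iW (bx y)).
    rewrite !RintegralZl//; [|exact: integ_bm|exact: ix].
    rewrite integral_cubei// -/m -/(II mu W (ind y)) -/(fcell c0 L W y).
    by rewrite [f x * m]mulrC -mulrBr normrM [`|m|]ger0_norm// exprn_ge0.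
apply: (@le_trans _ _ (`|\int[mu]_r ((f x - W r * m) * ind y r)%R%:E|)%E).
  by rewrite -(EFin_normr_Rintegral measurableT i2).
apply: (le_trans (le_abse_integral _ _ _)) => //.
  by have /integrableP[] := i2.
apply: ge0_le_integral => //.
- have /integrableP[m2 _] := i2; exact: measurableT_comp m2.
- exact: mf2_inner.
- by move=> r _; rewrite abse_EFin; exact: inner.
Qed.

(** The total weight a pair receives from all the levels at which it shares a cell. *)
Let Sg (x y : grid d T n) : R := \sum_(j < n | same_cell j x y) b ^+ j.

Let Kst : R := b / (b - 1) * (d%:R * L) `^ (theta + d%:R).

Let b1 : 1 < b.
Proof. by rewrite (lt_le_trans q1)// ler_peMr ?(ltW (lt_trans _ q1))// ler1n. Qed.

(** The geometric sum is dominated by its last term b^J, where J is the finest common level below n.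
    At that level p and r lie in one cell, so their distance is at most d L 2^-J and b^J is at most
    a constant times the kernel. *)
Let S_le (x y : grid d T n) p r : Sg x y * (`|W p - W r| * (ind x p * ind y r)) <=
  Kst * (kern p r * (ind x p * ind y r)).
Proof.
have h0 := msh_ge0 L0 n.
have Kst0 : 0 <= Kst.
  by rewrite mulr_ge0 ?powR_ge0// divr_ge0; have := b1; lra.
have kern0 r' : 0 <= kern p r' by rewrite divr_ge0// powR_ge0.
have k0 := kern0 r.
have [->|px] := eqVneq (ind x p) 0; first by rewrite mul0r !mulr0.
have [->|ry] := eqVneq (ind y r) 0; first by rewrite !mulr0.
rewrite !mulrA ler_wpM2r ?cubei_ge0// ler_wpM2r ?cubei_ge0//.
have [<-|pr] := eqVneq p r; first by rewrite subrr normr0 !mulr0 mul0r.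
have e0 : 0 < enorm (p - r).
  rewrite lt_neqAle enorm_ge0 andbT eq_sym; apply: contra pr => /eqP/enorm_eq0/eqP.
  by rewrite subr_eq0.
rewrite [leRHS]mulrAC ler_wpM2r//.
rewrite ler_pdivlMr ?powR_gt0//.
have b0 : 0 <= b by have := b1; lra.
case: (pickP (fun j : 'I_n => same_cell j x y)) => [j0 hj0|none]; last first.
  by rewrite /Sg big_pred0// mul0r.
case: (@arg_maxnP _ j0 (fun j : 'I_n => same_cell j x y) val hj0) => J xyJ Jmax.
have SJ : Sg x y <= b / (b - 1) * b ^+ J.
  apply: le_trans (geom_sum_le J b1).
  rewrite (big_ord_widen n (fun j => b ^+ j))//.
  rewrite [leRHS](bigID (fun j : 'I_n => same_cell j x y))/=.
  rewrite /Sg [leLHS](eq_bigl (fun j : 'I_n => (j < J.+1)%N && same_cell j x y)).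
    by rewrite lerDl sumr_ge0// => j _; rewrite exprn_ge0.
  move=> j; apply/idP/andP => [xyj|[]//]; split => //.
  by rewrite ltnS; exact: Jmax.
have pin z s i : ind z s != 0 ->
    c0 i + (z i)%:R * msh L n <= s ord0 i < c0 i + (z i)%:R * msh L n + msh L n.
  rewrite cubeiE//; case: (boolP [forall _, _]) => [/forallP/(_ i)//|_].
  by rewrite eqxx.
have dJ : enorm (p - r) <= d%:R * msh L J.
  apply: enorm_le => [|i]; first exact: msh_ge0.
  have s0 : (0 < side n J)%N by exact: side_gt0.
  have cellin (z : grid d T n) s : ind z s != 0 ->
      c0 i + (z i %/ side n J)%:R * msh L J <= s ord0 i <
      c0 i + (z i %/ side n J)%:R * msh L J + msh L J.
    move=> /(pin z s i)/andP[lo hi]; rewrite -(side_msh L (ltnW (ltn_ord J))).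
    have l1 : ((z i %/ side n J * side n J)%N%:R : R) <= (z i)%:R by rewrite ler_nat leq_divM.
    have l2 : (z i)%:R + 1 <= ((z i %/ side n J).+1 * side n J)%N%:R :> R.
      by rewrite natr1 ler_nat ltn_ceil.
    have {}l1 := ler_wpM2r h0 l1; have {}l2 := ler_wpM2r h0 l2.
    move: l1 l2; rewrite !natrM -natr1 => l1 l2.
    by apply/andP; split; lra.
  have /andP[x1 x2] := cellin x p px; have /andP[y1 y2] := cellin y r ry.
  move/same_cellP/(_ i) : xyJ => E; rewrite !mxE ler_norml.
  by rewrite -E in y1 y2; apply/andP; split; lra.
have bJ : b ^+ J * enorm (p - r) `^ (theta + d%:R) <= (d%:R * L) `^ (theta + d%:R).
  have s0 : 0 <= theta + d%:R by rewrite addr_ge0 ?ler0n// ltW.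
  have -> : b ^+ J = ((2 ^ J)%:R) `^ (theta + d%:R).
    have -> : b = 2 `^ (theta + d%:R).
      rewrite powRD; last by rewrite pnatr_eq0 implybT.
      by rewrite powR_mulrn// -natrX.
    rewrite natrX -(powR_mulrn J (powR_ge0 2 _)) -powRrM mulrC powRrM.
    by rewrite powR_mulrn.
  rewrite -powRM ?ler0n ?enorm_ge0//; apply: ge0_ler_powR => //.
  - by rewrite nnegrE mulr_ge0 ?enorm_ge0// ler0n.
  - by rewrite nnegrE mulr_ge0 ?ler0n// ltW.
  rewrite mulrC -ler_pdivlMr ?ltr0n ?expn_gt0//.
  by rewrite -mulrA.
apply: (@le_trans _ _ (b / (b - 1) * b ^+ J * enorm (p - r) `^ (theta + d%:R))).
  by rewrite ler_wpM2r ?powR_ge0.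
rewrite -mulrA ler_wpM2l// divr_ge0//; have := b1; lra.
Qed.

Lemma gagliardo_increments : (((\sum_(j < n) q ^+ j.+1 *
    \sum_x `|avg j.+1 f x - avg j f x|))%:E <= (q / L ^+ d * Kst)%:E * DI kern)%E.
Proof.
have h0 := msh_ge0 L0 n; have q0 : 0 < q by rewrite (lt_trans _ q1).
have b0 : 0 < b by rewrite (lt_trans _ b1).
have Ld : 0 < L ^+ d by rewrite exprn_gt0.
have Kst0 : 0 <= Kst.
  by rewrite mulr_ge0 ?powR_ge0// divr_ge0; have := b1; lra.
have S0 x y : 0 <= Sg x y by rewrite sumr_ge0// => j _; rewrite exprn_ge0// ltW.
have k0 p r : 0 <= kern p r by rewrite divr_ge0// powR_ge0.
have Bn : (2 ^ d)%:R ^+ n * m = L ^+ d :> R.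
  by rewrite /m /msh expr_div_n -!natrX -!expnM [(n * d)%N]mulnC mulrC divfK// pnatr_eq0 -lt0n expn_gt0.
have m0 : 0 <= m by rewrite exprn_ge0.
have B0 : (2 ^ d)%:R != 0 :> R by rewrite pnatr_eq0 -lt0n.
apply: (@le_trans _ _ ((q / L ^+ d)%:E * (\sum_x \sum_y Sg x y * (m * `|f x - f y|))%:E)%E).
  rewrite -EFinM lee_fin.
  apply: (@le_trans _ _ (\sum_(j < n) q ^+ j.+1 * ((csize R n (2 ^ d) j)^-1 *
      \sum_x \sum_(y | same_cell j x y) `|f x - f y|))).
    apply: ler_sum => j _; rewrite ler_wpM2l ?exprn_ge0 ?(ltW q0)//.
    exact: increment_le.
  rewrite (eq_bigr (fun j : 'I_n => q / L ^+ d * \sum_x \sum_(y | same_cell j x y)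
      b ^+ j * (m * `|f x - f y|))); last first.
    (* A cell of level j consists of [csize] finest cells of volume m and has volume L^d / 2^(d
       j). *)
    move=> j _; have -> : (csize R n (2 ^ d) j)^-1 = (2 ^ d)%:R ^+ j * m / L ^+ d.
      apply: (mulfI (lt0r_neq0 (csize_gt0 R n B_gt0 j))); rewrite mulfV; last first.
        by rewrite gt_eqF// csize_gt0.
      rewrite mulrA mulrA -natrX /csize -natrM -expnD subnK ?(ltnW (ltn_ord j))//.
      by rewrite natrX Bn mulfV// gt_eqF.
    rewrite [X in _ = _ * X](eq_bigr (fun x => b ^+ j * m * \sum_(y | same_cell j x y) `|f x - f y|)).
      by rewrite -mulr_sumr /b exprMn exprS; ring.
    by move=> x _; rewrite mulr_sumr; apply: eq_bigr => y _; rewrite mulrA.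
  rewrite -mulr_sumr ler_wpM2l ?divr_ge0 ?(ltW q0) ?(ltW Ld)//.
  rewrite exchange_big/=; apply: ler_sum => x _.
  rewrite (exchange_big_dep xpredT)//=; apply: ler_sum => y _.
  by rewrite -mulr_suml.
rewrite [(q / L ^+ d * Kst)%:E]EFinM -muleA; apply: lee_wpmul2l; first by rewrite lee_fin divr_ge0 ?(ltW q0) ?(ltW Ld).
have bx z := bm_cubei (sub c0 (msh L n) (z : grid d T n)) h0.
have mx z : measurable_fun setT (ind z) by have [] := bx z.
have mdiff : mf2 (fun p r => `|W p - W r|).
  by apply: measurableT_comp => //; apply: measurable_funB; [exact: mf2_fst_only|exact: mf2_snd_only].
have mk : mf2 kern by exact: mf2_quotient.
have mind x y : mf2 (fun p r => ind x p * ind y r).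
  by apply: measurable_funM; [exact: mf2_fst_only|exact: mf2_snd_only].
have mF x y : mf2 (fun p r => `|W p - W r| * (ind x p * ind y r)).
  by apply: measurable_funM; [exact: mdiff|exact: mind].
have mK x y : mf2 (fun p r => Kst * (kern p r * (ind x p * ind y r))).
  by apply: measurable_funM; [exact: measurable_cst|apply: measurable_funM; [exact: mk|exact: mind]].
have ind0 x y p r : 0 <= ind x p * ind y r by rewrite mulr_ge0 ?cubei_ge0.
have F0 x y p r : 0 <= `|W p - W r| * (ind x p * ind y r) by rewrite mulr_ge0.
have K0 x y p r : 0 <= Kst * (kern p r * (ind x p * ind y r)).
  by apply: mulr_ge0 => //; apply: mulr_ge0; [exact: k0|exact: ind0].
apply: (@le_trans _ _ (\sum_x \sum_y DI (fun p r => (Kst * (kern p r * (ind x p * ind y r)))%R))%E).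
  rewrite -sumEFin; apply: lee_sum => x _; rewrite -sumEFin; apply: lee_sum => y _.
  rewrite EFinM; apply: (@le_trans _ _ ((Sg x y)%:E *
      DI (fun p r => `|W p - W r| * (ind x p * ind y r))%R)%E).
    by apply: lee_wpmul2l; [rewrite lee_fin|exact: pair_le].
  rewrite -DI_Z//; apply: DI_le => //.
  - by apply: measurable_funM; [exact: measurable_cst|exact: mF].
  - by move=> p r; rewrite mulr_ge0.
rewrite (eq_bigr (fun x => DI (fun p r => (\sum_y Kst * (kern p r * (ind x p * ind y r)))%R))); last first.
  by move=> x _; rewrite DI_sum.
have mKs x : mf2 (fun p r => \sum_y Kst * (kern p r * (ind x p * ind y r))).
  by apply: measurable_sum => y; exact: mK.
have Ks0 x p r : 0 <= \sum_y Kst * (kern p r * (ind x p * ind y r)) by rewrite sumr_ge0.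
rewrite -DI_sum// -DI_Z//; apply: DI_le => //.
- by apply: measurable_sum => x; exact: mKs.
- by apply: measurable_funM; [exact: measurable_cst|exact: mk].
- by move=> p r; rewrite sumr_ge0.
move=> p r.
(* The finest cells are disjoint, so the sum over pairs of cells is at most the integral over the
   whole space. *)
have one s : 0 <= \sum_(z : grid d T n) ind z s <= 1.
  rewrite -cubei_sub; have := bm_cubei c0 (_ : 0 <= (T * 2 ^ n)%:R * msh L n).
  have TL : 0 <= (T * 2 ^ n)%:R * msh L n by rewrite mulr_ge0 ?ler0n.
  rewrite cubei_ge0//= => _; apply: prodr_ile1 => i _.
  exact: ii_bounds.
rewrite (_ : \sum_x _ = Kst * kern p r * ((\sum_(x : grid d T n) ind x p) * \sum_(y : grid d T n) ind y r)).
  have /andP[? ?] := one p; have /andP[? ?] := one r.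
  rewrite -[leRHS]mulr1; apply: ler_wpM2l; last by rewrite mulr_ile1.
  by apply: mulr_ge0 => //; exact: k0.
rewrite mulr_suml mulr_sumr; apply: eq_bigr => x _.
by rewrite !mulr_sumr; apply: eq_bigr => y _; rewrite !mulrA.
Qed.

End gagliardo_increments.

(** * Derivatives of test functions, and norms of tensors *)

Section derivative_of_test_functions.
Context {R : realType} {d : nat}.
Implicit Types phi : 'rV[R]_d -> R.

Lemma partial_rcons phi (s : seq 'I_d) a :
  partial phi (rcons s a) = partial ('D_(delta_mx ord0 a) phi) s.
Proof. by rewrite /partial foldr_rcons. Qed.

Lemma test_function_derive phi (a : 'I_d) : test_function phi ->
  test_function ('D_(delta_mx ord0 a) phi).
Proof.
move=> [sphi cphi]; split; first by move=> s; rewrite -partial_rcons; exact: sphi.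
refine (subclosed_compact (@closed_closure _ _) cphi _).
rewrite closureE; apply: smallest_sub; first exact: closed_closure.
move=> x /= dx; apply: contrapT => xS; move/eqP: dx; apply.
have o : open (~` closure [set x | phi x != 0]) by apply: closed_openC; exact: closed_closure.
have nx : \near x, phi x = cst 0 x.
  apply: filterS (open_nbhs_nbhs (conj o xS)) => y /= yS.
  by apply: contrapT => /eqP y0; apply: yS; exact: subset_closure.
rewrite (near_eq_derive (g := cst 0) _ nx) ?derive_cst//.
Qed.

End derivative_of_test_functions.

Section tensors.
Context {R : realType} {d : nat}.

Lemma tnorm_ge0 k (t : @tensor R d k) : 0 <= tnorm t.
Proof. exact: sqrtr_ge0. Qed.

Lemma ler_tnorm k (t : @tensor R d k) s : `|t s| <= tnorm t.
Proof.
rewrite -sqrtr_sqr; apply: ler_wsqrtr; rewrite (bigD1 s)//= lerDl.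
by apply: sumr_ge0 => i _; exact: sqr_ge0.
Qed.

Lemma sum_ler_tnorm k (t : @tensor R d k) : \sum_s `|t s| <= (d ^ k)%:R * tnorm t.
Proof.
apply: (@le_trans _ _ (\sum_(s : k.-tuple 'I_d) tnorm t)).
  by apply: ler_sum => s _; exact: ler_tnorm.
by rewrite sumr_const -[leLHS]mulr_natl card_tuple card_ord.
Qed.

Lemma tnorm_ler_sum k (t : @tensor R d k) : tnorm t <= \sum_s `|t s|.
Proof.
have S0 : 0 <= \sum_s `|t s| by apply: sumr_ge0.
rewrite -[leRHS](ger0_norm S0) -sqrtr_sqr; apply: ler_wsqrtr.
have sub (r : seq (k.-tuple 'I_d)) : 0 <= \sum_(s <- r) `|t s| /\
    \sum_(s <- r) t s ^+ 2 <= (\sum_(s <- r) `|t s|) ^+ 2.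
  elim: r => [|s r [h1 h2]]; first by rewrite !big_nil expr0n.
  rewrite !big_cons; split; first by rewrite addr_ge0.
  rewrite -(real_normK (num_real (t s))) sqrrD -addrA lerD2l.
  by apply: (le_trans h2); rewrite lerDr mulrn_wge0// mulr_ge0.
exact: (sub _).2.
Qed.

Lemma measurable_tnorm k (t : 'rV[R]_d -> @tensor R d k) :
  (forall s, measurable_fun setT (fun x => t x s)) -> measurable_fun setT (fun x => tnorm (t x)).
Proof.
move=> mt; rewrite (_ : (fun x => _) =
    (fun x => (\sum_(s : k.-tuple 'I_d) t x s ^+ 2) `^ 2^-1)).
  apply: (measurableT_comp (measurable_powR _)).
  by apply: measurable_sum => s; exact: measurable_funX.
apply/funext => x; rewrite powR12_sqrt// sumr_ge0// => s _.
exact: sqr_ge0.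
Qed.

Lemma mf2_tnorm k (t : 'rV[R]_d -> @tensor R d k) :
  (forall s, measurable_fun setT (fun x => t x s)) -> mf2 (fun p r => tnorm (t p \- t r)).
Proof.
move=> mt; rewrite /mf2 (_ : (fun z => _) = (fun z : 'rV[R]_d * 'rV[R]_d =>
    (\sum_(s : k.-tuple 'I_d) (t z.1 s - t z.2 s) ^+ 2) `^ 2^-1)).
  apply: (measurableT_comp (measurable_powR _)).
  apply: measurable_sum => s; apply: measurable_funX; apply: measurable_funB.
    exact: (mf2_fst_only (mt s)).
  exact: (mf2_snd_only (mt s)).
apply/funext => x; rewrite powR12_sqrt// sumr_ge0// => s _.
exact: sqr_ge0.
Qed.

End tensors.

(** * Sobolev functions dominated on grids *)

Section sobolev_functions.
Context {R : realType} {d : nat}.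
Local Notation mu := (lebesgue_rV R d).
Implicit Types (u : 'rV[R]_d -> R) (alpha L : R).

Lemma weak_derivativeP k u i : int_sobolev k u -> (i <= k)%N ->
  integrable_weak_derivative u (weak_derivative i u).
Proof.
move=> [iu wu]; case: i => [_ s|i ik].
  rewrite /weak_derivative; split => // phi _; rewrite expr0 mul1r.
  by rewrite (tuple0 s).
have [g hg] := wu i.+1 ik.
exact: (@xgetPex _ (fun _ _ => 0) [set g | integrable_weak_derivative u g] (ex_intro _ g hg)).
Qed.

(** The l^1 norm of the components, equivalent to [tnorm] up to d^i: the cube comparison holds for
    each component, and sums of components inherit it. *)
Definition W u i (p : 'rV[R]_d) : R := \sum_(s : i.-tuple 'I_d) `|weak_derivative i u p s|.

Lemma W_ge0 u i p : 0 <= W u i p.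
Proof. by apply: sumr_ge0. Qed.

Lemma W0 u : W u 0 = (fun p => `|u p|).
Proof.
apply/funext => p; rewrite /W (eq_bigr (fun=> `|u p|))//.
by rewrite sumr_const card_tuple expn0.
Qed.

Lemma integ_W k u i : int_sobolev k u -> (i <= k)%N -> integ mu (W u i).
Proof.
move=> su ik; apply: integ_sum => s; apply: integ_norm.
exact: (weak_derivativeP su ik s).1.
Qed.

(** The definition of order i is tested on the derivative of phi along a, that of order i + 1 on
    phi. The new direction is appended at the end because [partial] applies the last index first. *)
Lemma weak_pair_derivative k u i (s : i.-tuple 'I_d) a : int_sobolev k u -> (i < k)%N ->
  weak_pair a (fun p => weak_derivative i u p s)
              (fun p => weak_derivative i.+1 u p [tuple of rcons s a]).
Proof.
move=> su ik; have [is_ ws] := weak_derivativeP su (ltnW ik) s.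
have [is' ws'] := weak_derivativeP su ik [tuple of rcons s a].
split=> // phi tphi.
have e1 := ws _ (test_function_derive a tphi).
have e2 := ws' _ tphi; rewrite /= partial_rcons e1 in e2.
apply: (mulfI (x := (-1) ^+ i)); first by rewrite signr_eq0.
by rewrite e2 exprS mulN1r mulNr mulrN.
Qed.

(** The component s is controlled by the component [rcons s a] of the next order; [rcons] is
    injective, so the sum over s is at most the full sum over the components of that order. *)
Lemma adj_W k u i : int_sobolev k u -> (i < k)%N -> adj (W u i) (W u i.+1).
Proof.
move=> su ik a c h h0; have h0' := ltW h0.
have bc c' := bm_cubei (d := d) c' h0'.
have iv j s : (j <= k)%N -> integ mu (fun p => `|weak_derivative j u p s|).
  by move=> jk; apply: integ_norm; exact: (weak_derivativeP su jk s).1.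
have IW j c' : (j <= k)%N -> II mu (W u j) (cubei c' h) =
    \sum_(s : j.-tuple 'I_d) II mu (fun p => `|weak_derivative j u p s|) (cubei c' h).
  by move=> jk; rewrite -II_suml// => s; exact: iv.
have rc c' : \sum_(s : i.-tuple 'I_d)
    II mu (fun p => `|weak_derivative i.+1 u p [tuple of rcons s a]|) (cubei c' h) <=
    II mu (W u i.+1) (cubei c' h).
  have inj : {in xpredT &, injective (fun s : i.-tuple 'I_d => [tuple of rcons s a])}.
    move=> s s' _ _ /(congr1 val)/= /rcons_inj[ss']; exact: val_inj.
  rewrite IW// -(big_imset (fun s => II mu (fun p => `|weak_derivative i.+1 u p s|) (cubei c' h)) inj)/=.
  rewrite [leRHS](bigID (mem ((fun s : i.-tuple 'I_d => [tuple of rcons s a]) @: xpredT)))/=.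
  rewrite lerDl sumr_ge0// => s _; apply: II_ge0 => // p.
  exact: cubei_ge0.
rewrite !IW ?(ltnW ik)// -sumrB; apply: (le_trans (ler_norm_sum _ _ _)).
apply: (@le_trans _ _ (\sum_(s : i.-tuple 'I_d) h *
   (II mu (fun p => `|weak_derivative i.+1 u p [tuple of rcons s a]|) (cubei c h) +
    II mu (fun p => `|weak_derivative i.+1 u p [tuple of rcons s a]|) (cubei (shiftc a h c) h)))).
  by apply: ler_sum => s _; apply: adjacent_cubes => //; exact: weak_pair_derivative su ik.
rewrite -mulr_sumr ler_wpM2l// big_split/= -!IW//.
by apply: lerD; exact: rc.
Qed.

Lemma measurable_weak_derivative k u i s : int_sobolev k u -> (i <= k)%N ->
  measurable_fun setT (fun p => weak_derivative i u p s).
Proof.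
move=> su ik; have [+ _] := weak_derivativeP su ik s.
by move/integrableP => [/measurable_EFinP].
Qed.

Lemma int_sobolev_norm_ge0 k u : (0 <= int_sobolev_norm k u)%E.
Proof.
apply: sume_ge0 => i _; apply: integral_ge0 => x _.
by rewrite lee_fin tnorm_ge0.
Qed.

Lemma integral_W_le k u i : int_sobolev k u -> (i <= k)%N ->
  ((\int[mu]_p W u i p)%:E <= (d ^ i)%:R%:E * int_sobolev_norm k u)%E.
Proof.
move=> su ik; have mt s := measurable_weak_derivative s su ik.
have iW := integ_W su ik.
rewrite /Rintegral fineK; last exact: integrable_fin_num.
apply: (@le_trans _ _ ((d ^ i)%:R%:E * \int[mu]_p (tnorm (weak_derivative i u p))%:E)%E).
  have mT : measurable_fun setT (fun p => (tnorm (weak_derivative i u p))%:E).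
    by apply/measurable_EFinP; exact: measurable_tnorm.
  have T0 p : setT p -> (0 <= (tnorm (weak_derivative i u p))%:E)%E by rewrite lee_fin tnorm_ge0.
  have n0 : (0 <= (d ^ i)%:R%:E :> \bar R)%E by rewrite lee_fin.
  rewrite -(ge0_integralZl mu measurableT mT T0 n0).
  apply: ge0_le_integral => //.
  - by move=> p _; rewrite lee_fin W_ge0.
  - by have /integrableP[] := iW.
  - apply/measurable_EFinP; apply: measurable_funM; first exact: measurable_cst.
    exact: measurable_tnorm.
  - by move=> p _; rewrite -EFinM lee_fin; exact: sum_ler_tnorm.
apply: lee_wpmul2l; first by rewrite lee_fin.
rewrite /int_sobolev_norm (bigD1 (Ordinal (ik : (i < k.+1)%N)))//= leeDl//.
apply: sume_ge0 => j _; apply: integral_ge0 => x _.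
by rewrite lee_fin tnorm_ge0.
Qed.

Lemma gagliardo_W_le k u theta : int_sobolev k u ->
  (DI (fun p r => `|W u k p - W u k r| / enorm (p - r) `^ (theta + d%:R))%R <=
   (d ^ k)%:R%:E * gagliardo k theta u)%E.
Proof.
move=> su; have mt s := measurable_weak_derivative s su (leqnn k).
have mW : measurable_fun setT (W u k).
  by have /integrableP[/measurable_EFinP] := integ_W su (leqnn k).
have mD : mf2 (fun p r => tnorm (weak_derivative k u p \- weak_derivative k u r) /
    enorm (p - r) `^ (theta + d%:R)).
  by apply: mf2_quotient; exact: mf2_tnorm.
rewrite -[gagliardo k theta u]/(DI (fun p r => (tnorm (weak_derivative k u p \- weak_derivative k u r) /
    enorm (p - r) `^ (theta + d%:R))%R)).
rewrite -DI_Z//; last by move=> p r; rewrite divr_ge0 ?tnorm_ge0 ?powR_ge0.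
apply: DI_le.
- apply: mf2_quotient; apply: measurableT_comp => //.
  by apply: measurable_funB; [exact: (mf2_fst_only mW)|exact: (mf2_snd_only mW)].
- by apply: measurable_funM; [exact: measurable_cst|exact: mD].
- by move=> p r; rewrite divr_ge0 ?powR_ge0.
move=> p r; rewrite mulrA ler_wpM2r ?invr_ge0 ?powR_ge0//.
apply: (le_trans _ (sum_ler_tnorm _)); rewrite /W -sumrB.
apply: (le_trans (ler_norm_sum _ _ _)); apply: ler_sum => s _.
exact: ler_dist_dist.
Qed.

Lemma sobolev_norm_ge0 alpha u : (0 <= sobolev_norm alpha u)%E.
Proof.
rewrite /sobolev_norm adde_ge0 ?int_sobolev_norm_ge0//; case: ifP => // _.
apply: integral_ge0 => y _; apply: integral_ge0 => x _.
by rewrite lee_fin divr_ge0 ?tnorm_ge0 ?powR_ge0.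
Qed.

(* The cell averages of |u| are dominated by a sum over dyadic cubes Q of
   lambda_Q 1_Q with sum_Q lambda_Q side(Q)^(d - alpha) <= C |u|. *)
Lemma sobolev_domin alpha L : 0 < alpha -> 0 < L ->
  exists2 C, 0 <= C & forall u T n (c0 : 'I_d -> R), sobolev alpha u ->
    domin n (@same_cell d T n) (2 `^ alpha) (fcell c0 L (fun p => `|u p|))
      (C * fine (sobolev_norm alpha u)).
Proof.
move=> a0 L0; pose k := Num.truncn alpha; pose theta := alpha - k%:R.
have /andP[ka ak] : k%:R <= alpha < k.+1%:R by apply: truncn_itv; exact: ltW.
have theta0 : 0 <= theta by rewrite subr_ge0.
(* A common bound for the numbers d^i of components, i <= k, which compare l^1 norms with
   [tnorm]. *)
pose D : R := \sum_(i < k.+1) (d ^ i)%:R.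
have D0 : 0 <= D by apply: sumr_ge0.
have Dle i : (i <= k)%N -> (d ^ i)%:R <= D.
  by move=> ik; rewrite /D (bigD1 (Ordinal (ik : (i < k.+1)%N)))//= lerDl sumr_ge0.
have fin u : sobolev alpha u -> sobolev_norm alpha u = (fine (sobolev_norm alpha u))%:E.
  by move=> [_ h]; rewrite fineK// ge0_fin_numE// sobolev_norm_ge0.
have N0 u : 0 <= fine (sobolev_norm alpha u) by rewrite fine_ge0// sobolev_norm_ge0.
have WN u i : sobolev alpha u -> (i <= k)%N ->
    \int[mu]_p W u i p <= D * fine (sobolev_norm alpha u).
  move=> su ik; rewrite -lee_fin EFinM -fin//; have [su1 _] := su.
  apply: (le_trans (integral_W_le su1 ik)).
  apply: lee_pmul; rewrite ?lee_fin ?Dle ?int_sobolev_norm_ge0//.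
  rewrite /sobolev_norm leeDl//; case: ifP => // _.
  apply: integral_ge0 => y _; apply: integral_ge0 => x _.
  by rewrite lee_fin divr_ge0 ?tnorm_ge0 ?powR_ge0.
have SN u i T n (c0 : 'I_d -> R) : sobolev alpha u -> (i <= k)%N ->
    \sum_(x : grid d T n) fcell c0 L (W u i) x <= D * fine (sobolev_norm alpha u).
  move=> su ik; apply: le_trans (WN u i su ik); apply: sum_fcell => //.
    exact: integ_W su.1 ik.
  by move=> p; exact: W_ge0.
(* Integer order k >= 1: the base is [W u k.-1] with weight 2, its variation being controlled by
   [W u k]; the k - 1 remaining lifts bring the weight to 2^k. *)
have [t0|tn0] := eqVneq theta 0.
  have ka' : alpha = k%:R by apply/eqP; rewrite -subr_eq0; exact/eqP.
  have k0 : (0 < k)%N by rewrite -(ltr_nat R) -ka'.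
  have kS : k = k.-1.+1 by rewrite prednK.
  have [C C0 HC] := @domin_chain R d L k.-1 2 L0 (ltr1n _ 2).
  pose B : R := (2 ^ d)%:R.
  pose K := 2 * B * D + 8 * B * (d * 2 ^ d)%:R * (2 * d%:R * L * D).
  have K0 : 0 <= K.
    by rewrite addr_ge0 ?mulr_ge0 ?ler0n// ltW.
  exists (C * (k.-1%:R * D + K)); first by rewrite mulr_ge0// addr_ge0// mulr_ge0.
  move=> u T n c0 su; have su1 := su.1.
  have iW i : (i <= k)%N -> integ mu (W u i) by move=> ik; exact: integ_W su1 ik.
  have -> : 2 `^ alpha = 2 ^+ k.-1 * 2 by rewrite ka' powR_mulrn// -exprSr -kS.
  rewrite -W0.
  have base : domin n (@same_cell d T n) 2 (fcell c0 L (W u k.-1) : grid d T n -> R)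
      (K * fine (sobolev_norm alpha u)).
    have := @domin_variation R (grid d T n) n (2 ^ d) (@same_cell d T n) (@same_cell_refl d T n)
      (@same_cell_sym d T n) (@same_cell_trans d T n) (@same_cell_le d T n)
      (@card_same_cell d T n) (expn_gt0 2 d) (@edge d T n) (d * 2 ^ d)%:R (ler0n _ _)
      (@grid_poincare d T n R) (fcell c0 L (W u k.-1))
      (fun x => fcell_ge0 c0 L0 x (W_ge0 u k.-1)).
    move=> /domin_le; apply=> //.
    have h1 := SN u k.-1 T n c0 su (leq_pred k); have h2 := SN u k T n c0 su (leqnn k).
    have aw : adj (W u k.-1) (W u k).
      by have := @adj_W k u k.-1 su1; rewrite prednK// => /(_ (leqnn k)).
    have h3 := @adj_variation R d c0 L T n L0 (W u k.-1) (W u k) (iW _ (leq_pred k))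
      (iW _ (leqnn k)) (W_ge0 u k) aw.
    rewrite /K [leRHS]mulrDl; apply: lerD.
      by rewrite -[leRHS]mulrA ler_wpM2l// mulr_ge0// ler0n.
    rewrite -[leRHS]mulrA ler_wpM2l ?mulr_ge0 ?ler0n//.
    apply: (le_trans h3); rewrite -[leRHS]mulrA ler_wpM2l ?mulr_ge0 ?ler0n// ltW//.
  apply: (domin_le (HC T n c0 (W u) _ _ _ (W_ge0 u) _ base)) => //.
  - by rewrite mulr_ge0.
  - by move=> i ik; apply: iW; rewrite (leq_trans ik)// leq_pred.
  - by move=> i ik; apply: (adj_W su1); rewrite (leq_trans ik)// leq_pred.
  rewrite -[leRHS]mulrA ler_wpM2l// [leRHS]mulrDl lerD2r -[leRHS]mulrA mulr_natl -[X in _ *+ X]card_ord -sumr_const.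
  by apply: ler_sum => i _; apply: SN => //; rewrite (leq_trans (ltnW (ltn_ord i)))// leq_pred.
(* Fractional order: the base is [W u k] with weight 2^theta, given by [domin_haar], and k lifts
   follow. *)
have tpos : 0 < theta by rewrite lt_neqAle eq_sym tn0.
have q1 : 1 < 2 `^ theta.
  have := @gt0_ltr_powR R theta tpos 1 2; rewrite powR1; apply; rewrite ?nnegrE//.
  by rewrite ltr1n.
have [C C0 HC] := @domin_chain R d L k (2 `^ theta) L0 q1.
set b := 2 `^ theta * (2 ^ d)%:R.
pose G := 2 `^ theta / L ^+ d * (b / (b - 1) * (d%:R * L) `^ (theta + d%:R)).
have b1 : 1 < b.
  by rewrite (lt_le_trans q1)// ler_peMr ?(ltW (lt_trans _ q1))// ler1n expn_gt0.
have G0 : 0 <= G.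
  rewrite /G mulr_ge0 ?divr_ge0 ?powR_ge0 ?exprn_ge0 ?(ltW L0)//.
  by rewrite mulr_ge0 ?powR_ge0// divr_ge0//; lra.
exists (C * (k%:R * D + (D + G * D))).
  by rewrite mulr_ge0// addr_ge0// ?mulr_ge0// addr_ge0// mulr_ge0.
move=> u T n c0 su; have su1 := su.1.
have iW i : (i <= k)%N -> integ mu (W u i) by move=> ik; exact: integ_W su1 ik.
have -> : 2 `^ alpha = 2 ^+ k * 2 `^ theta.
  rewrite -powR_mulrn// -powRD; last by rewrite pnatr_eq0 implybT.
  by rewrite /theta addrC subrK.
rewrite -W0.
have base : domin n (@same_cell d T n) (2 `^ theta) (fcell c0 L (W u k) : grid d T n -> R)
    ((D + G * D) * fine (sobolev_norm alpha u)).
  have := @domin_haar R (grid d T n) n (2 ^ d) (@same_cell d T n) (@same_cell_refl d T n)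
      (@same_cell_sym d T n) (@same_cell_trans d T n) (@same_cell_le d T n)
      (@card_same_cell d T n) (expn_gt0 2 d) (2 `^ theta) (fcell c0 L (W u k))
      (fun x => fcell_ge0 c0 L0 x (W_ge0 u k)).
  move=> /domin_le; apply=> //; rewrite mulrDl; apply: lerD; first exact: SN.
  rewrite -lee_fin.
  apply: (le_trans (gagliardo_increments c0 T n L0 (iW k (leqnn k)) tpos)).
  rewrite -[X in (_ <= X%:E)%E]mulrA [X in (_ <= X)%E]EFinM.
  apply: lee_wpmul2l; first by rewrite lee_fin.
  apply: (le_trans (gagliardo_W_le theta su1)).
  rewrite EFinM -fin//; apply: lee_pmul; rewrite ?lee_fin ?Dle//.
    apply: integral_ge0 => y _; apply: integral_ge0 => x _.
    by rewrite lee_fin divr_ge0 ?tnorm_ge0 ?powR_ge0.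
  rewrite /sobolev_norm -/k -/theta (negbTE tn0) leeDr// int_sobolev_norm_ge0//.
apply: (domin_le (HC T n c0 (W u) _ _ _ (W_ge0 u) _ base)) => //.
- by rewrite mulr_ge0// addr_ge0// mulr_ge0.
- by move=> i ik; exact: (adj_W su1).
rewrite -[leRHS]mulrA ler_wpM2l// [leRHS]mulrDl lerD2r -[leRHS]mulrA mulr_natl -[X in _ *+ X]card_ord -sumr_const.
by apply: ler_sum => i _; apply: SN => //; exact: ltnW.
Qed.

End sobolev_functions.

(** * Integration by parts on the line *)

Section integration_on_the_line.
Context {R : realType}.
Local Notation leb := (@lebesgue_measure R).
Implicit Types (f F : R -> R) (H K : nat -> R -> R).

Lemma patch_zero_outside f (a b : R) : (forall x, x < a \/ b < x -> f x = 0) ->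
  (EFin \o f) \_ `[a, b] = EFin \o f.
Proof.
move=> f0; apply/funext => x; rewrite patchE; case: ifPn => //.
rewrite notin_setE/= in_itv/= => /negP; rewrite negb_and -!ltNge => xab.
by rewrite f0//; apply/orP.
Qed.

Lemma integrable_zero_outside f (a b : R) : continuous f ->
  (forall x, x < a \/ b < x -> f x = 0) -> leb.-integrable setT (EFin \o f).
Proof.
move=> cf f0; rewrite -(patch_zero_outside f0); have := @integrable_mkcond _ _ R leb `[a, b] (EFin \o f) (measurable_itv _).
move=> <-.
apply: (@continuous_compact_integrable R f `[a, b]); first exact: segment_compact.
exact: continuous_subspaceT.
Qed.

Lemma integral_derivative0 F f (a b : R) : a < b -> (forall x : R, is_derive x 1 F (f x)) ->
  continuous f -> (forall x, x <= a \/ b <= x -> F x = 0) ->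
  (forall x, x < a \/ b < x -> f x = 0) -> \int[leb]_x f x = 0.
Proof.
move=> ab dF cf F0 f0; rewrite /Rintegral.
rewrite -[X in integral _ _ X]/(EFin \o f) -(patch_zero_outside f0) -integral_mkcond.
have cF x : {for x, continuous F}.
  by apply/differentiable_continuous/derivable1_diffP; exact: (@ex_derive _ _ _ _ _ _ _ (dF x)).
rewrite (@continuous_FTC2 _ f F a b ab).
- by rewrite (F0 a (or_introl (lexx a))) (F0 b (or_intror (lexx b))) -EFinB subrr.
- exact: continuous_subspaceT.
- split.
  + by move=> x _; exact: (@ex_derive _ _ _ _ _ _ _ (dF x)).
  + by apply: cvg_at_right_filter; exact: cF.
  + by apply: cvg_at_left_filter; exact: cF.
- by move=> x _; rewrite derive1E; exact: (@derive_val _ _ _ _ _ _ _ (dF x)).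
Qed.

Lemma integrable_product H K (a b : R) n m : deriv_seq H -> deriv_seq K ->
  (forall n x, x < a \/ b < x -> H n x = 0) ->
  leb.-integrable setT (EFin \o (fun x => H n x * K m x)).
Proof.
move=> dH dK H0; apply: (@integrable_zero_outside _ a b).
  by move=> x; apply: continuousM; exact: deriv_seq_continuous.
by move=> x xab; rewrite H0 ?mul0r.
Qed.

Lemma integral_by_parts_seq H K (a b : R) n k : a < b -> deriv_seq H -> deriv_seq K ->
  (forall n x, x < a \/ b < x -> H n x = 0) ->
  \int[leb]_x (H n x * K k x) = (-1) ^+ k * \int[leb]_x (H (n + k)%N x * K 0%N x).
Proof.
move=> ab dH dK H0; elim: k n => [|k IHk] n; first by rewrite expr0 mul1r addn0.
have ip n' m := @integrable_product H K a b n' m dH dK H0.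
have := @integral_derivative0 (fun x => H n x * K k x) (fun x => H n x * K k.+1 x + K k x * H n.+1 x)
  (a - 1) (b + 1).
move=> /(_ _ _ _ _ _)/= E.
have {}E : \int[leb]_x (H n x * K k.+1 x + K k x * H n.+1 x) = 0.
  apply: E; first by lra.
  - by move=> x; apply: is_derive_eq; first exact: (is_deriveM (dH n x) (dK k x)).
  - by move=> x; apply: cvgD; apply: cvgM; exact: deriv_seq_continuous.
  - by move=> x xab; rewrite H0 ?mul0r//; case: xab => ?; [left|right]; lra.
  - move=> x xab; rewrite !H0 ?mul0r ?mulr0 ?addr0//; case: xab => ?; [left|right|left|right]; lra.
have E2 : (fun x => K k x * H n.+1 x) = (fun x => H n.+1 x * K k x).
  by apply/funext => x; rewrite mulrC.
have ip2 : leb.-integrable setT (EFin \o (fun x => K k x * H n.+1 x)).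
  by rewrite E2; exact: ip.
move: E; rewrite (RintegralD measurableT (ip n k.+1) ip2).
rewrite E2 IHk => /eqP; rewrite addr_eq0 => /eqP ->.
by rewrite addSnnS exprS mulN1r mulNr.
Qed.

End integration_on_the_line.

(** * Integrals of product functions by Fubini's theorem *)

Section product_functions.
Context {R : realType}.
Local Notation leb := (@lebesgue_measure R).

Lemma prodf_cons d (h : 'I_d.+1 -> R -> R) p :
  prodf h (rV_cons p) = h ord0 p.1 * prodf (fun i => h (lift ord0 i)) p.2.
Proof.
rewrite /prodf big_ord_recl rV_consE; congr (_ * _).
by apply: eq_bigr => i _; rewrite rV_consE.
Qed.

(** Induction on d: the measure of R^(d+1) is an image of a product measure under [rV_cons], and the
    product function splits accordingly. *)
Lemma integral_prodf d (h : 'I_d -> R -> R) :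
  (forall i, leb.-integrable setT (EFin \o h i)) ->
  integ (lebesgue_rV R d) (prodf h) /\
  \int[lebesgue_rV R d]_x prodf h x = \prod_i \int[leb]_t h i t.
Proof.
elim: d h => [|d IHd] h ih.
  have E : prodf h = (fun=> 1) by apply/funext => x; rewrite /prodf big_ord0.
  rewrite E big_ord0 /integ /Rintegral; split.
    apply/integrableP; split; first exact/measurable_EFinP.
    rewrite [ltLHS](@integral_dirac _ _ (0 : 'rV[R]_0) R setT measurableT (fun=> `|1%:E|%E))//.
    by rewrite diracE mem_set// mul1e/= normr1 ltry.
  rewrite [X in fine X](@integral_dirac _ _ (0 : 'rV[R]_0) R setT measurableT (fun=> 1%:E))//.
  by rewrite diracE mem_set// mul1e.
have [iP EP] := IHd _ (fun i => ih (lift ord0 i)).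
set P := prodf _ in iP EP; pose m2 := lebesgue_rV R d.
have mh : measurable_fun (setT : set (measurableTypeR R)) (h ord0).
  by have /integrableP[/measurable_EFinP] := ih ord0.
have mP : measurable_fun setT P by have /integrableP[/measurable_EFinP] := iP.
have fP : (\int[m2]_y (P y)%:E)%E = (fine (\int[m2]_y (P y)%:E))%:E.
  by rewrite fineK//; exact: integrable_fin_num iP.
pose g (p : measurableTypeR R * 'rV[R]_d) : \bar R := (h ord0 p.1 * P p.2)%:E.
have Eg : (EFin \o prodf h) \o @rV_cons R d = g by apply/funext => p; rewrite /= prodf_cons.
have mg : measurable_fun setT g.
  apply/measurable_EFinP; apply: measurable_funM.
    by apply: (measurableT_comp mh); exact: measurable_fst.
  by apply: (measurableT_comp mP); exact: measurable_snd.
have ig : (leb \x m2)%E.-integrable setT g.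
  apply/(integrable12ltyP leb m2 mg).
  have E x : (\int[m2]_y `|g (x, y)| = `|h ord0 x|%:E * \int[m2]_y `|(P y)%:E|)%E.
    rewrite -ge0_integralZl//; last by apply: measurableT_comp => //; exact/measurable_EFinP.
    by apply: eq_integral => y _; rewrite /g/= normrM EFinM.
  under eq_integral => x _ do rewrite E.
  have /integrableP[_ lP] := iP; have /integrableP[_ lh] := ih ord0.
  rewrite ge0_integralZr//.
  - by rewrite lte_mul_pinfty ?integral_ge0// ge0_fin_numE ?integral_ge0.
  - by apply/measurable_EFinP; exact: measurableT_comp.
  - exact: integral_ge0.
have mf : measurable_fun setT (EFin \o prodf h).
  apply/measurable_EFinP; apply: measurable_prod => i _.
  have /integrableP[/measurable_EFinP mhi _] := ih i.
  by apply: (measurableT_comp mhi); exact: measurable_coord.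
have mc := @measurable_rV_cons R d.
split.
  apply: (@integrable_pushforward _ _ _ _ R (@rV_cons R d) mc (leb \x m2)%E setT _ mf) => //.
  by rewrite preimage_setT Eg.
rewrite /Rintegral.
rewrite [X in fine X](@integral_pushforward _ _ _ _ R (@rV_cons R d) mc (leb \x m2)%E setT _ mf)//; last first.
  by rewrite preimage_setT Eg.
rewrite preimage_setT Eg -integral12_prod_meas1// big_ord_recl -EP.
have E x : fubini_F m2 g x = ((h ord0 x)%:E * \int[m2]_y (P y)%:E)%E.
  rewrite /fubini_F /g -(integralZl measurableT iP).
  by apply: eq_integral => y _; rewrite /= EFinM.
have EE : fubini_F m2 g = (fun x => ((h ord0 x)%:E * \int[m2]_y (P y)%:E)%E) by apply/funext.
rewrite EE fP integralZr//.
rewrite fineM//; last exact: integrable_fin_num (ih ord0).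

exact: ih.
Qed.

End product_functions.

(** * Uniqueness of weak derivatives almost everywhere *)

Section vanishing.
Context {R : realType} {d : nat}.
Local Notation mu := (lebesgue_rV R d).

Lemma Rintegral_sumI (I : Type) (r : seq I) (f : I -> 'rV[R]_d -> R) :
  (forall j, integ mu (f j)) ->
  \int[mu]_x (\sum_(j <- r) f j x) = \sum_(j <- r) \int[mu]_x f j x.
Proof.
move=> jf; have := II_suml r jf (bm_cst 1).
rewrite /II (_ : (fun x => _ * 1) = (fun x => \sum_(j <- r) f j x)); last first.
  by apply/funext => x; rewrite mulr1.
move=> ->; apply: eq_bigr => j _; apply: eq_Rintegral => x _.
by rewrite mulr1.
Qed.

(** The fundamental lemma of the calculus of variations, tested on product functions only. Such
    functions approximate indicators of cubes; once v has integral 0 on every cube,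
    [dyadic_approximation] gives the same for |v|, and large cubes exhaust the space. *)
Lemma vanishing (v : 'rV[R]_d -> R) : integ mu v ->
  (forall K : 'I_d -> nat -> R -> R, (forall i, deriv_seq (K i)) ->
     test_function (prodf (fun i => K i 0%N)) -> bm (prodf (fun i => K i 0%N)) ->
     II mu v (prodf (fun i => K i 0%N)) = 0) ->
  (\int[mu]_x `|v x|%:E)%E = 0%E.
Proof.
move=> iv tv.
have cube0 c h : 0 < h -> II mu v (cubei c h) = 0.
  move=> h0; have h0' := ltW h0.
  have [p [dp _ _ _] [_ p1 p1l p1r [M pM]]] := mollified_ramp R.
  (* The index is shifted by one: [B m] consists of the derivatives of a difference of smoothed
     Heaviside functions, and [B m 0] tends to [ii h]. *)
  pose B m n t := p m n.+1 t - p m n.+1 (t - h).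
  pose K m i n t := B m n (t - c i).
  have dK m i : deriv_seq (K m i).
    have dp' : deriv_seq (fun n => p m n.+1) by move=> n; exact: dp.
    apply: deriv_seq_shift; apply: deriv_seqB => //; exact: (deriv_seq_shift _ dp').
  have mK m i : measurable_fun setT (K m i 0%N).
    by apply: continuous_measurable_fun; exact: deriv_seq_continuous.
  have KM m i t : `|K m i 0%N t| <= 2 * `|M|.
    have MM s : `|p m 1%N s| <= `|M| by rewrite (le_trans (pM m s)) ?ler_norm.
    have := MM (t - c i); have := MM (t - c i - h).
    by rewrite /K /B !ler_norml => /andP[? ?] /andP[? ?]; apply/andP; split; lra.
  have bK m : bm (prodf (fun i => K m i 0%N)).
    by apply: bm_prodf => // i; exists (2 * `|M|) => t; exact: KM.
  have tK m : test_function (prodf (fun i => K m i 0%N)).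
    apply: (@test_prodf _ _ _ (fun i => c i - 1) (fun i => c i + h)) => // i t.
    rewrite negb_and -!ltNge => /orP[t1|t1]; rewrite /K /B.
      by rewrite !p1l ?subrr//; lra.
    by rewrite !p1r ?subrr//; lra.
  have cv : II mu v (prodf (fun i => K m i 0%N)) @[m --> \oo] --> II mu v (cubei c h).
    apply: (@II_cvg _ _ _ _ _ _ _ ((2 * `|M|) ^+ d)) => //.
    - by move=> m; exact: (bK m).1.
    - exact: (bm_cubei c h0').1.
    - by move=> m x; apply: prodf_bound => i t; exact: KM.
    move=> x; rewrite /cubei; apply: (@cvg_prodf _ _ (fun m i => K m i 0%N)) => i t.
    by apply: cvgB; exact: p1.
  have E : (fun m => II mu v (prodf (fun i => K m i 0%N))) = (fun=> 0).
    by apply/funext => m; exact: tv.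
  rewrite E in cv; apply: (cvg_unique _ cv); first exact: norm_hausdorff.
  exact: cvg_cst.
have iav := integ_norm iv.
have abs0 c h : 0 < h -> II mu (fun x => `|v x|) (cubei c h) = 0.
  move=> h0; apply/le_anti/andP; split; last first.
    by apply: II_ge0 => // x; exact: cubei_ge0 (ltW h0).
  apply/ler_addgt0Pr => e e0; have [m /(_ m (leqnn m)) H] := dyadic_approximation c iv h0 e0.
  apply: (le_trans H); rewrite big1 ?add0r// => z _.
  by rewrite cube0 ?normr0// divr_gt0// ltr0n expn_gt0.
have E : (\int[mu]_x `|v x|%:E)%E = (II mu (fun x => `|v x|) (fun=> 1))%:E.
  rewrite /II /Rintegral fineK.
    by apply: eq_integral => x _; rewrite mulr1.
  apply: integrable_fin_num => //.
  have := integ_bm iav (bm_cst 1); exact.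
rewrite E; congr EFin.
pose w m := cubei (d := d) (fun=> - m.+1%:R) (2 * m.+1%:R : R).
have w0 m : 0 < 2 * m.+1%:R :> R by rewrite mulr_gt0.
have cv : II mu (fun x => `|v x|) (w m) @[m --> \oo] --> II mu (fun x => `|v x|) (fun=> 1).
  apply: (@II_cvg _ _ _ _ _ _ _ 1) => //.
  - by move=> m; exact: (bm_cubei _ (ltW (w0 m))).1.
  - move=> m x; rewrite /w cubeiE ?(ltW (w0 m))// ger0_norm ?ler0n//.
    by rewrite lern1 leq_b1.
  move=> x; apply: cvg_near_cst; near=> m.
  rewrite /w cubeiE ?(ltW (w0 m))// (_ : [forall i, _] = true)//.
  apply/forallP => i.
  have xi : `|x ord0 i| <= \sum_j `|x ord0 j| by rewrite (bigD1 i)//= lerDl sumr_ge0.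
  have : \sum_j `|x ord0 j| <= m%:R by near: m; exact: nbhs_infty_ger.
  move=> /(le_trans xi); rewrite -natr1 ler_norml => /andP[? ?].
  by apply/andP; split; lra.
have E0 : (fun m => II mu (fun x => `|v x|) (w m)) = (fun=> 0).
  by apply/funext => m; exact: abs0.
rewrite E0 in cv; apply: (cvg_unique _ cv); first exact: norm_hausdorff.
exact: cvg_cst.
Unshelve. all: by end_near. Qed.

(** Changing a function on a null set alters its Gagliardo kernel only where p or r lies in that
    set; the two alternatives treat the inner and the outer variable. *)
Lemma DI_null (F : 'rV[R]_d -> 'rV[R]_d -> R) (v : 'rV[R]_d -> R) : mf2 F ->
  (forall p r, 0 <= F p r) -> measurable_fun setT v -> (\int[mu]_x `|v x|%:E)%E = 0%E ->
  (forall p r, v p = 0 -> F p r = 0) \/ (forall p r, v r = 0 -> F p r = 0) -> DI F = 0%E.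
Proof.
move=> mF F0 mv /(ae_eq_integral_abs mu measurableT (f := EFin \o v)) v0 vF.
have {}v0 : ae_eq mu setT (EFin \o v) (cst 0%E) by apply: v0; exact/measurable_EFinP.
rewrite /DI -(integral0 mu setT); case: vF => vF.
  apply: eq_integral => r _; rewrite -(integral0 mu setT).
  apply: ae_eq_integral => //.
    by apply/measurable_EFinP; exact: mf2_fst.
  by apply: filterS v0 => p /= vp _; have [vp0] := vp I; rewrite vF.
apply: ae_eq_integral => //; first exact: mf2_inner.
apply: filterS v0 => r /= vr _; have [vr0] := vr I.
by rewrite -(integral0 mu setT); apply: eq_integral => p _; rewrite vF.
Qed.

End vanishing.

Lemma prod_count_mem (R : comPzRingType) d (s : seq 'I_d) (m : R) :
  \prod_(i < d) m ^+ count_mem i s = m ^+ size s.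
Proof.
elim: s => [|a s IHs]; first by rewrite big1.
rewrite exprS -IHs; under eq_bigr do rewrite /= exprD.
rewrite big_split/=; congr (_ * _).
rewrite (bigD1 a)//= eqxx expr1 big1 ?mulr1// => i.
by rewrite eq_sym => /negbTE ->.
Qed.

(** * Sobolev norms of finite combinations of product functions *)

Section combinations.
Context {R : realType} {d : nat} {J : Type}.
Local Notation mu := (lebesgue_rV R d).
Local Notation leb := (@lebesgue_measure R).
Variables (w : J -> R) (H : J -> 'I_d -> nat -> R -> R) (lo hi : 'I_d -> R).
Hypotheses (dH : forall j i, deriv_seq (H j i)) (lohi : forall i, lo i < hi i).
Hypothesis H0 : forall j i n t, t < lo i \/ hi i < t -> H j i n t = 0.

(** The derivative along s of the combination itself, which is [comb r [::]]. *)
Definition comb (r : seq J) (s : seq 'I_d) (x : 'rV[R]_d) : R :=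
  \sum_(j <- r) w j * prodf (fun i => H j i (count_mem i s)) x.

Lemma is_derive_comb r s a x : is_derive x (delta_mx ord0 a) (comb r s) (comb r (a :: s) x).
Proof.
elim: r => [|j r IHr].
  rewrite (_ : comb [::] s = cst 0); last by apply/funext => y; rewrite /comb big_nil.
  by rewrite /comb big_nil; exact: is_derive_cst.
rewrite (_ : comb (j :: r) s =
    (fun y => w j *: prodf (fun i => H j i (count_mem i s)) y) + comb r s); last first.
  by apply/funext => y; rewrite /comb big_cons.
rewrite /comb big_cons; apply: is_deriveD.
apply: is_derive_eq; first exact: (is_deriveZ (w j) (is_derive_prodf_seq (fun i => count_mem i s) x a (dH j))).
congr (_ * _); apply: eq_bigr => i _ /=; by rewrite eq_sym.
Qed.

Lemma partial_comb r s : partial (comb r [::]) s = comb r s.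
Proof.
elim: s => //= a s ->; apply/funext => x.
exact: (@derive_val _ _ _ _ _ _ _ (is_derive_comb r s a x)).
Qed.

Lemma comb_outside r s (x : 'rV[R]_d) i : x ord0 i < lo i \/ hi i < x ord0 i -> comb r s x = 0.
Proof.
move=> xi; rewrite /comb big1// => j _; rewrite /prodf (bigD1 i)//= H0//.
by rewrite mul0r mulr0.
Qed.

Lemma test_comb r : test_function (comb r [::]).
Proof.
split.
  move=> s; rewrite partial_comb; split; last first.
    by move=> a x; exact: (@ex_derive _ _ _ _ _ _ _ (is_derive_comb r s a x)).
  move=> x; elim: r => [|j r IHr].
    have -> : comb [::] s = cst 0 by apply/funext => y; rewrite /comb big_nil.
    exact: cst_continuous.
  rewrite (_ : comb (j :: r) s =
    (fun y => w j * prodf (fun i => H j i (count_mem i s)) y + comb r s y)); last first.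
    by apply/funext => y; rewrite /comb big_cons.
  have c1 : continuous (prodf (fun i => H j i (count_mem i s))).
    by apply: continuous_prodf => i; exact: deriv_seq_continuous.
  exact: (cvgD (cvgM (cvg_cst (w j)) (c1 x)) IHr).
apply: (@compact_support_box _ _ _ lo hi) => x xn i; rewrite !leNgt -negb_or.
by apply: contra_neqN xn => /orP xi; exact: comb_outside xi.
Qed.

Lemma integ_prodf_seq j (n : 'I_d -> nat) : integ mu (prodf (fun i => H j i (n i))).
Proof.
apply: (integral_prodf _).1 => i; apply: (@integrable_zero_outside _ _ (lo i) (hi i)).
  exact: deriv_seq_continuous.
by move=> t; exact: H0.
Qed.

Lemma integ_comb r s : integ mu (comb r s).
Proof.
apply: integ_sum => j; have := integ_bm (integ_prodf_seq j (fun i => count_mem i s)) (bm_cst (w j)).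
by rewrite (_ : (fun x => _ * w j) = (fun x => w j * prodf (fun i => H j i (count_mem i s)) x))//;
  apply/funext => x; rewrite mulrC.
Qed.

(** Against a product test function everything factors into integrals on the line, and each
    coordinate i is integrated by parts [count_mem i s] times. *)
Lemma comb_by_parts r s (K : 'I_d -> nat -> R -> R) : (forall i, deriv_seq (K i)) ->
  II mu (comb r [::]) (partial (prodf (fun i => K i 0%N)) s) =
  (-1) ^+ size s * II mu (comb r s) (prodf (fun i => K i 0%N)).
Proof.
move=> dK; rewrite partial_prodf//.
pose F j n m x : R := prodf (fun i t => H j i (n i) t * K i (m i) t) x.
have FE j n m x : prodf (fun i => H j i (n i)) x * prodf (fun i => K i (m i)) x = F j n m x.
  by rewrite /prodf -big_split.
have ip j i n m : leb.-integrable setT (EFin \o (fun t => H j i n t * K i m t)).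
  by apply: (integrable_product n m (dH j i) (dK i)) => n' t; exact: H0.
have FI j n m := integral_prodf (fun i => ip j i (n i) (m i)).
have SI s1 m : II mu (comb r s1) (prodf (fun i => K i (m i))) =
    \sum_(j <- r) w j * \int[mu]_x F j (fun i => count_mem i s1) m x.
  rewrite /II (_ : (fun x => _) =
     (fun x => \sum_(j <- r) w j * F j (fun i => count_mem i s1) m x)); last first.
    apply/funext => x; rewrite /comb mulr_suml; apply: eq_bigr => j _.
    by rewrite -mulrA FE.
  rewrite Rintegral_sumI => [|j].
    apply: eq_bigr => j _; rewrite RintegralZl//.
    exact: (FI j _ _).1.
  have := integ_bm (FI j (fun i => count_mem i s1) m).1 (bm_cst (w j)).
  by rewrite (_ : (fun x => _ * w j) = (fun x => w j * F j (fun i => count_mem i s1) m x))//;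
    apply/funext => x; rewrite mulrC.
rewrite (SI [::]) (SI s (fun=> 0%N)) mulr_sumr; apply: eq_bigr => j _.
rewrite mulrCA; congr (_ * _).
rewrite (FI j _ _).2 (FI j _ _).2.
rewrite -(prod_count_mem s (-1)) -big_split/=; apply: eq_bigr => i _.
have := @integral_by_parts_seq R (H j i) (K i) (lo i) (hi i) 0 (count_mem i s) (lohi i) (dH j i) (dK i).
by rewrite add0n; apply => n t; exact: H0.
Qed.

(** Integration by parts against product functions identifies any chosen weak derivative with the
    classical one almost everywhere. If the set of integrable weak derivatives were empty, [xget]
    would return its default 0, which contributes nothing to the norm; both alternatives suffice for
    an upper bound. *)
Lemma weak_derivative_comb r i : weak_derivative i (comb r [::]) = (fun _ _ => 0) \/
  forall s : i.-tuple 'I_d,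
    measurable_fun setT (fun x => weak_derivative i (comb r [::]) x s) /\
    (\int[mu]_x `|weak_derivative i (comb r [::]) x s - comb r s x|%:E)%E = 0%E.
Proof.
case: i => [|i].
  right=> s; rewrite (tuple0 s) /=; split.
    by have /integrableP[/measurable_EFinP] := integ_comb r [::].
  rewrite -(integral0 mu setT); apply: eq_integral => x _.
  by rewrite subrr normr0.
have [[g hg]|ng] := pselect (exists g : 'rV[R]_d -> tensor i.+1,
    integrable_weak_derivative (comb r [::]) g); last first.
  by left; rewrite /weak_derivative xgetPN// => g hg; apply: ng; exists g.
right=> s; have hw : integrable_weak_derivative (comb r [::]) (weak_derivative i.+1 (comb r [::])).
  exact: (@xgetPex _ (fun _ _ => 0) [set g | integrable_weak_derivative (comb r [::]) g] (ex_intro _ g hg)).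
have [iw ww] := hw s; split; first by move/integrableP : iw => [/measurable_EFinP].
set wd := fun x => weak_derivative i.+1 (comb r [::]) x s in iw ww *.
have iv : integ mu (fun x => wd x - comb r s x).
  have := integD iw (integ_bm (integ_comb r s) (bm_cst (-1))).
  rewrite (_ : (fun x => _ + _) = (fun x => wd x - comb r s x))//.
  by apply/funext => x; rewrite mulrN1.
apply: vanishing iv _ => K dK tK bK.
have E : II mu wd (prodf (fun i => K i 0%N)) = II mu (comb r s) (prodf (fun i => K i 0%N)).
  apply: (mulfI (x := (-1) ^+ i.+1)); first by rewrite signr_eq0.
  rewrite -[LHS](ww _ tK) -[X in _ ^+ X](size_tuple s) -comb_by_parts//.
rewrite /II (_ : (fun x => _) = (fun x => wd x * prodf (fun i => K i 0%N) x -
    comb r s x * prodf (fun i => K i 0%N) x)); last by apply/funext => x; rewrite mulrBl.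
rewrite RintegralB//; [|exact: integ_bm|exact: integ_bm (integ_comb r s) bK].
by rewrite -/(II mu wd _) E subrr.
Qed.

Lemma sobolev_norm_comb r alpha (k := Num.truncn alpha) (theta := alpha - k%:R) :
  (sobolev_norm alpha (comb r [::]) <=
   \sum_(i < k.+1) \sum_(s : i.-tuple 'I_d) \int[mu]_x `|comb r s x|%:E +
   if theta == 0%R then 0 else \sum_(s : k.-tuple 'I_d)
     DI (fun p q => `|comb r s p - comb r s q| / enorm (p - q) `^ (theta + d%:R))%R)%E.
Proof.
have mG s : measurable_fun setT (comb r s) by have /integrableP[/measurable_EFinP] := integ_comb r s.
have tn0 i (t : @tensor R d i) : t = (fun _ => 0) -> tnorm t = 0.
  by move=> ->; rewrite /tnorm big1 ?sqrtr0// => s _; rewrite expr0n.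
rewrite /sobolev_norm -/k -/theta; apply: leeD.
  apply: lee_sum => i _; have [->|wG] := weak_derivative_comb r i.
    rewrite (_ : (\int[mu]_x _)%E = 0%E); last first.
      by rewrite -(integral0 mu setT); apply: eq_integral => x _; rewrite tn0.
    by apply: sume_ge0 => s _; apply: integral_ge0 => x _; rewrite lee_fin.
  have mw s := (wG s).1.
  have E (s : i.-tuple 'I_d) : (\int[mu]_x `|weak_derivative i (comb r [::]) x s|%:E =
      \int[mu]_x `|comb r s x|%:E)%E.
    have mB : measurable_fun setT (fun x => weak_derivative i (comb r [::]) x s - comb r s x).
      by apply: measurable_funB => //.
    have /measurable_EFinP mE := mB.
    have ae := (ae_eq_integral_abs mu measurableT mE).1 (wG s).2.
    apply: ae_eq_integral => //.
    - by apply/measurable_EFinP; exact: measurableT_comp.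
    - by apply/measurable_EFinP; exact: measurableT_comp.
    apply: filterS ae => x /= h _; have [/eqP] := h I.
    by rewrite subr_eq0 => /eqP ->.
  under eq_bigr => s _ do rewrite -E.
  have mE (s : i.-tuple 'I_d) : measurable_fun setT
      (fun x => `|weak_derivative i (comb r [::]) x s|%:E).
    by apply/measurable_EFinP; exact: measurableT_comp.
  have E0 (s : i.-tuple 'I_d) x : setT x -> (0 <= `|weak_derivative i (comb r [::]) x s|%:E)%E.
    by rewrite lee_fin.
  rewrite -(ge0_integral_sum mu measurableT mE E0).
  apply: ge0_le_integral => //.
  - by move=> x _; rewrite lee_fin tnorm_ge0.
  - by apply/measurable_EFinP; exact: measurable_tnorm.
  - by apply: emeasurable_sum.
  - by move=> x _; rewrite sumEFin lee_fin; exact: tnorm_ler_sum.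
case: ifP => // _.
set wd := weak_derivative k (comb r [::]).
have mnum f : mf2 f -> mf2 (fun p q => `|f p q| / enorm (p - q) `^ (theta + d%:R)).
  by move=> mf; apply: mf2_quotient; exact: measurableT_comp.
have m2B (f : 'rV[R]_d -> R) : measurable_fun setT f -> mf2 (fun p q => f p - f q).
  by move=> mf; apply: measurable_funB; [exact: (mf2_fst_only mf)|exact: (mf2_snd_only mf)].
rewrite -[gagliardo k theta _]/(DI (fun p q =>
  (tnorm (wd p \- wd q) / enorm (p - q) `^ (theta + d%:R))%R)).
have [w0|wG] := weak_derivative_comb r k.
  rewrite [leLHS](_ : _ = 0%E); last first.
    rewrite /DI -(integral0 mu setT); apply: eq_integral => q _.
    rewrite -(integral0 mu setT); apply: eq_integral => p _.
    by rewrite tn0 ?mul0r//; apply/funext => s; rewrite /wd w0 /= subrr.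
  by apply: sume_ge0 => s _; apply: DI_ge0 => p q; rewrite divr_ge0 ?powR_ge0.
have mw s := (wG s).1.
pose v (s : k.-tuple 'I_d) x := wd x s - comb r s x.
have mv s : measurable_fun setT (v s) by apply: measurable_funB => //; exact: mw.
pose ker (f : 'rV[R]_d -> 'rV[R]_d -> R) := (fun p q => `|f p q| / enorm (p - q) `^ (theta + d%:R)).
have k0 f p q : 0 <= ker f p q by rewrite divr_ge0 ?powR_ge0.
have mk1 s : mf2 (ker (fun p _ => v s p)) by apply: mnum; exact: (mf2_fst_only (mv s)).
have mk2 s : mf2 (ker (fun _ q => v s q)) by apply: mnum; exact: (mf2_snd_only (mv s)).
have mk s : mf2 (ker (fun p q => comb r s p - comb r s q)) by apply: mnum; apply: m2B.
have d1 s : DI (ker (fun p _ => v s p)) = 0%E.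
  apply: (DI_null (mk1 s) _ (mv s) (wG s).2) => //.
  by left=> p q vp; rewrite /ker vp normr0 mul0r.
have d2 s : DI (ker (fun _ q => v s q)) = 0%E.
  apply: (DI_null (mk2 s) _ (mv s) (wG s).2) => //.
  by right=> p q vp; rewrite /ker vp normr0 mul0r.
(* The kernel of the chosen derivative is at most the kernel of the classical one plus the kernels
   of the null difference [v s] at p and at q, whose double integrals are 0. *)
pose F (s : k.-tuple 'I_d) (b : 'I_3) := nth (fun _ _ => 0) [:: ker (fun p q => comb r s p - comb r s q);
  ker (fun p _ => v s p); ker (fun _ q => v s q)] b.
have mF s b : mf2 (F s b) by rewrite /F; case: b => -[|[|[|//]]] /= _.
have F0 s b p q : 0 <= F s b p q by rewrite /F; case: b => -[|[|[|//]]] /= _.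
have -> : (\sum_(s : k.-tuple 'I_d) DI (ker (fun p q => (comb r s p - comb r s q)%R)) =
    DI (fun p q => (\sum_(s : k.-tuple 'I_d) \sum_(b < 3) F s b p q)%R))%E.
  rewrite DI_sum.
  - apply: eq_bigr => s _; rewrite DI_sum//.
    by rewrite !big_ord_recl big_ord0 /F/= d1 d2 !adde0.
  - by move=> s; apply: measurable_sum => b; exact: mF.
  - by move=> s p q; apply: sumr_ge0.
apply: DI_le.
- apply: mf2_quotient; apply: mf2_tnorm => s; exact: mw.
- by apply: measurable_sum => s; apply: measurable_sum => b; exact: mF.
- by move=> p q; rewrite divr_ge0 ?tnorm_ge0 ?powR_ge0.
move=> p q; apply: (@le_trans _ _ ((\sum_(s : k.-tuple 'I_d) `|wd p s - wd q s|) /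
   enorm (p - q) `^ (theta + d%:R))).
  by apply: ler_wpM2r; [rewrite invr_ge0 powR_ge0|exact: tnorm_ler_sum].
rewrite mulr_suml; apply: ler_sum => s _.
rewrite !big_ord_recl big_ord0 /F/= /ker addr0 -!mulrDl.
apply: ler_wpM2r; first by rewrite invr_ge0 powR_ge0.
rewrite (_ : wd p s - wd q s = (comb r s p - comb r s q) + (v s p - v s q)); last by rewrite /v; ring.
apply: (le_trans (ler_normD _ _)); rewrite lerD2l.
exact: ler_normB.
Qed.

End combinations.

(** * A smooth bump and elementary estimates *)

Section bump.
Context {R : realType}.
Implicit Types (t u : R).

Lemma deriv_seq_scale (H : nat -> R -> R) (m a : R) : deriv_seq H ->
  deriv_seq (fun n t => m ^+ n * H n (m * (t - a))).
Proof.
move=> dH n t.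
have d1 : is_derive t 1 (fun s : R => m * (s - a)) m.
  have d0 := is_deriveD (is_derive_id t (1 : R)) (is_derive_cst (- a) t (1 : R)).
  by have := is_deriveZ m d0; rewrite addr0 => /is_derive_eq; apply; rewrite /GRing.scale/= mulr1.
have d2 := @is_derive1_comp R (H n) (fun s : R => m * (s - a)) t _ _ (dH n _) d1.
have := is_deriveZ (m ^+ n) d2; move=> /is_derive_eq; apply.
by rewrite /GRing.scale/= exprSr -!mulrA; congr (_ * _); rewrite mulrC.
Qed.

Lemma deriv_seq_lipschitz (H : nat -> R -> R) n (M : R) t u : deriv_seq H ->
  (forall x, `|H n.+1 x| <= M) -> `|H n t - H n u| <= M * `|t - u|.
Proof.
move=> dH HM; wlog tu : t u / u < t.
  move=> h; have [|tu|->] := ltgtP t u; [|exact: h|by rewrite !subrr normr0 mulr0].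
  by move=> tu; rewrite distrC [`|t - u|]distrC; exact: h.
have [|x _ ->] := @MVT R (H n) (H n.+1) u t tu (fun x _ => dH n x).
  by apply: continuous_subspaceT => x; exact: deriv_seq_continuous.
by rewrite normrM ler_wpM2r.
Qed.

(** step (t + 1) - step (t - 1): the first transition ends at 0 and the second begins at 1. *)
Lemma bump : exists2 b : nat -> R -> R, deriv_seq b &
  [/\ forall t, 0 <= b 0%N t, forall t, 0 <= t <= 1 -> b 0%N t = 1,
      forall n t, t < -1 \/ 2 < t -> b n t = 0 &
      forall n, exists M, forall t, `|b n t| <= M].
Proof.
have [s s0 ds] := Ck_deriv_seq (@Ck_step R).
pose b n t := s n (t - - 1) - s n (t - 1).
have db : deriv_seq b by apply: deriv_seqB; exact: deriv_seq_shift.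
have bl : forall x, x < -1 -> b 0%N x = 0.
  by move=> t t1; rewrite /b s0 !step0 ?subrr//; lra.
have br : forall x, 2 < x -> b 0%N x = 0.
  by move=> t t1; rewrite /b s0 !step1 ?subrr//; lra.
have bz n t : t < -1 \/ 2 < t -> b n t = 0.
  case: n => [[?|?]|n]; [exact: bl|exact: br|move=> [?|?]].
    exact: (deriv_seq_cst_left db bl).
  exact: (deriv_seq_cst_right db br).
exists b => //; split => //.
- move=> t; rewrite /b s0; have [t0|t0] := leP 0 t.
    by rewrite step1 ?subr_ge0 ?step_le1//; lra.
  by rewrite (@step0 _ (t - 1)) ?subr0 ?step_ge0//; lra.
- move=> t /andP[? ?]; rewrite /b s0 step1 ?step0 ?subr0//; lra.
move=> n; have ab : -1 <= 2 :> R by lra.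
have [M _ bM] := @bounded_cst_outside R (b n) (-1) 2 0 0 ab (deriv_seq_continuous db)
   (fun t h => bz n t (or_introl h)) (fun t h => bz n t (or_intror h)).
by exists M.
Qed.

(** Factors are exchanged one at a time; A >= 1 allows the same power of A in front of every
    term. *)
Lemma prod_lipschitz (I : Type) (r : seq I) (a b : I -> R) (A : R) : 1 <= A ->
  (forall i, `|a i| <= A) -> (forall i, `|b i| <= A) ->
  `|\prod_(i <- r) a i - \prod_(i <- r) b i| <= A ^+ size r * \sum_(i <- r) `|a i - b i|.
Proof.
move=> A1 aA bA; have A0 : 0 <= A by rewrite (le_trans ler01).
elim: r => [|i r IHr]; first by rewrite !big_nil subrr normr0 mulr0.
rewrite !big_cons (_ : _ - _ = (a i - b i) * \prod_(j <- r) a j +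
   b i * (\prod_(j <- r) a j - \prod_(j <- r) b j)); last by ring.
apply: (le_trans (ler_normD _ _)); rewrite !normrM mulrDr; apply: lerD.
  rewrite mulrC ler_wpM2r// normr_prod.
  apply: (@le_trans _ _ (\prod_(j <- r) A)).
    by apply: ler_prod => j _; rewrite normr_ge0 aA.
  by rewrite big_const_seq count_predT iter_mulr_1; apply: ler_weXn2l => //; exact: leqnSn.
rewrite exprS -mulrA; apply: ler_pM => //; exact: mulr_ge0.
Qed.

Lemma dyadic_bracket (y : R) : 1 <= y -> exists m, 2 ^+ m <= y < 2 ^+ m.+1.
Proof.
move=> y1; have ex : exists n, y < 2 ^+ n.+1.
  exists (Num.bound y).
  apply: (lt_le_trans (archi_boundP (le_trans ler01 y1))).
  by rewrite -natrX ler_nat (leq_trans _ (ltnW (ltn_expl _ _))).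
case: (ex_minnP ex) => -[|m] ym mmin.
  by exists 0%N; rewrite expr0 y1.
exists m.+1; rewrite ym andbT leNgt; apply/negP => /mmin.
by rewrite ltnn.
Qed.

Lemma geom_le (x : R) n : 0 <= x < 1 -> \sum_(0 <= m < n) x ^+ m <= (1 - x)^-1.
Proof.
move=> /andP[x0 x1]; have x10 : 0 < 1 - x by rewrite subr_gt0.
rewrite -[leRHS]mul1r ler_pdivlMr// big_mkord.
have := subrX1 x n; rewrite -opprB -[x - 1]opprB mulNr => /oppr_inj E.
by rewrite mulrC -E gerBl exprn_ge0.
Qed.

End bump.

(** * Kernel integrals over dyadic shells *)

Section series.
Context {R : realType} {d : nat}.
Local Notation mu := (lebesgue_rV R d).

(** Each point lies under at least one term, so f is at most the whole series of nonnegative terms,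
    which is integrated term by term; the cubes may overlap. *)
Lemma integral_le_series (f : 'rV[R]_d -> R) (a b h : nat -> R) (B : R)
    (r l : nat -> R) (c e : nat -> 'I_d -> R) :
  measurable_fun setT f -> (forall x, 0 <= f x) -> (forall m, 0 <= a m) -> (forall m, 0 <= b m) ->
  (forall m, 0 <= r m) -> (forall m, 0 <= l m) ->
  (forall x, exists m, f x <= a m * cubei (c m) (r m) x + b m * cubei (e m) (l m) x) ->
  (forall n, \sum_(0 <= m < n) (a m * r m ^+ d + b m * l m ^+ d) <= B) ->
  (\int[mu]_x (f x)%:E <= B%:E)%E.
Proof.
move=> mf f0 a0 b0 r0 l0 fs sB.
pose g m x := a m * cubei (c m) (r m) x + b m * cubei (e m) (l m) x.
have g0 m x : 0 <= g m x by rewrite addr_ge0 ?mulr_ge0 ?cubei_ge0.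
have mg m : measurable_fun setT (fun x => (g m x)%:E).
  apply/measurable_EFinP; apply: measurable_funD.
    exact: (bmZ (a m) (bm_cubei (c m) (r0 m))).1.
  exact: (bmZ (b m) (bm_cubei (e m) (l0 m))).1.
have Ig m : (\int[mu]_x (g m x)%:E = (a m * r m ^+ d + b m * l m ^+ d)%:E)%E.
  have ig t s y : 0 <= s -> integ mu (fun x => t * cubei y s x).
    move=> s0; have := integ_bm (integ_cubei (d := d) y s0) (bm_cst t).
    rewrite (_ : (fun x => _ * t) = (fun x => t * cubei y s x))//.
    by apply/funext => x; rewrite mulrC.
  have iz t s y : 0 <= s -> \int[mu]_x (t * cubei y s x) = t * s ^+ d.
    by move=> s0; rewrite RintegralZl// ?integral_cubei//; exact: integ_cubei.
  have := RintegralD measurableT (ig (a m) _ (c m) (r0 m)) (ig (b m) _ (e m) (l0 m)).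
  rewrite iz// iz// => <-; rewrite /Rintegral fineK//.
  have := integrable_fin_num measurableT (integD (ig (a m) _ (c m) (r0 m)) (ig (b m) _ (e m) (l0 m))).
  exact.
apply: (@le_trans _ _ (\int[mu]_x (\sum_(0 <= m <oo) (g m x)%:E))%E).
  apply: ge0_le_integral => //.
  - by move=> x _; rewrite lee_fin.
  - exact/measurable_EFinP.
  - by apply: ge0_emeasurable_sum => // m x _ _; rewrite lee_fin.
  move=> x _; have [m fm] := fs x.
  apply: (@le_trans _ _ (\sum_(0 <= i < m.+1) (g i x)%:E)%E); last first.
    by apply: nneseries_lim_ge => n _ _; rewrite lee_fin.
  rewrite sumEFin lee_fin big_nat_recr//= (le_trans fm)// lerDr.
  by apply: sumr_ge0.
rewrite integral_nneseries//; last by move=> n x _; rewrite lee_fin.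
apply: lime_le.
  by apply: is_cvg_nneseries => n _ _; apply: integral_ge0 => x _; rewrite lee_fin.
apply: nearW => n; rewrite (eq_bigr (fun m => (a m * r m ^+ d + b m * l m ^+ d)%:E)).
  by rewrite sumEFin lee_fin.
by move=> m _; exact: Ig.
Qed.

End series.

Section shells.
Context {R : realType} {d : nat}.
Local Notation mu := (lebesgue_rV R d).

Lemma coord_le_enorm (x : 'rV[R]_d) i : `|x ord0 i| <= enorm x.
Proof.
rewrite -sqrtr_sqr; apply: ler_wsqrtr; rewrite (bigD1 i)//= lerDl.
by apply: sumr_ge0 => j _; exact: sqr_ge0.
Qed.

Lemma enorm_sym (x y : 'rV[R]_d) : enorm (x - y) = enorm (y - x).
Proof. by congr Num.sqrt; apply: eq_bigr => i _; rewrite !mxE -sqrrN opprB. Qed.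

Lemma cubei_center (q p : 'rV[R]_d) r : 0 < r -> enorm (p - q) < 2 * r ->
  cubei (fun i => q ord0 i - 2 * r) (4 * r) p = 1.
Proof.
move=> r0 pq; rewrite cubeiE ?mulr_ge0 ?(ltW r0)// (_ : [forall i, _] = true)//.
apply/forallP => i; have := le_lt_trans (coord_le_enorm (p - q) i) pq.
by rewrite !mxE ltr_norml => /andP[? ?]; apply/andP; split; lra.
Qed.

Lemma exprn_div_powR r (t : R) : 0 < r -> r ^+ d / r `^ (t + d%:R) = r `^ (- t).
Proof.
move=> r0; have rn : r != 0 by rewrite gt_eqF.
rewrite powRN powRD ?rn ?implybT// powR_mulrn ?(ltW r0)// invfM mulrCA mulfV ?mulr1//.
by rewrite expf_neq0.
Qed.

Lemma powR_geo (l x t : R) m : 0 < l -> 0 < x -> (l * x ^+ m) `^ t = l `^ t * (x `^ t) ^+ m.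
Proof.
move=> l0 x0; rewrite powRM ?exprn_ge0 ?(ltW l0) ?(ltW x0)//; congr (_ * _).
by rewrite -!powR_mulrn ?powR_ge0 ?(ltW x0)// -!powRrM mulrC.
Qed.

(* The annuli between the radii 2^m l and 2^(m+1) l, for m in Z. *)
Lemma integral_shells (t : R) : 0 < t < 1 -> exists2 C, 0 <= C &
  forall (q : 'rV[R]_d) (f : 'rV[R]_d -> R) (l A B : R), 0 < l -> 0 <= A -> 0 <= B ->
    measurable_fun setT f -> (forall p, 0 <= f p) ->
    (forall p, f p <= A / enorm (p - q) `^ (t + d%:R)) ->
    (forall p, f p <= B * enorm (p - q) / enorm (p - q) `^ (t + d%:R)) ->
    (\int[mu]_p (f p)%:E <= (C * ((A + B * l) * l `^ (- t)))%:E)%E.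
Proof.
move=> /andP[t0 t1]; set s := t + d%:R; have s0 : 0 < s by rewrite ltr_wpDr.
(* Ratios of the two series: an outer shell of radius rho contributes rho^-t, an inner one of radius
   sig contributes sig^(1 - t). Both converge because 0 < t < 1. *)
pose X : R := 2 `^ (- t); pose Y : R := 2^-1 `^ (1 - t).
have X01 : 0 <= X < 1.
  rewrite powR_ge0/= /X powRN invf_lt1 ?powR_gt0//.
  have := @gt0_ltr_powR R t t0 1 2; rewrite powR1; apply; rewrite ?nnegrE//.
  by rewrite ltr1n.
have t10 : 0 < 1 - t by rewrite subr_gt0.
have Y01 : 0 <= Y < 1.
  rewrite powR_ge0/= /Y; have := @gt0_ltr_powR R (1 - t) t10 2^-1 1.
  by rewrite powR1; apply; rewrite ?nnegrE//; lra.
have X1 : 0 <= (1 - X)^-1 by rewrite invr_ge0 subr_ge0; case/andP: X01 => _ /ltW.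
have Y1 : 0 <= (1 - Y)^-1 by rewrite invr_ge0 subr_ge0; case/andP: Y01 => _ /ltW.
pose C1 := 4 ^+ d * (1 - X)^-1; pose C2 := 4 ^+ d * (2 `^ s * (1 - Y)^-1).
have C10 : 0 <= C1 by rewrite mulr_ge0 ?exprn_ge0.
have C20 : 0 <= C2 by rewrite mulr_ge0 ?exprn_ge0// mulr_ge0// powR_ge0.
exists (C1 + C2); first by rewrite addr_ge0.
move=> q f l A B l0 A0 B0 mf f0 fA fB.
pose rho m := l * 2 ^+ m; pose sig m := l * 2^-1 ^+ m.
have rho0 m : 0 < rho m by rewrite mulr_gt0 ?exprn_gt0.
have sig0 m : 0 < sig m by rewrite mulr_gt0 ?exprn_gt0 ?invr_gt0.
have pw r r' : 0 < r -> r <= r' -> (r' `^ s)^-1 <= (r `^ s)^-1.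
  move=> r0 rr; rewrite lef_pV2 ?posrE ?powR_gt0 ?(lt_le_trans r0)//.
  by apply: ge0_ler_powR; rewrite ?nnegrE ?(ltW s0) ?(ltW r0)// (le_trans (ltW r0)).
(* Beyond l the shell has inner radius [rho m] and the bound by A is used; inside, its outer radius
   is [sig m] and the bound by B is used. Cubes of side four times these radii contain the
   shells. *)
apply: (@integral_le_series R d f (fun m => A / rho m `^ s)
   (fun m => B * sig m / (sig m / 2) `^ s) (fun=> 0) _ (fun m => 4 * rho m) (fun m => 4 * sig m)
   (fun m i => q ord0 i - 2 * rho m) (fun m i => q ord0 i - 2 * sig m)) => //.
- by move=> m; rewrite divr_ge0 ?powR_ge0.
- by move=> m; rewrite divr_ge0 ?powR_ge0// mulr_ge0// ltW.
- by move=> m; rewrite mulr_ge0 ?(ltW (rho0 m)).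
- by move=> m; rewrite mulr_ge0 ?(ltW (sig0 m)).
- move=> p; have aux m : 0 <= A / rho m `^ s * cubei (fun i => q ord0 i - 2 * rho m) (4 * rho m) p.
    by rewrite mulr_ge0 ?divr_ge0 ?powR_ge0// cubei_ge0// mulr_ge0// ltW.
  have aux2 m : 0 <= B * sig m / (sig m / 2) `^ s * cubei (fun i => q ord0 i - 2 * sig m) (4 * sig m) p.
    apply: mulr_ge0; first by rewrite divr_ge0 ?powR_ge0// mulr_ge0// ltW.
    by rewrite cubei_ge0// mulr_ge0// ltW.
  (* At p = q, which lies in no shell, the second bound gives f p <= 0. *)
  have := enorm_ge0 (p - q); rewrite le_eqVlt => /orP[/eqP e0|e0].
    exists 0%N; apply: (@le_trans _ _ 0); last exact: addr_ge0.
    by rewrite (le_trans (fB p))// -e0 mulr0 mul0r.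
  have [le|el] := leP l (enorm (p - q)).
    have [|m] := @dyadic_bracket R (enorm (p - q) / l); first by rewrite ler_pdivlMr// mul1r.
    rewrite ler_pdivlMr// ltr_pdivrMr// => /andP[m1 m2].
    have m1' : rho m <= enorm (p - q) by rewrite /rho mulrC.
    have m2' : enorm (p - q) < 2 * rho m by rewrite /rho; rewrite exprS in m2; lra.
    exists m; apply: (@le_trans _ _ (A / rho m `^ s)).
      by rewrite (le_trans (fA p))// ler_wpM2l// pw.
    by rewrite (cubei_center (rho0 m) m2') mulr1 lerDl.
  have [|m] := @dyadic_bracket R (l / enorm (p - q)).
    by rewrite ler_pdivlMr// mul1r ltW.
  rewrite ler_pdivlMr// ltr_pdivrMr// => /andP[m1 m2].
  have z2 : (2 : R) ^+ m != 0 by rewrite expf_neq0.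
  have m1' : enorm (p - q) <= sig m.
    by rewrite /sig exprVn ler_pdivlMr ?exprn_gt0// mulrC.
  have m2' : sig m / 2 <= enorm (p - q).
    by rewrite /sig exprVn -mulrA -invfM -exprSr ler_pdivrMr ?exprn_gt0// mulrC ltW.
  have m3 : enorm (p - q) < 2 * sig m by have := sig0 m; lra.
  exists m; apply: (@le_trans _ _ (B * sig m / (sig m / 2) `^ s)).
    rewrite (le_trans (fB p))//; apply: ler_pM.
    + by rewrite mulr_ge0// ltW.
    + by rewrite invr_ge0 powR_ge0.
    + by rewrite ler_wpM2l.
    + by apply: pw => //; rewrite divr_gt0.
  by rewrite (cubei_center (sig0 m) m3) mulr1 lerDr.
move=> n.
have Ea m : A / rho m `^ s * (4 * rho m) ^+ d = 4 ^+ d * (A * l `^ (- t)) * X ^+ m.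
  rewrite exprMn -mulrA [_^-1 * _]mulrCA [_^-1 * _]mulrC (exprn_div_powR t (rho0 m)).
  by rewrite powR_geo//; rewrite -/X; ring.
have Eb m : B * sig m / (sig m / 2) `^ s * (4 * sig m) ^+ d =
    4 ^+ d * (2 `^ s * (B * l * l `^ (- t))) * Y ^+ m.
  have h2 : (2^-1 : R) `^ s = (2 `^ s)^-1 by rewrite -powR_inv1// -powRrM mulN1r powRN.
  rewrite powRM ?(ltW (sig0 m))// h2 invfM invrK exprMn.
  rewrite (_ : B * sig m * ((sig m `^ s)^-1 * 2 `^ s) * (4 ^+ d * sig m ^+ d) =
    4 ^+ d * (2 `^ s * B) * (sig m * (sig m ^+ d / sig m `^ s))); last by ring.
  rewrite (exprn_div_powR t (sig0 m)) -{1}(powRr1 (ltW (sig0 m))) -powRD; last first.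
    by rewrite (gt_eqF (sig0 m)) implybT.
  rewrite powR_geo ?invr_gt0// -/Y powRD ?(gt_eqF l0) ?implybT//.
  by rewrite (powRr1 (ltW l0)); ring.
rewrite big_split/= (eq_bigr _ (fun m _ => Ea m)) (eq_bigr _ (fun m _ => Eb m)) -!mulr_sumr.
have p0 := powR_ge0 l (- t).
apply: (@le_trans _ _ (4 ^+ d * (A * l `^ (- t)) * (1 - X)^-1 +
   4 ^+ d * (2 `^ s * (B * l * l `^ (- t))) * (1 - Y)^-1)).
  apply: lerD; apply: ler_wpM2l; rewrite ?geom_le//.
    by rewrite mulr_ge0 ?exprn_ge0// mulr_ge0.
  by rewrite mulr_ge0 ?exprn_ge0// mulr_ge0 ?powR_ge0// !mulr_ge0// ltW.
rewrite [leLHS](_ : _ = C1 * (A * l `^ (- t)) + C2 * (B * l * l `^ (- t))); last first.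
  by rewrite /C1 /C2; ring.
have u0 : 0 <= A * l `^ (- t) by rewrite mulr_ge0.
have v0 : 0 <= B * l * l `^ (- t) by rewrite !mulr_ge0// ltW.
have := mulr_ge0 C10 v0; have := mulr_ge0 C20 u0; lra.
Qed.

Lemma DI_swap (F : 'rV[R]_d -> 'rV[R]_d -> R) : mf2 F -> (forall p r, 0 <= F p r) ->
  DI F = DI (fun p r => F r p).
Proof.
move=> mF F0; have := @fubini_tonelli _ _ _ _ _ mu mu (fun z => (F z.1 z.2)%:E).
rewrite /DI => -> //.
  exact/measurable_EFinP.
by move=> z; rewrite lee_fin.
Qed.

Lemma DI_localized (F : 'rV[R]_d -> 'rV[R]_d -> R) c h Z : mf2 F -> (forall p r, 0 <= F p r) ->
  0 <= h -> (forall r, \int[mu]_p (F p r)%:E <= Z%:E)%E ->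
  (DI (fun p r => (cubei c h r * F p r)%R) <= (h ^+ d * Z)%:E)%E.
Proof.
move=> mF F0 h0 FZ; rewrite /DI.
have Z0 : 0 <= Z.
  by rewrite -lee_fin (le_trans _ (FZ 0))// integral_ge0// => p _; rewrite lee_fin.
have mc : measurable_fun setT (cubei (d := d) c h) := (bm_cubei c h0).1.
have E : (fun r => \int[mu]_p (cubei c h r * F p r)%:E)%E =
    (fun r => (cubei c h r)%:E * \int[mu]_p (F p r)%:E)%E.
  apply/funext => r; rewrite -ge0_integralZl//.
  - by apply/measurable_EFinP; exact: mf2_fst.
  - by move=> p _; rewrite lee_fin.
  - by rewrite lee_fin cubei_ge0.
rewrite E; apply: (@le_trans _ _ (\int[mu]_r (cubei c h r * Z)%:E)%E).
  apply: ge0_le_integral => //.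
  - move=> r _; rewrite mule_ge0 ?lee_fin ?cubei_ge0// integral_ge0// => p _.
    by rewrite lee_fin.
  - by apply: emeasurable_funM; [exact/measurable_EFinP|exact: mf2_inner].
  - by apply/measurable_EFinP; apply: measurable_funM.
  - by move=> r _; rewrite EFinM lee_wpmul2l// lee_fin cubei_ge0.
have iz : \int[mu]_r (cubei c h r * Z) = h ^+ d * Z.
  by rewrite RintegralZr// ?integral_cubei//; exact: integ_cubei.
rewrite -iz /Rintegral fineK//; apply: integrable_fin_num => //.
have := integ_bm (integ_cubei c h0) (bm_cst Z); exact.
Qed.

End shells.

Lemma DI_D (R : realType) d (F G : 'rV[R]_d -> 'rV[R]_d -> R) : mf2 F -> mf2 G ->
  (forall p r, 0 <= F p r) -> (forall p r, 0 <= G p r) ->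
  DI (fun p r => F p r + G p r) = (DI F + DI G)%E.
Proof.
move=> mF mG F0 G0.
have := @DI_sum R d bool [:: true; false] (fun b => if b then F else G) _ _.
rewrite big_cons big_cons big_nil adde0 => <-.
- by congr DI; apply/funext => p; apply/funext => r; rewrite !big_cons big_nil addr0.
- by case.
- by case.
Qed.

(** * Norms of bumps adapted to a cube *)

Section scaled_bumps.
Context {R : realType} {d : nat}.
Local Notation mu := (lebesgue_rV R d).
Variables (b : nat -> R -> R) (A : R) (k : nat).
Hypotheses (db : deriv_seq b) (bz : forall n t, t < -1 \/ 2 < t -> b n t = 0).
Hypotheses (A1 : 1 <= A) (bA : forall n t, (n <= k.+1)%N -> `|b n t| <= A).
Implicit Types (c : 'I_d -> R) (l : R) (s : seq 'I_d).

(** The n-th derivative of the bump carried by the interval [c i, c i + l]. *)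
Definition scaled c l (i : 'I_d) n t : R := l^-1 ^+ n * b n (l^-1 * (t - c i)).

Definition dbump c l s : 'rV[R]_d -> R := prodf (fun i => scaled c l i (count_mem i s)).

Lemma deriv_seq_scaled c l i : deriv_seq (scaled c l i).
Proof. exact: deriv_seq_scale. Qed.

Lemma scaled_outside c l i n t : 0 < l -> t < c i - l \/ c i + 2 * l < t -> scaled c l i n t = 0.
Proof.
move=> l0 tc; rewrite /scaled bz ?mulr0//.
case: tc => h; [left|right]; first by rewrite mulrC ltr_pdivrMr//; lra.
by rewrite mulrC ltr_pdivlMr//; lra.
Qed.

Lemma dbumpE c l s x : dbump c l s x =
  l^-1 ^+ size s * \prod_i b (count_mem i s) (l^-1 * (x ord0 i - c i)).
Proof. by rewrite /dbump /prodf big_split/= prod_count_mem. Qed.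

Let count_le (i : 'I_d) s : (size s <= k)%N -> (count_mem i s <= k)%N.
Proof. by move=> sk; rewrite (leq_trans (count_size _ _)). Qed.

Let A0 : 0 <= A. Proof. by rewrite (le_trans ler01). Qed.

(** The side is 4 l rather than 3 l because the half-open box must contain the closed support
    [c i - l, c i + 2 l]. *)
Local Notation box c l := (cubei (fun i => c i - l) (4 * l)).

Lemma dbump_le c l s x : 0 < l -> (size s <= k)%N ->
  `|dbump c l s x| <= l^-1 ^+ size s * A ^+ d * box c l x.
Proof.
move=> l0 sk; have l4 : 0 <= 4 * l by rewrite mulr_ge0// ltW.
rewrite cubeiE//; case: (boolP [forall i, _]) => [_|].
  rewrite mulr1 dbumpE normrM ger0_norm ?exprn_ge0 ?invr_ge0 ?(ltW l0)//.
  rewrite ler_wpM2l ?exprn_ge0 ?invr_ge0 ?(ltW l0)// normr_prod -[X in _ ^+ X]card_ord -prodr_const.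
  apply: ler_prod => i _; rewrite normr_ge0 bA//.
  by rewrite (leq_trans (count_le i sk)).
rewrite negb_forall => /existsP[i]; rewrite negb_and -leNgt -ltNge => xi.
rewrite mulr0 /dbump /prodf (bigD1 i)//= scaled_outside ?mul0r ?normr0//.
by case/orP: xi => h; [left|right]; lra.
Qed.

Lemma dbump_lipschitz c l s x y : 0 < l -> (size s <= k)%N ->
  `|dbump c l s x - dbump c l s y| <= l^-1 ^+ size s * (A ^+ d * (A * d%:R)) / l * enorm (x - y).
Proof.
move=> l0 sk; have m0 : 0 <= l^-1 by rewrite invr_ge0 ltW.
rewrite !dbumpE -mulrBr normrM ger0_norm ?exprn_ge0// -!mulrA ler_wpM2l ?exprn_ge0//.
have bk t i : `|b (count_mem i s) t| <= A by rewrite bA// (leq_trans (count_le i sk)).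
apply: (le_trans (@prod_lipschitz R 'I_d _ _ _ A A1 (fun i => bk _ i) (fun i => bk _ i))).
rewrite [size _](_ : _ = d); last by rewrite -[RHS]card_ord cardE enumT.
rewrite ler_wpM2l ?exprn_ge0//.
apply: (@le_trans _ _ (\sum_(i < d) A * (l^-1 * enorm (x - y)))).
  apply: ler_sum => i _.
  apply: (le_trans (@deriv_seq_lipschitz R b (count_mem i s) A _ _ db _)).
    by move=> t; rewrite bA// ltnS count_le.
  rewrite ler_wpM2l// -mulrBr normrM ger0_norm// ler_wpM2l//.
  have -> : x ord0 i - c i - (y ord0 i - c i) = x ord0 i - y ord0 i by ring.
  by have := coord_le_enorm (x - y) i; rewrite !mxE.
by rewrite sumr_const card_ord -[leLHS]mulr_natl mulrCA !mulrA.
Qed.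

Lemma integral_dbump c l s : 0 < l -> (size s <= k)%N ->
  (\int[mu]_x `|dbump c l s x|%:E <= (l^-1 ^+ size s * A ^+ d * (4 * l) ^+ d)%:E)%E.
Proof.
move=> l0 sk; have l4 : 0 <= 4 * l by rewrite mulr_ge0// ltW.
have mP : measurable_fun setT (dbump c l s).
  apply: measurable_prod => i _; apply: measurableT_comp; last exact: measurable_coord.
  by apply: continuous_measurable_fun; apply: deriv_seq_continuous; exact: deriv_seq_scaled.
have mB : measurable_fun setT (box c l : 'rV[R]_d -> R) := (bm_cubei _ l4).1.
apply: (@le_trans _ _ (\int[mu]_x (l^-1 ^+ size s * A ^+ d * box c l x)%:E)%E).
  apply: ge0_le_integral => //.
  - by apply/measurable_EFinP; exact: measurableT_comp.
  - by apply/measurable_EFinP; apply: measurable_funM.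
  - by move=> x _; rewrite lee_fin dbump_le.
rewrite -(integral_cubei (d := d) (fun i => c i - l) l4) -RintegralZl//; last exact: integ_cubei.
rewrite /Rintegral fineK//; apply: integrable_fin_num => //.
have := integ_bm (integ_cubei (d := d) (fun i => c i - l) l4) (bm_cst (l^-1 ^+ size s * A ^+ d)).
rewrite (_ : (fun x => _ * (_ * _)) = (fun x => l^-1 ^+ size s * A ^+ d * box c l x))//.
by apply/funext => x; rewrite mulrC.
Qed.

(** For fixed r, the sup bound at large distance and the Lipschitz bound at small distance feed
    [integral_shells] at the scale l of the bump. Integrating r over the box brings l^d, and
    symmetry handles the case of p in the box. *)
Lemma gagliardo_dbump (t : R) : 0 < t < 1 -> exists2 C, 0 <= C & forall c l s,
  0 < l -> size s = k ->
  (DI (fun p q => `|dbump c l s p - dbump c l s q| / enorm (p - q) `^ (t + d%:R))%R <=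
   (C * (l ^+ d * (l^-1 ^+ k * l `^ (- t))))%:E)%E.
Proof.
move=> t01; have [C C0 HC] := @integral_shells R d t t01.
pose B := A ^+ d * (A * d%:R); pose E := 2 * A ^+ d.
have B0 : 0 <= B by rewrite mulr_ge0 ?exprn_ge0// mulr_ge0.
have E0 : 0 <= E by rewrite mulr_ge0 ?exprn_ge0.
exists (2 * (4 ^+ d * (C * (E + B)))).
  by rewrite mulr_ge0// mulr_ge0 ?exprn_ge0// mulr_ge0// addr_ge0.
move=> c l s l0 sk; have sk' : (size s <= k)%N by rewrite sk.
have l4 : 0 <= 4 * l by rewrite mulr_ge0// ltW.
have m0 : 0 <= l^-1 ^+ k by rewrite exprn_ge0// invr_ge0 ltW.
set P := dbump c l s; pose F p q := `|P p - P q| / enorm (p - q) `^ (t + d%:R).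
have mP : measurable_fun setT P.
  apply: measurable_prod => i _; apply: measurableT_comp; last exact: measurable_coord.
  by apply: continuous_measurable_fun; apply: deriv_seq_continuous; exact: deriv_seq_scaled.
have F0 p q : 0 <= F p q by rewrite divr_ge0 ?powR_ge0.
have mF : mf2 F.
  apply: mf2_quotient; apply: measurableT_comp => //.
  by apply: measurable_funB; [exact: (mf2_fst_only mP)|exact: (mf2_snd_only mP)].
have Fs p q : F p q = F q p by rewrite /F distrC enorm_sym.
have Pb p : `|P p| <= l^-1 ^+ k * A ^+ d.
  rewrite -[leRHS]mulr1 -sk; apply: (le_trans (dbump_le c p l0 sk')).
  apply: ler_wpM2l; first by rewrite mulr_ge0 ?exprn_ge0// invr_ge0 ltW.
  by rewrite cubeiE// lern1 leq_b1.
pose Z := C * ((l^-1 ^+ k * E + l^-1 ^+ k * B / l * l) * l `^ (- t)).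
have FZ r : (\int[mu]_p (F p r)%:E <= Z%:E)%E.
  apply: (HC r (F ^~ r)) => //.
  - by rewrite mulr_ge0.
  - by rewrite divr_ge0 ?(ltW l0)// mulr_ge0.
  - exact: (mf2_fst r mF).
  - move=> p; rewrite /F ler_wpM2r ?invr_ge0 ?powR_ge0//.
    apply: (le_trans (ler_normB _ _)); rewrite /E mulrCA mulr2n mulrDl mul1r.
    by apply: lerD; exact: Pb.
  - move=> p; rewrite /F ler_wpM2r ?invr_ge0 ?powR_ge0//.
    by rewrite -sk; exact: dbump_lipschitz.
pose X r : R := box c l r.
have mX : measurable_fun setT X := (bm_cubei _ l4).1.
have X0 r : 0 <= X r by exact: cubei_ge0.
have X01 r : P r != 0 -> X r = 1.
  move=> Pr; have : 0 < `|P r| by rewrite normr_gt0.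
  move=> /lt_le_trans/(_ (dbump_le c r l0 sk')).
  rewrite /X cubeiE//; case: [forall i, _] => //=.
  by rewrite mulr0 ltxx.
pose G p r := X r * F p r; pose G' p r := X p * F p r.
have mG : mf2 G by apply: measurable_funM => //; exact: (mf2_snd_only mX).
have mG' : mf2 G' by apply: measurable_funM => //; exact: (mf2_fst_only mX).
have G0 p r : 0 <= G p r by exact: mulr_ge0.
have G0' p r : 0 <= G' p r by exact: mulr_ge0.
have loc : (DI G <= ((4 * l) ^+ d * Z)%:E)%E.
  exact: (@DI_localized R d F (fun i => c i - l) (4 * l) Z mF F0 l4 FZ).
(* The numerator vanishes unless p or r lies in the box. *)
apply: (@le_trans _ _ (DI (fun p r => (G p r + G' p r)%R))).
  apply: DI_le => //; first exact: measurable_funD.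
  move=> p r; rewrite /G /G'.
  have [Pr|/X01 ->] := eqVneq (P r) 0; last by rewrite mul1r lerDl mulr_ge0.
  have [Pp|/X01 ->] := eqVneq (P p) 0; last by rewrite mul1r lerDr mulr_ge0.
  by rewrite {1}/F Pr Pp subrr normr0 mul0r addr_ge0// mulr_ge0.
rewrite (DI_D mG mG' G0 G0').
have e : (fun p r => G' r p) = G.
  by apply/funext => p; apply/funext => r; rewrite /G /G' Fs.
have E1 : DI G' = DI G by rewrite (DI_swap mG' G0') e.
rewrite E1; apply: (le_trans (leeD loc loc)).
have ZE : Z = C * ((l^-1 ^+ k * E + l^-1 ^+ k * B) * l `^ (- t)).
  by rewrite /Z divfK ?gt_eqF.
have aux (x1 x2 x3 x4 x5 x6 x7 : R) :
    x1 * x6 * (x7 * ((x2 * x4 + x2 * x5) * x3)) + x1 * x6 * (x7 * ((x2 * x4 + x2 * x5) * x3)) =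
    2 * (x1 * (x7 * (x4 + x5))) * (x6 * (x2 * x3)) by ring.
rewrite -[leLHS]EFinD lee_fin ZE exprMn aux; exact: lexx.
Qed.

End scaled_bumps.

(** * Capacity of a compact set covered by weighted cubes *)

Section capacity.
Context {R : realType} {d : nat}.
Local Notation mu := (lebesgue_rV R d).

(** Twice the weighted sum of bumps is admissible, and its norm is at most the sum of the norms. A
    bump of side l costs a constant times l^(d - alpha): the top order scales exactly so, and the
    lower orders do because l <= L. *)
Lemma compact_cap_le (alpha L : R) : 0 < alpha -> 0 < L -> exists2 C, 0 <= C &
  forall (J : Type) (r : seq J) (w : J -> R) (c : J -> 'I_d -> R) (l : J -> R)
    (lo hi : 'I_d -> R) (K : set 'rV[R]_d),
  (forall j, 0 <= w j) -> (forall j, 0 < l j <= L) ->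
  (forall j i, lo i <= c j i - l j) -> (forall j i, c j i + 2 * l j <= hi i) ->
  (forall i, lo i < hi i) ->
  (forall x, K x -> 1 <= \sum_(j <- r) w j * cubei (c j) (l j) x) ->
  (compact_cap alpha K <= (C * \sum_(j <- r) w j * (l j ^+ d * l j `^ (- alpha)))%:E)%E.
Proof.
move=> a0 L0; pose k := Num.truncn alpha; pose theta := alpha - k%:R.
have /andP[ka ak] : k%:R <= alpha < k.+1%:R by apply: truncn_itv; exact: ltW.
have [b db [b0 b1 bz bM]] := @bump R.
have /choice[M HM] := bM.
pose A := 1 + \sum_(n < k.+2) `|M n|.
have A1 : 1 <= A by rewrite lerDl sumr_ge0.
have bA n t : (n <= k.+1)%N -> `|b n t| <= A.
  move=> nk; rewrite (le_trans (HM n t))// (le_trans (ler_norm _))//.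
  rewrite /A (bigD1 (Ordinal (nk : (n < k.+2)%N)))//= addrCA lerDl addr_ge0// sumr_ge0//.
pose cost l : R := l ^+ d * l `^ (- alpha).
(* At order i, l^-i = l^-alpha l^(alpha - i), and the last power is at most L^(alpha - i). *)
pose D1 := A ^+ d * 4 ^+ d * \sum_(i < k.+1) L `^ (alpha - i%:R).
have A0 : 0 <= A by rewrite (le_trans ler01).
have D10 : 0 <= D1.
  by rewrite mulr_ge0 ?mulr_ge0 ?exprn_ge0// sumr_ge0// => i _; exact: powR_ge0.
have cost0 l : 0 < l -> 0 <= cost l by move=> l0; rewrite mulr_ge0 ?powR_ge0// exprn_ge0 ?ltW.
have intP (c : 'I_d -> R) l s : 0 < l <= L -> (size s <= k)%N ->
    (\int[mu]_x `|dbump b c l s x|%:E <= (D1 * cost l)%:E)%E.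
  move=> /andP[l0 lL] sk; apply: (le_trans (integral_dbump db bz bA c l0 sk)).
  rewrite lee_fin exprMn /D1 /cost.
  have -> : l^-1 ^+ size s = l `^ (- alpha) * l `^ (alpha - (size s)%:R).
    rewrite -powRD ?(gt_eqF l0) ?implybT// addKr powRN powR_mulrn ?(ltW l0)//.
    by rewrite exprVn.
  have : l `^ (alpha - (size s)%:R) <= \sum_(i < k.+1) L `^ (alpha - i%:R).
    apply: (@le_trans _ _ (L `^ (alpha - (size s)%:R))).
      apply: ge0_ler_powR; rewrite ?nnegrE ?(ltW l0) ?(ltW L0)//.
      by rewrite subr_ge0 (le_trans _ ka)// ler_nat.
    rewrite (bigD1 (Ordinal (sk : (size s < k.+1)%N)))//= lerDl sumr_ge0// => i _.
    exact: powR_ge0.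
  set S := \sum_(i < k.+1) _ => h.
  rewrite [leLHS](_ : _ = A ^+ d * 4 ^+ d * (l ^+ d * l `^ (- alpha)) * l `^ (alpha - (size s)%:R)); last ring.
  rewrite [leRHS](_ : _ = A ^+ d * 4 ^+ d * (l ^+ d * l `^ (- alpha)) * S); last ring.
  by rewrite ler_wpM2l// mulr_ge0 ?cost0// mulr_ge0 ?exprn_ge0.
have [D2 D20 gagP] : exists2 D2, 0 <= D2 & theta != 0 -> forall (c : 'I_d -> R) l s, 0 < l -> size s = k ->
    (DI (fun p q => `|dbump b c l s p - dbump b c l s q| / enorm (p - q) `^ (theta + d%:R))%R <=
    (D2 * cost l)%:E)%E.
  have [t0|tn0] := eqVneq theta 0; first by exists 0.
  have t01 : 0 < theta < 1.
    rewrite lt_neqAle eq_sym tn0 subr_ge0 ka/= ltrBlDr.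
    by rewrite -natr1 in ak; lra.
  have [C C0 HC] := @gagliardo_dbump R d b A k db bz A1 bA theta t01.
  exists C => // _ c l s l0 sk; apply: (le_trans (HC c l s l0 sk)).
  rewrite lee_fin /cost ler_wpM2l// ler_wpM2l ?exprn_ge0 ?(ltW l0)//.
  rewrite le_eqVlt; apply/orP; left; apply/eqP.
  rewrite exprVn -powR_mulrn ?(ltW l0)// -powRN -powRD ?(gt_eqF l0) ?implybT//.
  by congr (_ `^ _); rewrite /theta; ring.
pose D := \sum_(i < k.+1) \sum_(s : i.-tuple 'I_d) D1 + \sum_(s : k.-tuple 'I_d) D2.
have D0 : 0 <= D by rewrite addr_ge0 ?sumr_ge0// => i _; rewrite sumr_ge0.
exists (D * 2); first by rewrite mulr_ge0.
move=> J r w c l lo hi K w0 lL loc hic lohi Kw.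
have l0 j : 0 < l j by case/andP: (lL j).
pose H j := scaled b (c j) (l j).
have dH j i : deriv_seq (H j i) by exact: deriv_seq_scaled.
have H0 j i n t : t < lo i \/ hi i < t -> H j i n t = 0.
  move=> h; apply: (scaled_outside bz) => //; have := loc j i; have := hic j i.
  by case: h => ? ? ?; [left|right]; lra.
(* Admissibility asks for values strictly above 1 on K, while the hypothesis gives at least 1. *)
pose w2 j := 2 * w j.
have w20 j : 0 <= w2 j by rewrite mulr_ge0.
have combE s x : comb w2 H r s x = \sum_(j <- r) w2 j * dbump b (c j) (l j) s x by [].
pose S := \sum_(j <- r) w2 j * cost (l j).
have S0 : 0 <= S by rewrite sumr_ge0// => j _; rewrite mulr_ge0 ?cost0.
have mP j s : measurable_fun setT (dbump b (c j) (l j) s).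
  apply: measurable_prod => i _; apply: measurableT_comp; last exact: measurable_coord.
  by apply: continuous_measurable_fun; apply: deriv_seq_continuous; exact: deriv_seq_scaled.
have mC s : measurable_fun setT (comb w2 H r s).
  by apply: measurable_sum => j; apply: measurable_funM => //; exact: mP.
have int_comb s : (size s <= k)%N -> (\int[mu]_x `|comb w2 H r s x|%:E <= (D1 * S)%:E)%E.
  move=> sk; pose f j x : \bar R := (w2 j * `|dbump b (c j) (l j) s x|)%:E.
  have mf j : measurable_fun setT (f j).
    by apply/measurable_EFinP; apply: measurable_funM => //; exact: measurableT_comp.
  have f0 j x : setT x -> (0 <= f j x)%E by rewrite lee_fin mulr_ge0.
  apply: (@le_trans _ _ (\int[mu]_x (\sum_(j <- r) f j x))%E).
    apply: ge0_le_integral => //.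
    - by apply/measurable_EFinP; exact: measurableT_comp.
    - by apply: emeasurable_sum.
    move=> x _; rewrite sumEFin lee_fin combE (le_trans (ler_norm_sum _ _ _))//.
    by apply: ler_sum => j _; rewrite normrM ger0_norm.
  rewrite (ge0_integral_sum mu measurableT mf f0) /S mulr_sumr -sumEFin.
  apply: lee_sum => j _; rewrite /f.
  rewrite (eq_integral (fun x => (w2 j)%:E * `|dbump b (c j) (l j) s x|%:E)%E)//.
  have mg : measurable_fun setT (fun x => `|dbump b (c j) (l j) s x|%:E).
    by apply/measurable_EFinP; exact: measurableT_comp.
  have g0 x : setT x -> (0 <= `|dbump b (c j) (l j) s x|%:E)%E by rewrite lee_fin.
  have wj0 : (0 <= (w2 j)%:E)%E by rewrite lee_fin.
  rewrite (ge0_integralZl mu measurableT mg g0 wj0).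
  have -> : (D1 * (w2 j * cost (l j)))%:E = ((w2 j)%:E * (D1 * cost (l j))%:E)%E.
    by rewrite -[RHS]EFinM mulrCA.
  apply: lee_wpmul2l; first by rewrite lee_fin.
  exact: intP.
have gag_comb s : theta != 0 -> size s = k ->
    (DI (fun p q => `|comb w2 H r s p - comb w2 H r s q| / enorm (p - q) `^ (theta + d%:R))%R <=
     (D2 * S)%:E)%E.
  move=> tn0 sk.
  pose f j p q := `|dbump b (c j) (l j) s p - dbump b (c j) (l j) s q| / enorm (p - q) `^ (theta + d%:R).
  have mf j : mf2 (f j).
    apply: mf2_quotient; apply: measurableT_comp => //.
    by apply: measurable_funB; [exact: (mf2_fst_only (mP j s))|exact: (mf2_snd_only (mP j s))].
  have f0 j p q : 0 <= f j p q by rewrite divr_ge0 ?powR_ge0.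
  have mwf j : mf2 (fun p q => w2 j * f j p q) by apply: measurable_funM => //; exact: mf.
  apply: (@le_trans _ _ (DI (fun p q => \sum_(j <- r) w2 j * f j p q)%R)).
    apply: DI_le.
    - apply: mf2_quotient; apply: measurableT_comp => //.
      by apply: measurable_funB; [exact: (mf2_fst_only (mC s))|exact: (mf2_snd_only (mC s))].
    - by apply: measurable_sum => j; exact: mwf.
    - by move=> p q; rewrite divr_ge0 ?powR_ge0.
    move=> p q; rewrite !combE -sumrB.
    have -> : \sum_(j <- r) w2 j * f j p q =
        (\sum_(j <- r) w2 j * `|dbump b (c j) (l j) s p - dbump b (c j) (l j) s q|) /
        enorm (p - q) `^ (theta + d%:R).
      by rewrite mulr_suml; apply: eq_bigr => j _; rewrite /f mulrA.
    rewrite ler_wpM2r ?invr_ge0 ?powR_ge0// (le_trans (ler_norm_sum _ _ _))//.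
    by apply: ler_sum => j _; rewrite -mulrBr normrM ger0_norm.
  rewrite DI_sum//; last by move=> j p q; rewrite mulr_ge0.
  rewrite /S mulr_sumr -sumEFin; apply: lee_sum => j _.
  have -> : (D2 * (w2 j * cost (l j)))%:E = ((w2 j)%:E * (D2 * cost (l j))%:E)%E.
    by rewrite -[RHS]EFinM mulrCA.
  rewrite DI_Z//; apply: lee_wpmul2l; first by rewrite lee_fin.
  exact: gagP.
have box1 j x : cubei (c j) (l j) x <= dbump b (c j) (l j) [::] x.
  rewrite cubeiE ?(ltW (l0 j))//; rewrite /dbump /prodf.
  have P0 : 0 <= \prod_i scaled b (c j) (l j) i (count_mem i [::]) (x ord0 i).
    by apply: prodr_ge0 => i _; rewrite /scaled expr0 mul1r.
  case: (boolP [forall i, _]) => // /forallP xc.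
  rewrite big1// => i _; rewrite /scaled expr0 mul1r b1//.
  have /andP[h1 h2] := xc i; rewrite mulr_ge0 ?invr_ge0 ?(ltW (l0 j)) ?subr_ge0//=.
  by rewrite mulrC ler_pdivrMr// mul1r; lra.
have adm : [/\ test_function (comb w2 H r [::]), forall x, 0 <= comb w2 H r [::] x &
    forall x, K x -> 1 < comb w2 H r [::] x].
  split.
  - exact: (test_comb w2 dH H0 r).
  - move=> x; rewrite combE; apply: sumr_ge0 => j _; apply: mulr_ge0 => //.
    by apply: le_trans (box1 j x); apply: cubei_ge0; exact: ltW.
  move=> x /Kw h; apply: (@lt_le_trans _ _ (2 * \sum_(j <- r) w j * cubei (c j) (l j) x)).
    by lra.
  rewrite combE mulr_sumr; apply: ler_sum => j _.
  by rewrite mulrA -/(w2 j); apply: ler_wpM2l; [exact: w20|exact: box1].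
apply: ge_ereal_inf; exists (sobolev_norm alpha (comb w2 H r [::])); first by exists (comb w2 H r [::]).
apply: (le_trans (sobolev_norm_comb w2 dH lohi H0 r alpha)).
have -> : D * 2 * (\sum_(j <- r) w j * (l j ^+ d * l j `^ (- alpha))) = D * S.
  rewrite -mulrA; congr (_ * _); rewrite mulr_sumr; apply: eq_bigr => j _.
  by rewrite /w2 /cost; ring.
rewrite /D mulrDl EFinD; apply: leeD.
  rewrite mulr_suml -sumEFin; apply: lee_sum => i _.
  rewrite mulr_suml -sumEFin; apply: lee_sum => s _.
  by apply: int_comb; rewrite size_tuple -ltnS.
rewrite -/k -/theta; case: (eqVneq theta 0) => [_|tn0].
  by rewrite lee_fin mulr_ge0// sumr_ge0.
rewrite mulr_suml -sumEFin; apply: lee_sum => s _.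
by apply: gag_comb => //; rewrite size_tuple.
Qed.

End capacity.

(** * Points of R^d and the grid cells containing them *)

Section cells.
Context {R : realType} {d : nat}.
Variables (c0 : 'I_d -> R) (L : R) (T n : nat).
Hypothesis L0 : 0 < L.
Implicit Types (z y : grid d T n) (p : 'rV[R]_d).

Local Notation h := (msh L n).

Definition in_cell z p := forall a, c0 a + (z a)%:R * h <= p ord0 a < c0 a + (z a)%:R * h + h.

Let h0 : 0 < h. Proof. exact: msh_gt0. Qed.

Lemma cubei_in_cell z p : in_cell z p -> cubei (sub c0 h z) h p = 1.
Proof.
move=> zp; rewrite cubeiE ?(ltW h0)// (_ : [forall i, _] = true)//.
by apply/forallP => a; exact: zp.
Qed.

Lemma size_grid : (T * 2 ^ n)%:R * h = T%:R * L.
Proof. by rewrite /msh natrM -mulrA [X in _ * X]mulrCA mulfV ?mulr1// pnatr_eq0 expn_eq0. Qed.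

Lemma exists_cell p : (forall a, c0 a <= p ord0 a < c0 a + T%:R * L) -> exists z, in_cell z p.
Proof.
move=> pbox; have p1 : cubei c0 ((T * 2 ^ n)%:R * h) p = 1.
  have hh : 0 <= (T * 2 ^ n)%:R * h by rewrite mulr_ge0 ?ler0n// ltW.
  rewrite (cubeiE c0 p hh) (_ : [forall i, _] = true)//.
  by apply/forallP => a; rewrite size_grid.
have [|z [_ /(_ z)]] := @sub_cell R d c0 h (T * 2 ^ n) p (ltW h0); first by rewrite p1 oner_neq0.
rewrite eqxx cubeiE ?(ltW h0)// => zE; exists z => a.
by move: zE; case: forallP => [zp _|_ /eqP]; [exact: zp|rewrite eq_sym oner_eq0].
Qed.

Lemma near_cells i z z' p p' : (i <= n)%N -> in_cell z p -> in_cell z' p' ->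
  (forall a, `|p ord0 a - p' ord0 a| < msh L i) -> near_cell i z z'.
Proof.
move=> iln zp zp' pp'; pose S := side n i.
have S0 : (0 < S)%N by exact: side_gt0.
have aux (c x x' : R) (m m' : nat) : c + m%:R * h <= x < c + m%:R * h + h ->
    c + m'%:R * h <= x' < c + m'%:R * h + h -> `|x - x'| < S%:R * h ->
    (m %/ S <= (m' %/ S).+1)%N.
  move=> /andP[x1 x2] /andP[x3 x4]; rewrite ltr_norml => /andP[x5 x6].
  have : m%:R * h < (m' + S).+1%:R * h by rewrite -natr1 natrD !mulrDl mul1r; lra.
  rewrite ltr_pM2r// ltr_nat ltnS => mS.
  by rewrite (leq_trans (leq_div2r _ mS))// divnDr// divnn S0 addn1.
apply/forallP => a; have := pp' a; rewrite -(side_msh _ iln) => ppa.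
by rewrite (aux _ _ _ _ _ (zp a) (zp' a) ppa) (aux _ _ _ _ _ (zp' a) (zp a)) 1?distrC.
Qed.

Lemma cubei_corner j z p : (j <= n)%N -> in_cell z p -> cubei (corner c0 L j z) (msh L j) p = 1.
Proof.
move=> jn zp; apply/le_anti/andP; split.
  by rewrite cubeiE ?msh_ge0// lern1 leq_b1.
rewrite -cell_sum// (bigD1 z) ?same_cell_refl//= cubei_in_cell// lerDl.
by apply: sumr_ge0 => y _; apply: cubei_ge0; exact: ltW.
Qed.

Lemma corner_same_cell j z z' : same_cell j z z' -> corner c0 L j z = corner c0 L j z'.
Proof. by move=> /same_cellP zz; apply/funext => a; rewrite /corner zz. Qed.

End cells.

(** * Capacity of a superlevel set through stopping cells *)

Section stopping.
Context {R : realType} {d : nat}.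

(* A point of K lies in the cell of level j at which the partial sums of Lam
   first exceed tau; the bumps of these stopping cells cover K. *)
Lemma stopping_cap (alpha L : R) : 0 < alpha -> 0 < L -> exists2 C, 0 <= C &
  forall (T n : nat) (c0 : 'I_d -> R) (Lam : nat -> grid d T n -> R) (tau : R) (K : set 'rV[R]_d),
  0 <= tau -> (forall j x, 0 <= Lam j x) -> (forall j x y, same_cell j x y -> Lam j x = Lam j y) ->
  (forall p, K p -> exists2 z, in_cell c0 L z p & tau < \sum_(j < n.+1) Lam j z) ->
  (compact_cap alpha K <= (C * (msh L n ^+ d * \sum_(j < n.+1) (2 `^ alpha) ^+ j *
     \sum_x ((\sum_(i < j) Lam i x <= tau)%R && (tau < \sum_(i < j.+1) Lam i x)%R)%:R))%:E)%E.
Proof.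
move=> a0 L0; have [C C0 HC] := @compact_cap_le R d alpha L a0 L0.
exists (C * L `^ (- alpha)); first by rewrite mulr_ge0 ?powR_ge0.
move=> T n c0 Lam tau K tau0 Lam0 Lami Kz.
have h0 := msh_gt0 L0 n.
pose S j x := \sum_(i < j) Lam i x.
pose stop j x := (S j x <= tau) && (tau < S j.+1 x).
pose cs j : R := ((2 ^ d) ^ (n - j))%:R.
have cs0 j : 0 < cs j by rewrite ltr0n expn_gt0 expn_gt0.
(* The sum runs over finest cells, so a stopping cell of level j is counted [cs j] times; the weight
   1 / [cs j] makes it count once. *)
pose w (jx : 'I_n.+1 * grid d T n) := (stop jx.1 jx.2)%:R * (cs jx.1)^-1.
have Sinv j x y : (j <= n)%N -> same_cell j x y -> S j.+1 x = S j.+1 y /\ S j x = S j y.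
  move=> jn xy; have e i : (i <= j)%N -> Lam i x = Lam i y.
    by move=> ij; apply: Lami; apply: same_cell_le xy; rewrite ij.
  by split; apply: eq_bigr => i _; apply: e; [rewrite -ltnS|rewrite ltnW].
have stopi j x y : (j <= n)%N -> same_cell j x y -> stop j x = stop j y.
  by move=> jn /(Sinv _ _ _ jn)[e1 e2]; rewrite /stop e1 e2.
(* The bumps extend beyond the grid by at most one cell side of level 0, for which the margins in
   the last box allow. *)
have := HC _ (index_enum ('I_n.+1 * grid d T n)%type) w (fun jx => corner c0 L jx.1 jx.2)
  (fun jx => msh L jx.1) (fun a => c0 a - L) (fun a => c0 a + (T%:R + 2) * L) K.
have mshL j : 0 < msh L j <= L.
  rewrite msh_gt0//= /msh ler_pdivrMr ?ltr0n ?expn_gt0// ler_peMr ?(ltW L0)//.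
  by rewrite ler1n expn_gt0.
have T0 : 0 <= T%:R :> R by exact: ler0n.
move=> HH; apply: (le_trans (HH _ _ _ _ _ _)).
- by move=> jx; rewrite /w mulr_ge0 ?invr_ge0 ?(ltW (cs0 _)).
- by move=> jx; exact: mshL.
- move=> [j x] a /=; have /andP[_ h1] := mshL j; rewrite /corner.
  have : 0 <= (x a %/ side n j)%:R * msh L j by rewrite mulr_ge0 ?msh_ge0.
  by lra.
- move=> [j x] a /=.
  have jn : (j <= n)%N by rewrite -ltnS.
  have : (x a %/ side n j)%:R * msh L j <= T%:R * L.
    rewrite -(side_msh _ jn) mulrA -natrM -(size_grid L T n) ler_wpM2r ?(ltW h0)// ler_nat.
    by rewrite (leq_trans (leq_trunc_div _ _))// ltnW.
  have /andP[_] := mshL j; rewrite /corner => h1 h2.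
  by rewrite !mulrDl; lra.
- move=> a; have TL : 0 <= T%:R * L by rewrite mulr_ge0// ltW.
  by rewrite mulrDl; lra.
- move=> p /Kz[z zp tz].
  have ex : exists j, tau < S j.+1 z by exists n.
  case: (ex_minnP ex) => j tj jmin.
  have jn : (j < n.+1)%N by rewrite ltnS; apply: jmin.
  have sj : stop j z.
    (* At level 0 the preceding partial sum is empty and does not exceed tau because tau >= 0. *)
    rewrite /stop tj andbT; case: j tj jmin jn => [|j] tj jmin jn.
      by rewrite /S big_ord0.
    by rewrite leNgt; apply/negP => /jmin; rewrite ltnn.
  pose F (j : 'I_n.+1) x := w (j, x) * cubei (corner c0 L j x) (msh L j) p.
  rewrite (_ : \sum_(jx <- _) _ = \sum_(j < n.+1) \sum_x F j x); last first.
    by rewrite pair_bigA/=; apply: eq_bigr => -[].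
  have F0 i x : 0 <= F i x.
    rewrite mulr_ge0 ?cubei_ge0 ?msh_ge0// /w mulr_ge0// invr_ge0 ltW//.
  rewrite (bigD1 (Ordinal jn))//= (bigID (same_cell j z))/=.
  rewrite (eq_bigr (fun=> (cs j)^-1)) => [|x zx]; last first.
    rewrite /F /w/= -(stopi _ _ _ _ zx)// sj mul1r -(corner_same_cell _ _ zx).
    by rewrite cubei_corner ?mulr1.
  rewrite (eq_bigl (mem [pred x | same_cell j z x]))// sumr_const card_same_cell//.
  rewrite -[X in X + _ + _]mulr_natl mulfV ?gt_eqF// -addrA lerDl.
  by rewrite addr_ge0// ?sumr_ge0// => i _; rewrite sumr_ge0.
rewrite lee_fin -mulrA ler_wpM2l// le_eqVlt; apply/orP; left; apply/eqP.
transitivity (\sum_(j < n.+1) \sum_x (stop j x)%:R * (cs j)^-1 * (msh L j ^+ d * msh L j `^ (- alpha))).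
  by rewrite pair_bigA/=; apply: eq_bigr => -[].
rewrite mulrA mulr_sumr; apply: eq_bigr => j _; rewrite mulrA mulr_sumr; apply: eq_bigr => x _.
have jn : (j <= n)%N by rewrite -ltnS.
(* A cell of level j has the volume of [cs j] finest cells, which cancels the weight; side^-alpha is
   q^j up to the constant L^-alpha. *)
have e1 : msh L j ^+ d = cs j * msh L n ^+ d.
  rewrite -(side_msh _ jn) exprMn /cs -natrX; congr (_%:R * _).
  by rewrite /side -!expnM mulnC.
have e2 : msh L j `^ (- alpha) = L `^ (- alpha) * (2 `^ alpha) ^+ j.
  have e3 : (2^-1 : R) `^ (- alpha) = 2 `^ alpha by rewrite -powR_inv1// -powRrM mulN1r opprK.
  by rewrite mshE powR_geo ?invr_gt0// e3.
rewrite e1 e2 /stop /S.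
have cn : cs j != 0 by rewrite gt_eqF.
have aux (b x1 x2 x3 e f : R) : e * f = 1 -> b * e * (f * x1 * (x2 * x3)) = x2 * x1 * x3 * b.
  move=> ef; transitivity (b * (e * f) * x1 * x2 * x3); first by ring.
  by rewrite ef; ring.
by apply: aux; exact: mulVf.
Qed.

End stopping.

(** * Averages over balls against means over neighbouring cells *)

Section balls.
Context {R : realType} {d : nat}.
Local Notation mu := (lebesgue_rV R d).
Implicit Types (x p y : 'rV[R]_d).

Lemma measurable_eball x r : measurable (eball x r).
Proof.
have m : measurable_fun setT (fun y => enorm (y - x)) by exact: (mf2_fst x mf2_enorm).
have := m measurableT _ (measurable_itv `]-oo, r[).
by rewrite setTI.
Qed.

(** The Euclidean norm is at most d times the largest coordinate, and d / (d + 1) < 1 makes the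
    inclusion strict. *)
Lemma cube_eball x r : 0 < r ->
  cube (fun a => x ord0 a - r / d.+1%:R) (2 * (r / d.+1%:R)) `<=` eball x r.
Proof.
move=> r0 y yc; have D0 : 0 < d.+1%:R :> R by [].
have s0 : 0 <= r / d.+1%:R by rewrite divr_ge0 ?(ltW r0).
apply: (@le_lt_trans _ _ (d%:R * (r / d.+1%:R))).
  move: s0 yc; set s := r / d.+1%:R => s0 yc; clearbody s.
  apply: enorm_le => // a; have /andP[y1 y2] := yc a.
  by rewrite !mxE ler_norml; apply/andP; split; lra.
by rewrite mulrCA gtr_pMr// ltr_pdivrMr// mul1r ltr_nat.
Qed.

Lemma eball_cube x r : eball x r `<=` cube (fun a => x ord0 a - r) (2 * r).
Proof.
move=> y yb a; have := le_lt_trans (coord_le_enorm (y - x) a) yb.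
by rewrite !mxE ltr_norml => /andP[? ?]; apply/andP; split; lra.
Qed.

Lemma measure_eball x r : 0 < r -> exists2 m : R, (2 * (r / d.+1%:R)) ^+ d <= m & mu (eball x r) = m%:E.
Proof.
move=> r0; have s0 : 0 <= 2 * (r / d.+1%:R) by rewrite mulr_ge0// divr_ge0// ltW.
have r20 : 0 <= 2 * r by rewrite mulr_ge0// ltW.
have mB := measurable_eball x r.
have up : (mu (eball x r) <= ((2 * r) ^+ d)%:E)%E.
  rewrite -(mu_cube (fun a => x ord0 a - r) r20); apply: le_measure; rewrite ?inE//.
    exact: measurable_cube.
  exact: eball_cube.
have dn : (((2 * (r / d.+1%:R)) ^+ d)%:E <= mu (eball x r))%E.
  rewrite -(mu_cube (fun a => x ord0 a - r / d.+1%:R) s0); apply: le_measure; rewrite ?inE//.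
    exact: measurable_cube.
  exact: cube_eball.
have f : mu (eball x r) \is a fin_num.
  by rewrite ge0_fin_numE// (le_lt_trans up)// ltry.
exists (fine (mu (eball x r))); last by rewrite fineK.
by rewrite -lee_fin fineK.
Qed.

(** The ball of radius r contains a cube of side 2 r / (d + 1). With a mesh of at most 4 r, its
    volume is at least kappa times that of a cell. *)
Definition kappa : R := (2 * d.+1%:R)^-1 ^+ d.

Lemma kappa_gt0 : 0 < kappa.
Proof. by rewrite exprn_gt0// invr_gt0 mulr_gt0. Qed.

(* The ball B_r(x) is covered by the cells near p when the mesh at level i is
   comparable to the diameter 2 r. *)
Lemma maximal_near_cells (u : 'rV[R]_d -> R) delta t x :
  integ mu u -> 0 < delta -> 0 <= t -> (t%:E < local_maximal delta u x)%E ->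
  exists2 r, 0 < r & exists N, forall n p, (N <= n)%N -> (forall a, `|p ord0 a - x ord0 a| < r) ->
    exists i, (i <= n)%N /\ exists2 z : grid d (2 * n) n,
      in_cell (fun=> - (n%:R * (2 * delta))) (2 * delta) z p &
      t * kappa * msh (2 * delta) n ^+ d <
      mean n (2 ^ d) (@near_cell d (2 * n) n) i
        (fcell (fun=> - (n%:R * (2 * delta))) (2 * delta) (fun y => `|u y|)) z.
Proof.
move=> iu dl0 t0 /ereal_sup_gt[_ [r /= + <-]]; rewrite in_itv/= => /andP[r0 rd].
have [m mge ->] := measure_eball x r0.
have rD0 : 0 < r / d.+1%:R by rewrite divr_gt0.
have m0 : 0 < m by rewrite (lt_le_trans _ mge)// exprn_gt0// mulr_gt0.
have iau := integ_norm iu; have mB := measurable_eball x r.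
have bB : bm (\1_(eball x r) : 'rV[R]_d -> R) by exact: bm_indic.
set a := II mu (fun y => `|u y|) (\1_(eball x r)).
have -> : (\int[mu]_(y in eball x r) `|u y|%:E)%E = a%:E.
  rewrite /a /II /Rintegral fineK; last first.
    by apply: integrable_fin_num => //; exact: (integ_bm iau bB).
  rewrite [LHS]integral_mkcond; apply: eq_integral => y _.
  rewrite patchE indicE; case: ifPn => yB /=; first by rewrite mulr1.
  by rewrite mulr0.
have -> : (m%:E^-1 = (m^-1)%:E)%E by rewrite /inve gt_eqF.
rewrite -EFinM lte_fin mulrC ltr_pdivlMr// => tma.
pose L := 2 * delta; have L0 : 0 < L by rewrite mulr_gt0.
have r20 : 0 < 2 * r by rewrite mulr_gt0.
(* This level satisfies 2 r <= msh L i <= 4 r. It exists because r <= delta and L = 2 delta. Two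
   points within r of x, coordinate by coordinate, then lie in neighbouring cells. *)
have [|i] := @dyadic_bracket R (L / (2 * r)).
  by rewrite ler_pdivlMr// mul1r ler_pM2l.
rewrite ler_pdivlMr// ltr_pdivrMr// => /andP[i1 i2].
have ri : 2 * r <= msh L i by rewrite /msh natrX ler_pdivlMr ?exprn_gt0// mulrC.
have ri' : msh L i <= 4 * r.
  rewrite /msh natrX ler_pdivrMr ?exprn_gt0// (le_trans (ltW i2))// exprS.
  by rewrite le_eqVlt; apply/orP; left; apply/eqP; ring.
(* For n at least this bound, the box [-n L, n L)^d contains every point whose coordinates are
   within r of those of x. *)
pose B := (\sum_b `|x ord0 b| + 2 * r) / L.
have B0 : 0 <= B by rewrite divr_ge0 ?(ltW L0)// addr_ge0 ?sumr_ge0// ltW.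
exists r => //; exists (maxn i (Num.bound B)) => n p; rewrite geq_max => /andP[lin Bn] px.
rewrite -/L; pose c0 : 'I_d -> R := fun=> - (n%:R * L); rewrite -/c0.
have nL : \sum_b `|x ord0 b| + 2 * r < n%:R * L.
  rewrite -ltr_pdivrMr// (lt_le_trans (archi_boundP B0))// ler_nat//.
have inbox (y : 'rV[R]_d) : (forall b, `|y ord0 b - x ord0 b| < r) -> exists z : grid d (2 * n) n, in_cell c0 L z y.
  move=> yx; apply: exists_cell => // b; have := yx b.
  have xb : `|x ord0 b| <= \sum_b `|x ord0 b| by rewrite (bigD1 b)//= lerDl sumr_ge0.
  move: xb; rewrite /c0 natrM ltr_norml ler_norml => /andP[x1 x2] /andP[y1 y2].
  by apply/andP; split; lra.
have [z zp] := inbox p px.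
exists i; split => //; exists z => //.
have h0 := msh_gt0 L0 n; have h0' := ltW h0.
have cs0 : 0 < csize R n (2 ^ d) i by rewrite ltr0n expn_gt0 expn_gt0.
rewrite /mean [ltRHS]mulrC ltr_pdivlMr//.
apply: (@le_lt_trans _ _ (t * m)).
  rewrite -[X in X <= _]mulrA -[X in X <= _]mulrA ler_wpM2l//; apply: le_trans mge.
  have e : csize R n (2 ^ d) i * msh L n ^+ d = msh L i ^+ d.
    have cE : ((2 ^ d) ^ (n - i))%N = (side n i ^ d)%N by rewrite /side -!expnM mulnC.
    by rewrite /csize cE natrX -exprMn (side_msh _ lin).
  rewrite [_ * csize _ _ _ _]mulrC e /kappa -exprMn.
  have s1 : 0 <= (2 * d.+1%:R)^-1 * msh L i.
    by apply: mulr_ge0; [rewrite invr_ge0 mulr_ge0|exact: msh_ge0].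
  have s2 : 0 <= 2 * (r / d.+1%:R) by apply: mulr_ge0 => //; exact: ltW.
  apply: lerXn2r; [exact: s1|exact: s2|].
  have e2 : (2 * d.+1%:R)^-1 * msh L i = msh L i / 2 / d.+1%:R.
    by rewrite invfM [LHS]mulrC mulrA.
  rewrite e2 [leRHS]mulrA ler_pM2r ?invr_gt0//.
  by lra.
apply: (lt_le_trans tma).
rewrite -big_filter /fcell -II_sum//; last by move=> y; exact: bm_cubei.
apply: II_le => //.
  by apply: bm_sum => y _; exact: bm_cubei.
move=> y; rewrite indicE; case: (boolP (y \in _)) => [yB|_]; last first.
  by apply: sumr_ge0 => w _; exact: cubei_ge0.
have yx b : `|y ord0 b - x ord0 b| < r.
  move: yB; rewrite inE => yB; apply: le_lt_trans yB.
  by have := coord_le_enorm (y - x) b; rewrite !mxE.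
have [zy hzy] := inbox y yx.
rewrite big_filter (bigD1 zy)/=; last first.
  apply: (near_cells L0 lin zp hzy) => b; apply: lt_le_trans ri.
  rewrite (_ : _ - _ = (p ord0 b - x ord0 b) - (y ord0 b - x ord0 b)); last by ring.
  by apply: (le_lt_trans (ler_normB _ _)); rewrite mulr2n mulrDl mul1r ltrD.
rewrite cubei_in_cell// lerDl; apply: sumr_ge0 => w _; exact: cubei_ge0.
Qed.

End balls.

(** The integral of a nonnegative function is a supremum over the simple functions below it, hence
    monotone. It is applied to the map from t to the capacity of the superlevel set, which is
    dominated by a measurable function of t. *)
Lemma ge0_le_integral_dominated dsp (T : measurableType dsp) (R : realType)
    (m : {measure set T -> \bar R}) (D : set T) (f g : T -> \bar R) :
  (forall x, D x -> (0 <= f x)%E) -> (forall x, D x -> (f x <= g x)%E) ->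
  (\int[m]_(x in D) f x <= \int[m]_(x in D) g x)%E.
Proof.
move=> f0 fg; have g0 x : D x -> (0 <= g x)%E by move=> Dx; rewrite (le_trans (f0 x Dx))// fg.
rewrite !ge0_integralE//; apply: ereal_sup_le => _ [h hf <-]; exists h => // x.
apply: (le_trans (hf x)); rewrite !patchE; case: ifPn => //.
by rewrite inE; exact: fg.
Qed.

Lemma limn_einf_ge (R : realType) (u : nat -> \bar R) (a : \bar R) N :
  (forall n, (N <= n)%N -> (a <= u n)%E) -> (a <= limn_einf u)%E.
Proof.
move=> au; rewrite limn_einf_lim (cvg_lim _ (@cvg_einfs_sup R u))//.
apply: (@le_trans _ _ (einfs u N)); last by apply: ereal_sup_ubound; exists N.
by apply: le_ereal_inf_tmp => _ [n /= Nn <-]; exact: au.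
Qed.

Lemma limn_einf_le (R : realType) (u : nat -> \bar R) (a : \bar R) :
  (forall n, (u n <= a)%E) -> (limn_einf u <= a)%E.
Proof.
move=> ua; rewrite limn_einf_lim; apply: lime_le; first exact: is_cvg_einfs.
apply: nearW => n; apply: le_trans (ua n); apply: ereal_inf_lbound.
by exists n => /=.
Qed.

(** Stopping at a given cell and level happens for t in one interval, so integrating in t adds up
    interval lengths. *)
Lemma integral_steps (R : realType) (J : finType) (c a b : J -> R) :
  (forall j, 0 <= c j) -> (forall j, a j <= b j) ->
  measurable_fun setT (fun t : measurableTypeR R => (\sum_j c j * (a j <= t < b j)%R%:R)%:E) /\
  (\int[@lebesgue_measure R]_t (\sum_j c j * (a j <= t < b j)%R%:R)%:E =
    (\sum_j c j * (b j - a j))%:E)%E.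
Proof.
move=> c0 ab.
pose I j : set (measurableTypeR R) := `[a j, b j[%classic.
have mI j : measurable (I j) by exact: measurable_itv.
have mind j : measurable_fun setT (\1_(I j) : measurableTypeR R -> R).
  exact: (bm_indic (mI j)).1.
have E j (t : measurableTypeR R) : (a j <= t < b j)%R%:R = \1_(I j) t :> R.
  by rewrite indicE mem_setE in_itv.
pose f j (t : measurableTypeR R) : \bar R := (c j * \1_(I j) t)%:E.
have mf j : measurable_fun setT (f j).
  by apply/measurable_EFinP; apply: measurable_funM.
have f0 j t : setT t -> (0 <= f j t)%E by rewrite lee_fin mulr_ge0.
have EE : (fun t : measurableTypeR R => (\sum_j c j * (a j <= t < b j)%R%:R)%:E) =
    (fun t => (\sum_j f j t)%E).
  by apply/funext => t; rewrite sumEFin; congr EFin; apply: eq_bigr => j _; rewrite E.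
rewrite EE; split; first exact: emeasurable_sum.
rewrite (ge0_integral_sum _ measurableT mf f0) -sumEFin; apply: eq_bigr => j _.
have mi : measurable_fun (setT : set (measurableTypeR R))
    (fun t => (\1_(I j) t)%:E : \bar R).
  exact/measurable_EFinP.
have i0 (t : measurableTypeR R) : setT t -> (0 <= (\1_(I j) t)%:E :> \bar R)%E.
  by rewrite lee_fin.
have cj : (0 <= (c j)%:E)%E by rewrite lee_fin.
have := ge0_integralZl (@lebesgue_measure R) measurableT mi i0 cj.
rewrite /f => ->.
have -> : (\int[@lebesgue_measure R]_t (\1_(I j) t)%:E = (b j - a j)%:E)%E.
  rewrite integral_indic//.
  rewrite setIT [LHS](@lebesgue_measure_itv R `[a j, b j[)/= lte_fin.
  have [_|ba] := ltP (a j) (b j).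
    by rewrite EFinB.
  have -> : a j = b j by apply/le_anti; rewrite ab ba.
  by rewrite subrr.
by rewrite -EFinM.
Qed.

(** * From grid estimates to the Choquet integral *)

Unset Implicit Arguments.

Theorem proposition4p1 (R : realType) (d : nat) (alpha delta : R)
    (hd : (1 <= d)%N) (halpha : 0 < alpha) (hdelta : 0 < delta) :
  exists2 C : R, 0 < C &
    forall u : 'rV[R]_d -> R, sobolev alpha u ->
      (choquet (cap alpha) (local_maximal delta u) <=
       C%:E * sobolev_norm alpha u)%E.
Proof.
pose L := 2 * delta; have L0 : 0 < L by rewrite mulr_gt0.
pose q : R := 2 `^ alpha.
have q1 : 1 < q.
  have := @gt0_ltr_powR R alpha halpha 1 2; rewrite powR1; apply; rewrite ?nnegrE//.
  by rewrite ltr1n.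
have [C1 C10 HC1] := @sobolev_domin R d alpha L halpha L0.
have [C2 C20 HC2] := @stopping_cap R d alpha L halpha L0.
pose K3 : R := (3 ^ d)%:R ^+ 2 * (q / (q - 1)).
have K30 : 0 <= K3 by rewrite mulr_ge0 ?exprn_ge0// divr_ge0//; lra.
pose kap : R := kappa (R := R) (d := d).
have kap0 : 0 < kap by exact: kappa_gt0.
(* Factors: C2 from the capacity of stopping cells, 1 / kap from the comparison of balls with cells,
   K3 from the maximal function, C1 from the domination of |u|. *)
pose C0 := C2 * (kap^-1 * (K3 * C1)).
have C00 : 0 <= C0 by rewrite mulr_ge0// mulr_ge0 ?invr_ge0 ?(ltW kap0)// mulr_ge0.
exists (C0 + 1); first by rewrite ltr_wpDl.
move=> u su; pose N := fine (sobolev_norm alpha u).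
have normE : sobolev_norm alpha u = N%:E.
  by rewrite /N fineK// ge0_fin_numE ?sobolev_norm_ge0//; exact: su.2.
have N0 : 0 <= N by rewrite fine_ge0// sobolev_norm_ge0.
have iu : integ (lebesgue_rV R d) u := su.1.1.
(* With 2 n cells of side L per direction, the box is [-n L, n L)^d and exhausts the space as the
   mesh shrinks. *)
pose c0 n : 'I_d -> R := fun=> - (n%:R * L).
pose f n : grid d (2 * n) n -> R := fcell (c0 n) L (fun y => `|u y|).
have dm n : exists Lam : nat -> grid d (2 * n) n -> R, [/\ forall j x, 0 <= Lam j x,
    forall j x y, same_cell j x y -> Lam j x = Lam j y,
    forall j x, (j <= n)%N -> mean n (2 ^ d) (@near_cell d (2 * n) n) j (f n) x <=
      \sum_(i < n.+1) Lam i x &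
    \sum_(j < n.+1) q ^+ j * \sum_x Lam j x <= K3 * (C1 * N)].
  have D := HC1 u (2 * n)%N n (c0 n) su.
  have K3p : (0 < 3 ^ d)%N by rewrite expn_gt0.
  have [h hm [Lam [L1 L2 L3 L4]]] := @domin_maximal R (grid d (2 * n) n) n (2 ^ d) (@same_cell d (2 * n) n)
    (@same_cell_sym d (2 * n) n) (@card_same_cell d (2 * n) n) (expn_gt0 2 d)
    (@near_cell d (2 * n) n) (3 ^ d) K3p (@near_cell_sym d (2 * n) n) (@near_cell_le d (2 * n) n)
    (@near_same_cell d (2 * n) n) (@card_near_cell d (2 * n) n) q _ _ q1 D.
  exists Lam; split => //.
  by move=> j x jn; rewrite (le_trans (hm j x jn)).
pose Lam n := projT1 (cid (dm n)).
have HLam n := projT2 (cid (dm n)).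
have Lam0 n j x : 0 <= Lam n j x by have [h _ _ _] := HLam n; exact: h.
pose S n j x := \sum_(i < j) Lam n i x.
pose v n := msh L n ^+ d.
have v0 n : 0 < v n by rewrite exprn_gt0// msh_gt0.
(* The level t for averages over balls, translated to means of the unnormalised integrals [fcell]:
   hence the cell volume [v n]. *)
pose tau n t := t * kap * v n.
pose g n t := v n * \sum_(j < n.+1) q ^+ j *
   \sum_x ((S n j x <= tau n t) && (tau n t < S n j.+1 x))%:R.
have cap_g t : 0 <= t -> (cap alpha [set x | t%:E < local_maximal delta u x] <=
    limn_einf (fun n => (C2 * g n t)%:E))%E.
  move=> t0; apply: ge_ereal_sup => _ [K [cK Kw] <-].
  have nc : \forall n \near \oo, K `<=` [set p | exists2 z, in_cell (c0 n) L z p &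
      tau n t < S n n.+1 z].
    (* Each point of K has a neighbourhood captured by all sufficiently fine grids; compactness
       makes the rank uniform on K. *)
    apply: ((compact_near_coveringP K).1 cK nat \oo (fun n => [set p | exists2 z, in_cell (c0 n) L z p &
      tau n t < S n n.+1 z])) => x Kx.
    have [r r0 [M HM]] := @maximal_near_cells R d u delta t x iu hdelta t0 (Kw x Kx).
    have nr : \forall p \near x, forall a, `|(p : 'rV[R]_d) ord0 a - x ord0 a| < r.
      refine (@filter_forall _ 'I_d (fun a => [set p : 'rV[R]_d | `|p ord0 a - x ord0 a| < r]) (nbhs x) _ _) => a.
      have := @coord_continuous R 1 d ord0 a x.
      by move=> /cvgrPdist_lt/(_ r r0); apply: filterS => p; rewrite distrC.
    exists ([set p : 'rV[R]_d | forall a, `|p ord0 a - x ord0 a| < r], [set n | (M <= n)%N]).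
      by split => //=; exact: nbhs_infty_ge.
    move=> [p n] [/= px Mn]; have [i [lin [z zp tz]]] := HM n p Mn px.
    exists z => //; apply: (lt_le_trans tz).
    by have [_ _ h _] := HLam n; exact: h.
  have [n0 _ Hn0] := nc.
  (* The rank n0 depends on K but the lower limit does not, so the latter also bounds the supremum
     over K. *)
  apply: (@limn_einf_ge _ _ _ n0) => n nn0.
  have [_ Linv _ _] := HLam n.
  apply: (HC2 (2 * n)%N n (c0 n) (Lam n) (tau n t) K) => //.
    by apply: mulr_ge0; [apply: mulr_ge0 => //; exact: ltW|exact: ltW].
  by move=> p /(Hn0 n nn0).
have g_int n : measurable_fun (setT : set (measurableTypeR R)) (fun t => (C2 * g n t)%:E) /\
    (\int[@lebesgue_measure R]_t (C2 * g n t)%:E <= (C0 * N)%:E)%E.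
  have kv0 : 0 < kap * v n by rewrite mulr_gt0.
  pose J := ('I_n.+1 * grid d (2 * n) n)%type.
  (* Stopping at level j means that t lies between consecutive partial sums divided by kap * v n.
     The interval has length [Lam] / (kap * v n), and v n cancels the volume in the cost of the
     cell. *)
  pose c (j : J) := C2 * (v n * q ^+ j.1).
  pose a (j : J) := S n j.1 j.2 / (kap * v n).
  pose b (j : J) := S n j.1.+1 j.2 / (kap * v n).
  have q0 : 0 <= q by rewrite powR_ge0.
  have c_ge0 j : 0 <= c j.
    by apply: mulr_ge0 => //; apply: mulr_ge0; [exact: ltW|exact: exprn_ge0].
  have bE j : b j - a j = Lam n j.1 j.2 / (kap * v n).
    by rewrite /b /a -mulrBl /S big_ord_recr/= addrAC subrr add0r.
  have ab j : a j <= b j by rewrite -subr_ge0 bE; apply: divr_ge0; [exact: Lam0|exact: ltW].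
  have E : (fun t : measurableTypeR R => (C2 * g n t)%:E) =
      (fun t => (\sum_j c j * (a j <= t < b j)%R%:R)%:E).
    apply/funext => t; congr EFin.
    transitivity (\sum_(j < n.+1) \sum_x c (j, x) * (a (j, x) <= t < b (j, x))%R%:R); last first.
      by rewrite pair_bigA/=; apply: eq_bigr => -[].
    rewrite /g mulr_sumr mulr_sumr; apply: eq_bigr => j _.
    rewrite !mulr_sumr; apply: eq_bigr => x _.
    by rewrite /c /a /b/= ler_pdivrMr// ltr_pdivlMr// /tau !mulrA.
  have [mg Ig] := @integral_steps R J c a b c_ge0 ab.
  rewrite E; split => //; rewrite Ig lee_fin.
  have [_ _ _ Lc] := HLam n.
  apply: (@le_trans _ _ (C2 * (kap^-1 * \sum_(j < n.+1) q ^+ j * \sum_x Lam n j x))).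
    rewrite le_eqVlt; apply/orP; left; apply/eqP.
    transitivity (\sum_(j < n.+1) \sum_x c (j, x) * (b (j, x) - a (j, x))).
      by rewrite pair_bigA/=; apply: eq_bigr => -[].
    rewrite !mulr_sumr; apply: eq_bigr => j _; rewrite !mulr_sumr; apply: eq_bigr => x _.
    by rewrite bE /c/=; field; rewrite !gt_eqF.
  rewrite /C0 -[leRHS]mulrA ler_wpM2l// -[leRHS]mulrA ler_wpM2l ?invr_ge0 ?(ltW kap0)//.
  by rewrite -[leRHS]mulrA.
have g0 n t : 0 <= C2 * g n t.
  rewrite mulr_ge0// mulr_ge0 ?(ltW (v0 n))// sumr_ge0// => j _.
  by rewrite mulr_ge0 ?exprn_ge0 ?powR_ge0// sumr_ge0.
have cap0 w : (0 <= cap alpha (w : set 'rV[R]_d))%E.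
  apply: (@le_trans _ _ (compact_cap alpha (set0 : set 'rV[R]_d))).
    by apply: le_ereal_inf_tmp => _ [phi _ <-]; exact: sobolev_norm_ge0.
  apply: ereal_sup_ubound; exists set0 => //; split; first exact: compact0.
  exact: sub0set.
rewrite normE /choquet.
pose D : set (measurableTypeR R) := `]0%R, +oo[%classic.
have mD : measurable D by exact: measurable_itv.
(* Pointwise domination by the lower limit comes before Fatou's lemma, which is applied only to the
   measurable step functions [C2 * g n t]. *)
apply: (@le_trans _ _ (\int[@lebesgue_measure R]_(t in D) limn_einf (fun n => (C2 * g n t)%:E))%E).
  apply: ge0_le_integral_dominated => t; first by move=> _; exact: cap0.
  by rewrite /D/= in_itv/= andbT => t0; apply: cap_g; exact: ltW.
have mgD n : measurable_fun D (fun t => (C2 * g n t)%:E).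
  exact: (measurable_funS measurableT (@subsetT _ D) (g_int n).1).
apply: (le_trans (fatou (@lebesgue_measure R) mD mgD _)).
  by move=> n t _; rewrite lee_fin.
apply: (@le_trans _ _ (C0 * N)%:E); last first.
  by rewrite -EFinM lee_fin mulrDl lerDl mul1r.
apply: limn_einf_le => n; apply: le_trans (g_int n).2.
apply: ge0_subset_integral => //; first exact: (g_int n).1.
by move=> t _; rewrite lee_fin.
Qed.
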